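(* Let $L>0$, $\mathbb S^1_L=\mathbb R/L\mathbb Z$, $\mathbb S^1=\mathbb R/2\pi\mathbb Z$, $\mathcal S=\mathbb S^1_L\times\mathbb S^1$ with coordinates $(s,\theta)$, and let $\mathfrak f\in C^\infty(\mathbb S^1_L;\mathbb R)$ (viewed as a function of $s$ on $\mathcal S$) and $q=q(s)\in L^\infty(\mathcal S;\mathbb R)$. Let $\omega=I_\omega\times\mathbb S^1$ with $I_\omega\subset\mathbb S^1_L$ a nonempty open interval such that $\overline{I_\omega}\neq\mathbb S^1_L$. Then there is a constant $C>0$ such that for any $\delta\in(0,1)$ there exists a function $R_\delta\in C^\infty(\mathbb S^1_L;(0,\infty))$ such that, with $g_\delta=ds^2+R_\delta(s)^2d\theta^2$: 1. the vector field $\nabla_{g_\delta}\mathfrak f\cdot\nabla_{g_\delta}=\mathfrak f'(s)\partial_s$ does not depend on the metric $g_\delta$; the triple $(\mathcal S,\nabla_{g_\delta}\mathfrak f,\omega)$ satisfies (GCC) if and only if $\mathfrak f'\ne0$ on $\mathbb S^1_L\setminus I_\omega$, and in this case $$T_{GCC}(\mathcal S,\nabla_{g_\delta}\mathfrak f,I_\omega\times\mathbb S^1)=\Big|\int_{\mathbb S^1_L\setminus I_\omega}\frac{ds}{\mathfrak f'(s)}\Big|<+\infty;$$ 2. for the transport equation with viscosity given by the metric $g_\delta$, $$T_{unif}(I_\omega\times\mathbb S^1)\ge C\delta^{-1/2};$$ 3. $\delta^{1/2}(1-C\delta)\le\min_{\mathbb S^1_L}R_\delta\le\delta^{1/2}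$.
   Context: (GCC): $(\mathcal S,X,\omega)$ satisfies (GCC) if there is $T>0$ such that for all $x\in\mathcal S$ there is $t\in(0,T)$ with $\phi_{-t}(x)\in\omega$, where $(\phi_t)$ is the flow of $X$; $T_{GCC}(\mathcal S,X,\omega)$ is the infimum of such $T$. Transport equation with viscosity given by a metric $g$, for $\varepsilon>0$: $(\partial_t-\nabla_g\mathfrak f\cdot\nabla_g-q-\varepsilon\Delta_g)u=0$ in $(0,\infty)\times\mathcal S$, $u|_{t=0}=u_0\in L^2(\mathcal S)$, with $\cdot$ the inner product given by $g$. $T_{unif}(\omega)$ is the infimum of all $T>0$ for which there exist $K_0,\varepsilon_0>0$ such that for all $\varepsilon\in(0,\varepsilon_0)$, $\|u(T)\|^2_{L^2(\mathcal S)}\le K_0^2\int_0^T\int_\omega|u|^2\,d\mathrm{Vol}_g\,dt$ for all $u_0\in L^2(\mathcal S)$ ($\inf\emptyset=+\infty$). *)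

(* Defs.v *)
From HB Require Import structures.
From mathcomp Require Import all_boot all_order all_algebra.
From mathcomp Require Import all_classical all_reals all_analysis.

Set Implicit Arguments.
Unset Strict Implicit.
Unset Printing Implicit Defensive.

Import Order.TTheory GRing.Theory Num.Theory.
Import numFieldNormedType.Exports.

Local Open Scope classical_set_scope.
Local Open Scope ring_scope.

(* A function on the circle R/LZ is an L-periodic function on R, a subset of
   the circle is an L-periodic subset of R; likewise for the torus
   (R/LZ) x (R/2piZ) and the plane R * R with coordinates p = (s, theta).
   Integrals are taken over the fundamental domains [0, L[ and
   [0, L[ x [0, 2 pi[.  *)

Section Circle.
Variables (R : realType) (L : R).

Definition circle_dom : set R := `[0, L[%classic.

Definition smooth_circle (h : R -> R) : Prop :=
  periodic h L /\ forall (n : nat) (s : R), derivable (h^`(n))%classic s 1.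

Definition Linfty_circle (q : R -> R) : Prop :=
  [/\ periodic q L, measurable_fun setT q &
      exists M : R, {ae lebesgue_measure, forall s : R, `|q s| <= M}].

(* I is the L-periodic set whose projection to R/LZ is that of the open
   interval ]a, b[ of R. *)
Definition open_interval_circle (I : set R) : Prop :=
  exists a b : R,
    I = [set s | exists k : int, a < s + k%:~R * L /\ s + k%:~R * L < b].

End Circle.

Section Torus.
Variables (R : realType) (L : R).

Definition torus_dom : set (R * R) := `[0, L[ `*` `[0, 2 * pi[.

Definition periodic_torus (u : R * R -> R) : Prop :=
  periodic u (L, 0) /\ periodic u (0, 2 * pi).

Definition pderiv (i : 'I_2) (u : R * R -> R) (p : R * R) : R :=
  'D_(if i == 0 then (1, 0) else (0, 1)) u p.

Definition smooth_torus (u : R * R -> R) : Prop :=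
  periodic_torus u /\
  forall (l : seq 'I_2) (p : R * R), differentiable (foldr pderiv u l) p.

End Torus.

(* A metric is given by its matrix g_ij in the coordinates (s, theta), a vector
   field by its components on (d_s, d_theta). *)
Section Riemannian.
Variables (R : realType) (g : R * R -> 'M[R]_2).

Definition vol (p : R * R) : R := Num.sqrt (\det (g p)).

Definition inner (p : R * R) (v w : 'cV[R]_2) : R := (v^T *m g p *m w) 0 0.

Definition grad (u : R * R -> R) (p : R * R) : 'cV[R]_2 :=
  invmx (g p) *m \col_i pderiv i u p.

Definition divergence (X : R * R -> 'cV[R]_2) (p : R * R) : R :=
  (vol p)^-1 * \sum_(i < 2) pderiv i (fun z => vol z * X z i 0) p.

Definition laplacian (u : R * R -> R) : R * R -> R := divergence (grad u).

Definition int_vol (L : R) (A : set (R * R)) (h : R * R -> R) : \bar R :=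
  (\int[lebesgue_measure \x lebesgue_measure]_(p in torus_dom L `&` A)
     (h p * vol p)%:E)%E.

Definition L2_torus (L : R) (u : R * R -> R) : Prop :=
  [/\ periodic_torus L u, measurable_fun setT u &
      (int_vol L setT (fun p => u p ^+ 2)%R < +oo)%E].

End Riemannian.

(* The metric ds^2 + r(s)^2 dtheta^2. *)
Definition revolution_metric (R : realType) (r : R -> R) (p : R * R)
  : 'M[R]_2 :=
  \matrix_(i < 2, j < 2)
    if i == j then (if i == 0 then 1 else r p.1 ^+ 2) else 0.

(* [flow X t x y] means phi_t(x) = y, where phi is the flow of X. *)
Definition flow (R : realType) (X : R * R -> 'cV[R]_2) (t : R) (x y : R * R)
  : Prop :=
  exists c : R -> R * R,
    [/\ c 0 = x,
        forall tau : R,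
          is_derive tau 1 (fun r => (c r).1) (X (c tau) 0 0) /\
          is_derive tau 1 (fun r => (c r).2) (X (c tau) 1 0) &
        c t = y].

Definition gcc_time (R : realType) (X : R * R -> 'cV[R]_2)
    (omega : set (R * R)) (T : R) : Prop :=
  0 < T /\
  forall x : R * R, exists t : R,
    [/\ 0 < t, t < T & exists2 y, flow X (- t) x y & omega y].

Definition GCC (R : realType) (X : R * R -> 'cV[R]_2) (omega : set (R * R))
  : Prop := exists T : R, gcc_time X omega T.

Definition T_GCC (R : realType) (X : R * R -> 'cV[R]_2) (omega : set (R * R))
  : \bar R := ereal_inf [set T%:E | T in gcc_time X omega].

Section Transport.
Variables (R : realType) (L : R) (g : R * R -> 'M[R]_2).
Variables (f q : R * R -> R).

(* Formal adjoint, for the volume of g, of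
   grad f . grad + q + eps * laplacian. *)
Definition adjoint_generator (eps : R) (phi : R * R -> R) (p : R * R) : R :=
  eps * laplacian g phi p - divergence g (fun z => phi z *: grad g f z) p
  + q p * phi p.

(* u is the weak solution, in C([0, +oo); L^2), of
   (d_t - grad f . grad - q - eps * laplacian) u = 0 with u(0) = u0.
   Smooth functions are a core of the L^2-adjoint of the generator, so this is
   the semigroup solution, unique for each u0.  Functions are real valued: the
   equation has real coefficients, so the observability inequality with a given
   constant for real data is equivalent to the one for complex data. *)
Definition transport_solution (eps : R) (u0 : R * R -> R)
    (u : R -> R * R -> R) : Prop :=
  [/\ forall t : R, 0 <= t -> L2_torus g L (u t),
      forall t : R, 0 <= t ->
        int_vol g L setT (fun p => (u tau p - u t p) ^+ 2)
          @[tau --> within `[0, +oo[ (nbhs t)] --> 0%E,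
      int_vol g L setT (fun p => (u 0 p - u0 p) ^+ 2) = 0%E &
      forall (phi : R * R -> R) (t : R), smooth_torus L phi -> 0 <= t ->
        fine (int_vol g L setT (fun p => u t p * phi p)) =
        fine (int_vol g L setT (fun p => u0 p * phi p)) +
        \int[lebesgue_measure]_(tau in `[0, t])
          fine (int_vol g L setT
                  (fun p => u tau p * adjoint_generator eps phi p))].

Definition uniformly_observable (omega : set (R * R)) (T : R) : Prop :=
  0 < T /\
  exists K0 eps0 : R, [/\ 0 < K0, 0 < eps0 &
    forall eps : R, 0 < eps -> eps < eps0 ->
    forall (u0 : R * R -> R) (u : R -> R * R -> R),
      L2_torus g L u0 -> transport_solution eps u0 u ->
      (int_vol g L setT (fun p => u T p ^+ 2)%R <=
       (K0 ^+ 2)%:E *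
       \int[lebesgue_measure]_(t in `[0%R, T])
         int_vol g L omega (fun p => u t p ^+ 2)%R)%E].

Definition T_unif (omega : set (R * R)) : \bar R :=
  ereal_inf [set T%:E | T in uniformly_observable omega].

End Transport.

(* Main.v *)
Require Import Defs.
From HB Require Import structures.
From mathcomp Require Import all_boot all_order all_algebra.
From mathcomp Require Import all_classical all_reals all_analysis.
From mathcomp Require Import measurable_realfun lra ring.
Set Implicit Arguments.
Unset Strict Implicit.
Unset Printing Implicit Defensive.
Import Order.TTheory GRing.Theory Num.Theory.
Import numFieldNormedType.Exports.
Local Open Scope classical_set_scope.
Local Open Scope ring_scope.

(** With eps = 1 / beta, a separated solution e^(- lam t) V(s) cos(k theta) of the
    transport equation reduces to a periodic Sturm-Liouville problem whose potential
    contains eps k^2 / r^2.  Take k = kap beta with kap a large constant, and let r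
    be at least 4 near the middle s0 of the complement of I, but comparable to
    e = sqrt delta at distance at least l from s0.  The well at s0 gives an
    eigenvalue mu <= kap^2 beta^2 / 8, hence the decay rate
    lam = eps mu <= kap^2 beta / 8, whereas the barrier of height (kap beta / e)^2
    makes V smaller on I by a factor e^(- kap beta l / (8 e)) (Agmon).
    Letting beta tend to infinity, observability in time T forces
    2 kap^2 beta T / 8 to be at least of the order of kap beta l / e, that is
    T >= C / sqrt delta.

    The potential q is only measurable: the substitution V = e^(beta Theta) w with
    Theta'' = - (q - mean q) removes it.

    For (GCC), the control region does not depend on theta, so only the scalar flow
    of f' matters, and crossing the complement of I takes the time
    |int ds / f'|. *)

(** * Calculus on the line and the circle *)

(** The eigenvalue of the well is found by shooting. At [mu = 0] the trace of the monodromy matrix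
    over one period is at least 2. As long as the trace stays above 2, the solution vanishing at 0
    remains positive on []0, L]]; but for large beta it must change sign inside the well. Hence the
    trace equals 2 for some admissible [mu], and, the determinant being 1, a periodic solution
    exists. What must not depend on delta is kap. It is fixed by bounds on f', Theta, Theta' and f
    alone, large enough for three purposes: the potential is nonnegative, so that lam >= 0; well and
    barrier dominate all other terms of order beta^2; the Agmon gain, of exponent linear in beta,
    beats the weights e^(beta Theta) and e^E, whose exponents are linear in beta too. The profile,
    and so delta, enters elsewhere only through thresholds for beta and through factors of powers of
    beta, which lose against an exponential. The constant is C = l / (2 kap): for T < C / e, lam T
    is at most half the Agmon exponent, so the squared decay up to time T costs only half of the
    squared smallness on I. *)

Section RealCalculus.
Variable R : realType.
Implicit Types (f g F G : R -> R) (x y a b l : R).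

Lemma eq_ler x y : x = y -> x <= y. Proof. by move=> ->. Qed.

(** The non-strict bound, which is trivial at [y = x], is the form in which derivatives of limits
    and of integrals get checked. *)
Lemma is_derive_near f x l :
  is_derive x 1 f l <->
  forall e, 0 < e -> exists2 d, 0 < d &
    forall y, `|y - x| < d -> `|f y - f x - l * (y - x)| <= e * `|y - x|.
Proof.
split.
  move=> /is_derive1_caratheodory [g [fg cg gx]] e e0.
  have /cvgrPdist_lt/(_ _ e0) := cg.
  move=> /nbhs_ballP [d /= d0 hd].
  exists d => // y yx; have := hd y.
  rewrite /ball /= distrC => /(_ yx) ge.
  rewrite fg -gx -mulrBl normrM ler_wpM2r// distrC; exact: ltW.
move=> h; apply/is_derive1_caratheodory.
exists (fun z => if z == x then l else (f z - f x) / (z - x)); split.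
- move=> z; case: eqP => [->|/eqP]; first by rewrite !subrr mulr0.
  by rewrite -subr_eq0 => /divfK->.
- apply/cvgrPdist_le => e e0; have [d d0 hd] := h e e0.
  apply/nbhs_ballP; exists d => //= y; rewrite /ball/= => yx.
  rewrite eqxx; case: eqP => [_|/eqP yx0]; first by rewrite subrr normr0 ltW.
  have yx0' : y - x != 0 by rewrite subr_eq0.
  rewrite distrC -(ler_pM2r (_ : 0 < `|y - x|)) ?normr_gt0//.
  rewrite -normrM mulrBl divfK//; apply: hd; by rewrite distrC.
- by rewrite eqxx.
Qed.

Lemma is_derive_continuous f x l : is_derive x 1 f l -> {for x, continuous f}.
Proof.
by move=> [df _]; exact/differentiable_continuous/derivable1_diffP.
Qed.

(** Serves for increments of integrals of merely bounded functions, whose remainder is controlled by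
    a square. *)
Lemma is_derive_sq f x l : (exists2 K, 0 <= K &
    forall y, `|y - x| <= 1 -> `|f y - f x - l * (y - x)| <= K * (y - x) ^+ 2) ->
  is_derive x 1 f l.
Proof.
move=> [K K0 h]; apply/is_derive_near => e e0.
have K1 : 0 < K + 1 by rewrite ltr_wpDl.
exists (Num.min 1 (e / (K + 1))); first by rewrite lt_min ltr01 divr_gt0.
move=> y; rewrite lt_min => /andP[y1 y2].
apply: le_trans (h y (ltW y1)) _.
rewrite -real_normK ?num_real// expr2 mulrA ler_wpM2r//.
rewrite ltr_pdivlMr// in y2.
by apply: ltW; apply: le_lt_trans y2; rewrite mulrC ler_wpM2l// lerDl.
Qed.

(** This rule and the next ones act on explicit functions of [t]: a derivative is assembled as a
    proof term and its value corrected at the end by [is_derive1_eq]. *)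
Lemma is_derive1D f g x a b : is_derive x 1 f a -> is_derive x 1 g b ->
  is_derive x 1 (fun t => f t + g t) (a + b).
Proof. by move=> ? ?; apply: is_deriveD. Qed.

Lemma is_derive1N f x a : is_derive x 1 f a ->
  is_derive x 1 (fun t => - f t) (- a).
Proof. by move=> ?; apply: is_deriveN. Qed.

Lemma is_derive1B f g x a b : is_derive x 1 f a -> is_derive x 1 g b ->
  is_derive x 1 (fun t => f t - g t) (a - b).
Proof. by move=> ? ?; apply: is_deriveB. Qed.

Lemma is_derive1M f g x a b : is_derive x 1 f a -> is_derive x 1 g b ->
  is_derive x 1 (fun t => f t * g t) (a * g x + f x * b).
Proof.
move=> ? ?; apply: is_derive_eq; rewrite /GRing.scale /=; ring.
Qed.

Lemma is_derive1Z k f x a : is_derive x 1 f a ->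
  is_derive x 1 (fun t => k * f t) (k * a).
Proof. by move=> h; apply: is_deriveZ. Qed.

Lemma is_derive1cst k x : is_derive x 1 (fun=> k : R) 0.
Proof. exact: is_derive_cst. Qed.

Lemma is_derive1id x : is_derive x 1 (fun t : R => t) 1.
Proof. exact: is_derive_id. Qed.

Lemma is_derive1_compf (f g : R -> R) x a b :
  is_derive (g x) 1 f a -> is_derive x 1 g b ->
  is_derive x 1 (fun t => f (g t)) (a * b).
Proof. exact: is_derive1_comp. Qed.

Lemma is_derive1_expR f x a : is_derive x 1 f a ->
  is_derive x 1 (fun t => expR (f t)) (expR (f x) * a).
Proof. by move=> h; apply: is_derive1_compf. Qed.

Lemma is_derive1V f x a : f x != 0 -> is_derive x 1 f a ->
  is_derive x 1 (fun t => (f t)^-1) (- a / f x ^+ 2).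
Proof.
move=> fx h; have -> : - a / f x ^+ 2 = - (f x) ^- 2 *: a.
  by rewrite /GRing.scale /= mulNr mulrC mulNr.
exact: is_deriveV.
Qed.

Lemma is_derive1_eq f x a b : is_derive x 1 f a -> a = b -> is_derive x 1 f b.
Proof. by move=> ? <-. Qed.

Lemma is_derive1_ext f g x a : (forall t, f t = g t) -> is_derive x 1 f a ->
  is_derive x 1 g a.
Proof. by move=> /funext <-. Qed.

Lemma is_derive1_shift f x a c : is_derive (x + c) 1 f a ->
  is_derive x 1 (fun t => f (t + c)) a.
Proof.
move=> h; apply: (is_derive1_eq (is_derive1_compf (g := fun t => t + c) h
  (is_derive1D (is_derive1id _) (is_derive1cst _ _)))).
by rewrite addr0 mulr1.
Qed.

Lemma is_derive1_opp f x a : is_derive (- x) 1 f a ->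
  is_derive x 1 (fun t => f (- t)) (- a).
Proof.
move=> h; apply: (is_derive1_eq (is_derive1_compf (g := fun t => - t) h
  (is_derive1N (is_derive1id _)))).
by rewrite mulrN1.
Qed.

Lemma mean_value f df a b : a <= b ->
  (forall x, a <= x <= b -> is_derive x 1 f (df x)) ->
  exists2 c, a <= c <= b & f b - f a = df c * (b - a).
Proof.
move=> ab h; have [||c cab e] := @MVT_segment R f df a b ab.
- move=> x; rewrite in_itv/= => /andP[ax xb]; apply: h; by rewrite !ltW.
- apply: continuous_in_subspaceT => x; rewrite inE/= in_itv/= => xab.
  by apply: is_derive_continuous (h _ xab).
- by exists c => //; rewrite -in_itv.
Qed.

(** The intermediate point avoids both ends, so that [derive_gt0_lt] needs the sign of the
    derivative only inside the interval. *)
Lemma mean_value_in f df a b : a < b ->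
  (forall x, a <= x <= b -> is_derive x 1 f (df x)) ->
  exists2 c, a < c < b & f b - f a = df c * (b - a).
Proof.
move=> ab h; have [||c cab e] := @MVT R f df a b ab.
- move=> x; rewrite in_itv/= => /andP[ax xb]; apply: h; by rewrite !ltW.
- apply: continuous_in_subspaceT => x; rewrite inE/= in_itv/= => xab.
  by apply: is_derive_continuous (h _ xab).
- by exists c => //; rewrite -in_itv.
Qed.

Lemma derive_le f g df dg a b : a <= b ->
  (forall x, a <= x <= b -> is_derive x 1 f (df x)) ->
  (forall x, a <= x <= b -> is_derive x 1 g (dg x)) ->
  (forall x, a <= x <= b -> df x <= dg x) ->
  f b - f a <= g b - g a.
Proof.
move=> ab hf hg le.
have [x xab|c cab e] := mean_value (f := fun t => g t - f t)
    (df := fun t => dg t - df t) ab.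
  by apply: is_derive1B; [apply: hg|apply: hf].
rewrite -subr_ge0 [X in 0 <= X](_ : _ = g b - f b - (g a - f a)); last by ring.
by rewrite e mulr_ge0// subr_ge0// le.
Qed.

Lemma derive_ge0_le f df a b : a <= b ->
  (forall x, a <= x <= b -> is_derive x 1 f (df x)) ->
  (forall x, a <= x <= b -> 0 <= df x) -> f a <= f b.
Proof.
move=> ab h h0; have [c /h0 c0 e] := mean_value ab h.
by rewrite -subr_ge0 e mulr_ge0// subr_ge0.
Qed.

Lemma derive_gt0_lt f df a b : a < b ->
  (forall x, a <= x <= b -> is_derive x 1 f (df x)) ->
  (forall x, a < x < b -> 0 < df x) -> f a < f b.
Proof.
move=> ab h h0; have [c /h0 c0 e] := mean_value_in ab h.
by rewrite -subr_gt0 e mulr_gt0// subr_gt0.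
Qed.

Lemma derive_normr_le f df K a b :
  (forall x, Num.min a b <= x <= Num.max a b -> is_derive x 1 f (df x)) ->
  (forall x, Num.min a b <= x <= Num.max a b -> `|df x| <= K) ->
  `|f b - f a| <= K * `|b - a|.
Proof.
wlog ab : a b / a <= b.
  move=> H; case: (leP a b) => [ab|/ltW ba] hd hK.
    by apply: H => // x; rewrite (min_l ab) (max_r ab) => ?; [exact: hd|exact: hK].
  rewrite distrC [`|b - a|]distrC.
  by apply: H => // x; rewrite (min_l ba) (max_r ba) => ?; [exact: hd|exact: hK].
rewrite (min_l ab) (max_r ab) => hd hK.
have [c /hK c0 ->] := mean_value ab hd.
by rewrite normrM ler_wpM2r.
Qed.

Lemma derive_0_cst f : (forall x, is_derive x 1 f 0) -> forall x y, f x = f y.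
Proof. by move=> h x y; exact: is_derive_0_is_cst. Qed.

Lemma IVT_le f a b v : a <= b -> continuous f -> f a <= v -> v <= f b ->
  exists2 c, a <= c <= b & f c = v.
Proof.
move=> ab cf fa fb; have [||c] := @IVT R f a b v ab.
- exact: continuous_subspaceT.
- by rewrite (min_l (le_trans fa fb)) (max_r (le_trans fa fb)) fa fb.
- by rewrite in_itv/= => cab <-; exists c.
Qed.

Lemma IVT_ge f a b v : a <= b -> continuous f -> v <= f a -> f b <= v ->
  exists2 c, a <= c <= b & f c = v.
Proof.
move=> ab cf fa fb; have [||c] := @IVT R f a b v ab.
- exact: continuous_subspaceT.
- by rewrite (min_r (le_trans fb fa)) (max_l (le_trans fb fa)) fa fb.
- by rewrite in_itv/= => cab <-; exists c.
Qed.

Lemma max_segment f a b : a <= b -> continuous f ->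
  exists2 c, a <= c <= b & forall x, a <= x <= b -> f x <= f c.
Proof.
move=> ab cf; have [|c] := @EVT_max R f a b ab; first exact: continuous_subspaceT.
by rewrite in_itv/= => cab h; exists c => // x xab; apply: h; rewrite in_itv.
Qed.

Lemma min_segment f a b : a <= b -> continuous f ->
  exists2 c, a <= c <= b & forall x, a <= x <= b -> f c <= f x.
Proof.
move=> ab cf; have [|c] := @EVT_min R f a b ab; first exact: continuous_subspaceT.
by rewrite in_itv/= => cab h; exists c => // x xab; apply: h; rewrite in_itv.
Qed.

Lemma continuous1D f g : continuous f -> continuous g ->
  continuous (fun t => f t + g t).
Proof. by move=> cf cg x; exact: cvgD (cf x) (cg x). Qed.

Lemma continuous1B f g : continuous f -> continuous g ->
  continuous (fun t => f t - g t).
Proof. by move=> cf cg x; exact: cvgB (cf x) (cg x). Qed.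

Lemma continuous1M f g : continuous f -> continuous g ->
  continuous (fun t => f t * g t).
Proof. by move=> cf cg x; exact: cvgM (cf x) (cg x). Qed.

Lemma continuous1N f : continuous f -> continuous (fun t => - f t).
Proof. by move=> cf x; exact: cvgN (cf x). Qed.

Lemma continuous1cst k : continuous (fun _ : R => k : R).
Proof. by move=> x; exact: cvg_cst. Qed.

Lemma continuous1_comp f g : continuous f -> continuous g ->
  continuous (fun t => f (g t)).
Proof. by move=> cf cg x; apply: continuous_comp; [exact: cg|exact: cf]. Qed.

Lemma continuous1V f : (forall x, f x != 0) -> continuous f ->
  continuous (fun t => (f t)^-1).
Proof. by move=> f0 cf x; exact: cvgV (f0 x) (cf x). Qed.

Lemma continuous1_derive f df : (forall x, is_derive x 1 f (df x)) -> continuous f.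
Proof. by move=> h x; exact: is_derive_continuous (h x). Qed.

Lemma continuous_near f x e : {for x, continuous f} -> 0 < e ->
  exists2 d, 0 < d & forall y, `|y - x| < d -> `|f y - f x| < e.
Proof.
move=> /cvgrPdist_lt h e0; have := h _ e0.
move=> /nbhs_ballP [d /= d0 hd]; exists d => // y yx.
by rewrite distrC; apply: hd; rewrite /ball/= distrC.
Qed.

Lemma near_continuous f x :
  (forall e, 0 < e -> exists2 d, 0 < d & forall y, `|y - x| < d -> `|f y - f x| <= e) ->
  {for x, continuous f}.
Proof.
move=> h; apply/cvgrPdist_le => e /h[d d0 hd].
apply/nbhs_ballP; exists d => //= y; rewrite /ball/= => yx.
by rewrite distrC hd// distrC.
Qed.

(** * Periodic functions on the line *)

Section Periodic.
Variables (L : R) (L0 : 0 < L).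

Lemma periodic_int f : periodic f L -> forall (k : int) x, f (x + k%:~R * L) = f x.
Proof.
move=> pf; have nat (n : nat) x : f (x + n%:R * L) = f x.
  elim: n x => [|n IH] x; first by rewrite mul0r addr0.
  by rewrite -addn1 natrD mulrDl mul1r addrA pf IH.
case=> n x; first exact: nat.
by rewrite NegzE mulrNz mulNr -(nat n.+1 (x - _)) subrK.
Qed.

Lemma circle_representative x a : exists k : int, a <= x + k%:~R * L < a + L.
Proof.
exists (- Num.floor ((x - a) / L)).
have /andP[h1 h2] := mem_rg1_floor ((x - a) / L).
rewrite rmorphN/= mulNr; rewrite ler_pdivlMr// in h1.
rewrite ltr_pdivrMr// mulrDl mul1r in h2.
by apply/andP; split; lra.
Qed.

Lemma periodic_max f : periodic f L -> continuous f ->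
  exists c, forall x, f x <= f c.
Proof.
move=> pf cf; have [c _ h] := max_segment (ltW L0) cf; exists c => x.
have [k /andP[k1 k2]] := circle_representative x 0.
rewrite -(periodic_int pf k); apply: h; rewrite k1/= ltW//; lra.
Qed.

Lemma periodic_bounded f : periodic f L -> continuous f ->
  exists2 M, 0 <= M & forall x, `|f x| <= M.
Proof.
move=> pf cf; have [|x|c h] := @periodic_max (fun x => `|f x|).
- by move=> x; rewrite pf.
- by apply: cvg_norm; exact: cf.
- by exists `|f c|.
Qed.

End Periodic.
End RealCalculus.

(** * Signed integrals *)

Section SignedIntegral.
Variable R : realType.
Notation mu := (@lebesgue_measure R).
Implicit Types (f g h F chi dchi : R -> R) (x y z a b c s t K : R).

(** A class that contains the continuous functions and the bounded representative of [q], is stable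
    under sums, products and translations, and is integrable on every segment. *)
Definition loc_bounded_measurable f := measurable_fun setT f /\
  forall a b, exists K, forall t, a <= t <= b -> `|f t| <= K.

Notation lbm := loc_bounded_measurable.

Lemma lbm_integrable f a b : lbm f -> mu.-integrable `[a, b] (EFin \o f).
Proof.
move=> [mf bf]; apply: measurable_bounded_integrable => //.
- by rewrite /= lebesgue_measure_itv /=; case: ifP => // _; rewrite -EFinB ltry.
- exact: measurable_funTS.
- have [K hK] := bf a b; exists K; split; first exact: num_real.
  move=> M KM x /=; rewrite in_itv/= => xab.
  exact: le_trans (hK _ xab) (ltW KM).
Qed.

Lemma lbm_continuous f : continuous f -> lbm f.
Proof.
move=> cf; split; first exact: continuous_measurable_fun.
move=> a b; case: (leP a b) => [ab|ba].
  have [c _ h] := @max_segment R (fun x => `|f x|) a b ab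
    (fun x => cvg_norm (cf x)).
  by exists `|f c|.
by exists 0 => t /andP[at_ tb]; have := le_trans at_ tb; rewrite leNgt ba.
Qed.

Lemma lbmD f g : lbm f -> lbm g -> lbm (fun t => f t + g t).
Proof.
move=> [mf bf] [mg bg]; split; first exact: measurable_funD.
move=> a b; have [K hK] := bf a b; have [K' hK'] := bg a b.
by exists (K + K') => t tab; rewrite (le_trans (ler_normD _ _))// lerD ?hK ?hK'.
Qed.

Lemma lbmM f g : lbm f -> lbm g -> lbm (fun t => f t * g t).
Proof.
move=> [mf bf] [mg bg]; split; first exact: measurable_funM.
move=> a b; have [K hK] := bf a b; have [K' hK'] := bg a b.
by exists (K * K') => t tab; rewrite normrM ler_pM ?hK ?hK'.
Qed.

Lemma lbm_cst k : lbm (fun=> k : R).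
Proof. by apply: lbm_continuous => x; exact: cvg_cst. Qed.

Lemma lbmZ k f : lbm f -> lbm (fun t => k * f t).
Proof. by move=> ?; apply: lbmM => //; exact: lbm_cst. Qed.

Lemma lbmN f : lbm f -> lbm (fun t => - f t).
Proof.
by move=> /(lbmZ (-1)) h; rewrite (_ : (fun _ => _) = (fun t => -1 * f t))//;
   apply/funext => t; rewrite mulN1r.
Qed.

Lemma lbmB f g : lbm f -> lbm g -> lbm (fun t => f t - g t).
Proof. by move=> ? ?; apply: lbmD => //; exact: lbmN. Qed.

(** One of the two integrals is over an empty set, or both over a point; the Chasles relation then
    holds for any order of the bounds. *)
Definition sint f x y : R :=
  (\int[mu]_(t in `[x, y]) f t - \int[mu]_(t in `[y, x]) f t)%R.

Lemma sintxx f x : sint f x x = 0. Proof. exact: subrr. Qed.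

Lemma sintC f x y : sint f y x = - sint f x y.
Proof. by rewrite /sint opprB. Qed.

Lemma Rintegral_itv_empty f x y : y < x -> (\int[mu]_(t in `[x, y]) f t = 0)%R.
Proof. by move=> yx; rewrite set_itv_ge ?Rintegral_set0// bnd_simp -ltNge. Qed.

Lemma sint_le f x y : x <= y -> sint f x y = (\int[mu]_(t in `[x, y]) f t)%R.
Proof.
rewrite le_eqVlt /sint => /predU1P[->|xy].
  by rewrite subrr set_itv1 Rintegral_set1.
by rewrite [X in _ - X]Rintegral_itv_empty// subr0.
Qed.

Lemma sint_chasles f x y z : lbm f -> sint f x y + sint f y z = sint f x z.
Proof.
move=> lf; have base a b c : a <= b -> b <= c ->
    sint f a b + sint f b c = sint f a c.
  move=> ab bc; rewrite !sint_le//; last exact: le_trans bc.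
  have h := @Rintegral_itvB R f (BLeft a) (BRight c) b (lbm_integrable a c lf).
  rewrite !bnd_simp in h; have {}h := h ab bc.
  have -> : (\int[mu]_(t in `[b, c]) f t = \int[mu]_(t in `]b, c]) f t)%R.
    rewrite (@Rintegral_itv_obnd_cbnd R b (BRight c))//.
    apply: integrableS (lbm_integrable b c lf) => //.
    by apply: subset_itvr; rewrite bnd_simp.
  by rewrite -h addrC subrK.
have [xy|/ltW yx] := leP x y; have [yz|/ltW zy] := leP y z.
- exact: base.
- have [xz|/ltW zx] := leP x z.
    by rewrite -(base x z y)// (sintC _ y z); ring.
  by rewrite (sintC _ z x) (sintC _ z y) -(base z x y)//; ring.
- have [xz|/ltW zx] := leP x z.
    by rewrite (sintC _ y x) -(base y x z)//; ring.
  by rewrite (sintC _ y x) (sintC _ z x) -(base y z x)//; ring.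
- by rewrite (sintC _ y x) (sintC _ z y) (sintC _ z x) -(base z y x)//; ring.
Qed.

Lemma sintD f g x y : lbm f -> lbm g ->
  sint (fun t => f t + g t) x y = sint f x y + sint g x y.
Proof.
by move=> lf lg; rewrite /sint !RintegralD//; do ?exact: lbm_integrable; ring.
Qed.

Lemma sintZ k f x y : lbm f -> sint (fun t => k * f t) x y = k * sint f x y.
Proof.
by move=> lf; rewrite /sint !RintegralZl//; do ?exact: lbm_integrable; ring.
Qed.

Lemma sintN f x y : lbm f -> sint (fun t => - f t) x y = - sint f x y.
Proof.
move=> lf; rewrite -mulN1r -sintZ//; congr sint; apply/funext => t.
by rewrite mulN1r.
Qed.

Lemma sintB f g x y : lbm f -> lbm g ->
  sint (fun t => f t - g t) x y = sint f x y - sint g x y.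
Proof. by move=> lf lg; rewrite sintD ?sintN//; exact: lbmN. Qed.

Lemma sint_cst k x y : sint (fun=> k) x y = k * (y - x).
Proof.
have base a b : a <= b -> (\int[mu]_(t in `[a, b]) k)%R = k * (b - a).
  move=> ab; rewrite Rintegral_cst//= lebesgue_measure_itv/= lte_fin.
  by case: ltgtP ab => //= -> _; rewrite subrr.
by case: (leP x y) => [|/ltW] h; [|rewrite sintC]; rewrite sint_le// base//; ring.
Qed.

Lemma le_sint f g x y : lbm f -> lbm g -> x <= y ->
  (forall t, x <= t <= y -> f t <= g t) -> sint f x y <= sint g x y.
Proof.
move=> lf lg xy h; rewrite !sint_le//; apply: le_Rintegral; do ?exact: lbm_integrable.
  exact: measurable_itv.
by move=> t /=; rewrite in_itv/=; exact: h.
Qed.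

Lemma sint_normr_le f K x y : lbm f ->
  (forall t, Num.min x y <= t <= Num.max x y -> `|f t| <= K) ->
  `|sint f x y| <= K * `|y - x|.
Proof.
move=> lf; wlog xy : x y / x <= y.
  move=> H; case: (leP x y) => [xy|/ltW yx] h.
    by apply: H => // t; rewrite (min_l xy) (max_r xy); exact: h.
  rewrite sintC normrN (distrC y); apply: H => // t.
  by rewrite (min_l yx) (max_r yx); exact: h.
rewrite (min_l xy) (max_r xy) => h; rewrite (@ger0_norm _ (y - x)) ?subr_ge0//.
rewrite -(sint_cst K) ler_norml -sintN; last exact: lbm_cst.
apply/andP; split; apply: le_sint => //; do ?exact: lbm_cst;
  try (apply: lbmN; exact: lbm_cst); move=> t /h; rewrite ler_norml => /andP[]//.
Qed.

Lemma sint_ext f g x y : (forall t, f t = g t) -> sint f x y = sint g x y.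
Proof. by move=> /funext ->. Qed.

Lemma sint_derive f a x : continuous f -> is_derive x 1 (fun t => sint f a t) (f x).
Proof.
move=> cf; have lf := lbm_continuous cf; apply/is_derive_near => e e0.
have [d d0 hd] := continuous_near (cf x) e0; exists d => // y yx.
have -> : sint f a y - sint f a x = sint f x y.
  by rewrite -(sint_chasles a x y lf) addrC addKr.
rewrite -(sint_cst (f x)) -sintB//; last exact: lbm_cst.
apply: sint_normr_le; first by apply: lbmB => //; exact: lbm_cst.
move=> t txy; apply/ltW/hd; apply: le_lt_trans yx; move: txy.
case: (leP x y) => [xy|/ltW yx] /andP[h1 h2].
  by rewrite !ger0_norm ?subr_ge0// lerD2r.
by rewrite !ler0_norm ?subr_le0// lerN2 lerD2r.
Qed.

Lemma sint_FTC f F x y : continuous f -> (forall t, is_derive t 1 F (f t)) ->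
  sint f x y = F y - F x.
Proof.
move=> cf hF; have h t : is_derive t 1 (fun t => F t - sint f x t) 0.
  by apply: (is_derive1_eq (is_derive1B (hF t) (sint_derive x t cf))); rewrite subrr.
by have := derive_0_cst h y x; rewrite sintxx subr0 => <-; rewrite subKr.
Qed.

(** Both measures agree on half-open intervals, which characterizes Lebesgue measure. *)
Lemma lebesgue_measure_shift c (A : set R) : measurable A ->
  pushforward mu ((fun x => x + c) : _ -> measurableTypeR R) A = mu A.
Proof.
have mshift : @measurable_fun _ _ (measurableTypeR R) (measurableTypeR R)
    setT (fun x => x + c).
  by apply: measurable_funD.
move=> mA; apply/esym/lebesgue_measure_unique => //= _ [[a b]] _ <-.
rewrite /pushforward.
rewrite (_ : _ @^-1` _ = `]a - c, b - c]%classic).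
  rewrite !lebesgue_measure_itv/= !lte_fin ltrD2r.
  by case: ifP => // _; rewrite -!EFinD opprB addrA subrK.
by apply/seteqP; split => x /=; rewrite !in_itv/= ltrBlDr lerBrDr.
Qed.

Lemma lbm_shift f c : lbm f -> lbm (fun t => f (t + c)).
Proof.
move=> [mf bf]; split.
  apply: (measurableT_comp mf (g := fun t => t + c)).
  exact: measurable_funD.
move=> a b; have [K hK] := bf (a + c) (b + c); exists K => t /andP[ta tb].
by apply: hK; rewrite !lerD2r ta.
Qed.

Lemma sint_shift f c x y : lbm f ->
  sint (fun t => f (t + c)) x y = sint f (x + c) (y + c).
Proof.
move=> lf; wlog xy : x y / x <= y.
  move=> H; case: (leP x y) => [/H//|/ltW /H].
  by rewrite (sintC _ y x) (sintC _ (y + c)) => ->.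
rewrite !sint_le ?lerD2r// /Rintegral; congr fine.
have mshift : @measurable_fun _ _ (measurableTypeR R) (measurableTypeR R)
    setT (fun x => x + c).
  by apply: measurable_funD.
have pre : (fun t => t + c) @^-1` `[x + c, y + c] = `[x, y]%classic.
  by apply/seteqP; split => t /=; rewrite !in_itv/= !lerD2r.
rewrite -[in LHS]pre -(@integral_pushforward _ _ (measurableTypeR R)
  (measurableTypeR R) R _ mshift mu
  `[x + c, y + c]%classic (EFin \o f))//.
- by apply: eq_measure_integral => A mA _; exact: lebesgue_measure_shift.
- by apply/measurable_EFinP; case: lf.
- by rewrite pre; apply: lbm_integrable (lbm_shift c lf).
Qed.

Lemma sint_periodic f L x : lbm f -> periodic f L ->
  sint f x (x + L) = sint f 0 L.
Proof.
move=> lf pf; rewrite -(sint_chasles _ 0 _ lf) -(sint_chasles 0 L _ lf).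
have -> : sint f L (x + L) = sint f 0 x.
  rewrite -[X in sint f X](add0r L) -sint_shift//; exact: sint_ext.
by rewrite (sintC _ 0); ring.
Qed.

(* Both sides have the same increments up to O((y - x)^2), so no absolutely
   continuous product rule is needed. *)
Lemma sint_by_parts g chi dchi x y : lbm g -> continuous dchi ->
  (forall t, is_derive t 1 chi (dchi t)) ->
  sint (fun t => sint g 0 t * dchi t) x y =
  sint g 0 y * chi y - sint g 0 x * chi x - sint (fun t => g t * chi t) x y.
Proof.
move=> lg cdchi hchi.
have cchi : continuous chi by move=> t; exact: is_derive_continuous (hchi t).
have lchi := lbm_continuous cchi; have ldchi := lbm_continuous cdchi.
pose G t := sint g 0 t.
have Ginc a b : G b - G a = sint g a b.
  by rewrite /G -(sint_chasles 0 a b lg) addrC addKr.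
have chiinc a b : chi b - chi a = sint dchi a b by rewrite (sint_FTC _ _ cdchi hchi).
have bound f a : lbm f -> exists2 K, 0 <= K & forall t, `|t - a| <= 1 -> `|f t| <= K.
  move=> [_ bf]; have [K hK] := bf (a - 1) (a + 1); exists `|K| => // t.
  by rewrite ler_distl => /hK h; apply: le_trans h (ler_norm _).
have cG : continuous G.
  move=> a; apply: near_continuous => e e0; have [K K0 hK] := bound g a lg.
  have K1 : 0 < K + 1 by rewrite ltr_wpDl.
  exists (Num.min 1 (e / (K + 1))); first by rewrite lt_min ltr01 divr_gt0.
  move=> b; rewrite lt_min => /andP[ba1 ba2]; rewrite Ginc.
  apply: (@le_trans _ _ ((K + 1) * `|b - a|)).
    apply: sint_normr_le => // t tab; apply: (@le_trans _ _ K); last by rewrite lerDl.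
    apply: hK; apply: le_trans (ltW ba1); move: tab.
    case: (leP a b) => [ab|/ltW ba'] /andP[h1 h2].
      by rewrite !ger0_norm ?subr_ge0// lerD2r.
    by rewrite !ler0_norm ?subr_le0// lerN2 lerD2r.
  by rewrite mulrC -ler_pdivlMr// ltW.
have lG := lbm_continuous cG.
(* The defect of the formula, as a function of the upper bound [y], has zero derivative everywhere,
   although [G] itself need not be differentiable. *)
have h t : is_derive t 1 (fun y => sint (fun t => G t * dchi t) x y +
    sint (fun t => g t * chi t) x y - G y * chi y) 0.
  apply: is_derive_sq.
  have [K K0 hK] := bound g t lg; have [K' K'0 hK'] := bound dchi t ldchi.
  exists (K * K' + K' * K); first by rewrite addr_ge0// mulr_ge0.
  move=> b bt; rewrite mul0r subr0.
  have betw s : Num.min t b <= s <= Num.max t b -> `|s - t| <= `|b - t|.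
    case: (leP t b) => [ab|/ltW ba'] /andP[h1 h2].
      by rewrite !ger0_norm ?subr_ge0// lerD2r.
    by rewrite !ler0_norm ?subr_le0// lerN2 lerD2r.
  have betw2 s : Num.min t b <= s <= Num.max t b -> forall s', Num.min t s <= s' <= Num.max t s ->
    `|s' - t| <= 1.
    move=> hs s' hs'; apply: le_trans bt; apply: le_trans (betw _ hs); move: hs'.
    case: (leP t s) => [ab|/ltW ba'] /andP[h1 h2].
      by rewrite !ger0_norm ?subr_ge0// lerD2r.
    by rewrite !ler0_norm ?subr_le0// lerN2 lerD2r.
  have betw3 s : Num.min t b <= s <= Num.max t b -> forall s', Num.min s b <= s' <= Num.max s b ->
    `|s' - t| <= 1.
    move=> hs s' hs'; apply: le_trans bt; move: hs hs'.
    case: (leP t b) => [ab|/ltW ba'] /andP[h1 h2]; rewrite ?(min_l h2) ?(max_r h2) ?(min_r h1) ?(max_l h1).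
      move=> /andP[h3 h4]; rewrite !ger0_norm ?subr_ge0// ?lerD2r//; exact: le_trans h3.
    move=> /andP[h3 h4]; rewrite !ler0_norm ?subr_le0// ?lerN2 ?lerD2r//; exact: le_trans h2.
  (* Splitting [G b * chi b - G t * chi t] as [G t * (chi b - chi t) + chi b * (G b - G t)] turns
     the increment into a single integral whose integrand is O(|b - t|). *)
  have -> : sint (fun s => G s * dchi s) x b + sint (fun s => g s * chi s) x b - G b * chi b -
      (sint (fun s => G s * dchi s) x t + sint (fun s => g s * chi s) x t - G t * chi t) =
      sint (fun s => (G s - G t) * dchi s + g s * (chi s - chi b)) t b.
    rewrite -(sint_chasles x t b (lbmM lG ldchi)) -(sint_chasles x t b (lbmM lg lchi)).
    rewrite [RHS](sint_ext (g := fun s => (G s * dchi s + g s * chi s) - (G t * dchi s + chi b * g s))); last by move=> s; ring.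
    rewrite sintB; last 2 first.
    - by apply: lbmD; apply: lbmM.
    - by apply: lbmD; apply: lbmZ.
    rewrite !sintD ?sintZ//; do ?[by apply: lbmM | by apply: lbmZ].
    rewrite -chiinc -Ginc; ring.
  apply: (@le_trans _ _ ((K * K' + K' * K) * `|b - t| * `|b - t|)); last first.
    by rewrite -mulrA -expr2 real_normK// num_real.
  apply: sint_normr_le.
    apply: lbmD; apply: lbmM => //; apply: lbmB => //; exact: lbm_cst.
  move=> s hs; rewrite (le_trans (ler_normD _ _))// !normrM mulrDl lerD//.
    rewrite [leRHS]mulrAC; apply: ler_pM => //.
      rewrite Ginc (le_trans (sint_normr_le (K := K) lg _)) ?ler_wpM2l ?betw//.
      by move=> s' hs'; apply: hK (betw2 _ hs _ hs').
    by apply: hK' (le_trans (betw _ hs) bt).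
  rewrite [leRHS]mulrAC [leRHS]mulrC; apply: ler_pM => //.
    by apply: hK (le_trans (betw _ hs) bt).
  rewrite chiinc sintC normrN.
  rewrite (le_trans (sint_normr_le (K := K') ldchi _))//.
    by move=> s' hs'; exact: hK' (betw3 _ hs _ hs').
  rewrite ler_wpM2l//.
  move: hs; case: (leP t b) => [ab|/ltW ba'] /andP[h1 h2].
    by rewrite !ger0_norm ?subr_ge0// lerD2l lerN2.
  by rewrite !ler0_norm ?subr_le0// lerN2 lerD2l lerN2.
have := derive_0_cst h y x; rewrite !sintxx /G => e; move: e; lra.
Qed.

End SignedIntegral.
Notation lbm := loc_bounded_measurable.

(** * Ordinary differential equations *)

Section Picard.
Variable R : realType.
Implicit Types (a b c e s t x y T K M : R) (m n : nat).

Lemma exp2_small a e : 0 < e -> exists n, a / 2 ^+ n < e.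
Proof.
move=> e0; have [n hn] : exists n, `|a| / e < n%:R.
  by exists (Num.truncn (`|a| / e)).+1; exact: truncnS_gt.
exists n; have h1 : a / e < n%:R.
  by apply: le_lt_trans hn; rewrite ler_pM2r ?invr_gt0// ler_norm.
have h2 : n%:R < 2 ^+ n :> R by rewrite -natrX ltr_nat ltn_expl.
rewrite ltr_pdivrMr ?exprn_gt0// mulrC -ltr_pdivrMr//; exact: lt_trans h2.
Qed.

Lemma le_of_exp2 a b c : (forall n, a <= b + c / 2 ^+ n) -> a <= b.
Proof.
move=> h; apply/ler_addgt0Pr => e /(exp2_small c)[n hn].
by apply: le_trans (h n) _; rewrite lerD2l ltW.
Qed.

(** The geometric increments telescope, so every [u n - 2 * c / 2 ^+ n] lies below every
    [u m + 2 * c / 2 ^+ m]; the limit is the supremum of the former. *)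
Lemma exp2_limit (u : nat -> R) c : (forall n, `|u n.+1 - u n| <= c / 2 ^+ n) ->
  exists l, forall n, `|u n - l| <= 2 * c / 2 ^+ n.
Proof.
move=> h.
have step n m : `|u (n + m)%N - u n| <= 2 * c / 2 ^+ n - 2 * c / 2 ^+ (n + m).
  elim: m => [|m IH]; first by rewrite addn0 !subrr normr0.
  rewrite addnS -(subrK (u (n + m)%N) (u (n + m).+1)) -addrA.
  apply: le_trans (ler_normD _ _) _; apply: le_trans (lerD (h _) IH) _.
  have -> : 2 * c / 2 ^+ (n + m).+1 = c / 2 ^+ (n + m) :> R.
    rewrite exprS; field; by rewrite expf_neq0.
  by rewrite -!mulrA; set z := c / 2 ^+ (n + m); set w := c / _; lra.
have c0 : 0 <= c by have := le_trans (normr_ge0 _) (h 0%N); rewrite expr0 divr1.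
have p0 n : 0 <= 2 * c / 2 ^+ n by rewrite divr_ge0 ?mulr_ge0// exprn_ge0.
pose S := [set u n - 2 * c / 2 ^+ n | n in [set: nat]].
have ub n : ubound S (u n + 2 * c / 2 ^+ n).
  move=> _ [m _ <-]; have := p0 n; have := p0 m; case: (leqP n m) => nm.
    have := step n (m - n)%N; rewrite subnKC// ler_norml => /andP[_ h2]; lra.
  have := step m (n - m)%N; rewrite subnKC ?(ltnW nm)// ler_norml => /andP[h2 _]; lra.
have S0 : S !=set0 by exists (u 0%N - 2 * c / 2 ^+ 0), 0%N.
exists (sup S) => n; rewrite ler_distlC; apply/andP; split.
  by apply: ub_le_sup; [exists (u 0%N + 2 * c / 2 ^+ 0); exact: ub|exists n].
by apply: ge_sup => //; exact: ub.
Qed.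

(** The mean value theorem bounds the increments of [fn m - fn n] linearly in [y - x], uniformly in
    [m]. Letting [m] go to infinity transfers the bound to [f - fn n], and the expansion of a single
    [fn n] concludes. *)
Lemma limit_derive (fn gn : nat -> R -> R) (f g A : R -> R) :
  (forall n t, is_derive t 1 (fn n) (gn n t)) ->
  (forall T n t, `|t| <= T -> `|fn n t - f t| <= A T / 2 ^+ n) ->
  (forall T n t, `|t| <= T -> `|gn n t - g t| <= A T / 2 ^+ n) ->
  forall t, is_derive t 1 f (g t).
Proof.
move=> hd hf hg x; apply/is_derive_near => e e0.
pose T := `|x| + 1; have xT : `|x| <= T by rewrite lerDl.
have e40 : 0 < e / 4 by rewrite divr_gt0.
have [n hn] := exp2_small (A T) e40.
have [d d0 hy] := (is_derive_near _ _ _).1 (hd n x) _ e40.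
exists (Num.min 1 d); first by rewrite lt_min ltr01.
move=> y; rewrite lt_min => /andP[y1 yd].
have yT : `|y| <= T.
  by rewrite -(subrK x y) addrC (le_trans (ler_normD _ _))// lerD2l ltW.
have betw t : Num.min x y <= t <= Num.max x y -> `|t| <= T.
  move: xT yT; rewrite !ler_norml; case: (leP x y) => _ /andP[x1 x2] /andP[y3 y4] /andP[t1 t2];
  apply/andP; split; lra.
have tail : `|(f y - fn n y) - (f x - fn n x)| <= A T / 2 ^+ n * `|y - x|.
  apply: (@le_of_exp2 _ _ (A T * `|y - x| + 2 * A T)) => m.
  have h1 : `|(fn m y - fn n y) - (fn m x - fn n x)| <=
      (A T / 2 ^+ m + A T / 2 ^+ n) * `|y - x|.
    apply: (derive_normr_le (fun t _ => is_derive1B (hd m t) (hd n t))) => t txy.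
    have := hg T m t (betw _ txy); have := hg T n t (betw _ txy).
    by rewrite !ler_distl => /andP[? ?] /andP[? ?]; apply/andP; split; lra.
  have h2 := hf T m y yT; have h3 := hf T m x xT.
  have -> : f y - fn n y - (f x - fn n x) =
    (fn m y - fn n y - (fn m x - fn n x)) - (fn m y - f y) + (fn m x - f x) by ring.
  apply: le_trans (ler_normD _ _) _; apply: le_trans (lerD (ler_normB _ _) h3) _.
  apply: le_trans (lerD (lerD h1 h2) (lexx _)) _.
  by apply: eq_ler; ring.
have -> : f y - f x - g x * (y - x) = ((f y - fn n y) - (f x - fn n x)) +
   (fn n y - fn n x - gn n x * (y - x)) + (gn n x - g x) * (y - x) by ring.
apply: le_trans (ler_normD _ _) _; apply: le_trans (lerD (ler_normD _ _) (lexx _)) _.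
apply: le_trans (lerD (lerD tail (hy y yd)) (lexx _)) _.
rewrite normrM -!mulrDl ler_wpM2r//.
have := hg T n x xT; lra.
Qed.

(** The Bielecki weight: integrating against [expR (c * |t|)] gains a factor [1 / c], so that Picard
    iteration contracts on the whole line at once. *)
Lemma sint_exp_le (f : R -> R) A c t : lbm f ->
  (forall s, `|f s| <= A * c * expR (c * `|s|)) ->
  `|sint f 0 t| <= A * expR (c * `|t|) - A.
Proof.
have dE (b t' : R) : is_derive (t' : R) 1 (fun s => A * expR (b * s)) (A * b * expR (b * t')).
  apply: (is_derive1_eq
    (is_derive1Z A (is_derive1_expR (is_derive1Z b (is_derive1id _))))).
  by rewrite mulr1; ring.
have cE (b : R) : continuous (fun s => A * b * expR (b * s)).
  move=> t'; exact: (is_derive_continuous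
    (is_derive1Z (A * b) (is_derive1_expR (is_derive1Z b (is_derive1id t'))))).
have pos (h : R -> R) s : lbm h -> 0 <= s ->
    (forall s, `|h s| <= A * c * expR (c * `|s|)) ->
    sint h 0 s <= A * expR (c * s) - A.
  move=> lh s0 hh.
  have := sint_FTC 0 s (cE c) (dE c); rewrite mulr0 expR0 mulr1 => <-.
  apply: le_sint => //; first exact: lbm_continuous.
  move=> t' /andP[t0 _]; apply: le_trans (ler_norm _) _.
  by rewrite -{2}(ger0_norm t0) hh.
have neg (h : R -> R) s : lbm h -> s <= 0 ->
    (forall s, `|h s| <= A * c * expR (c * `|s|)) ->
    sint h 0 s <= A * expR (c * - s) - A.
  move=> lh s0 hh; rewrite sintC -sintN//.
  have := sint_FTC s 0 (fun x => continuousN (cE (- c) x)) (fun t => is_derive1N (dE (- c) t)).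
  rewrite mulr0 expR0 mulr1 mulNr -mulrN => e.
  have -> : A * expR (c * - s) - A = - A - - (A * expR (c * - s)) by ring.
  rewrite -e; apply: le_sint => //; first exact: lbmN.
    by apply: lbm_continuous => x; exact: (continuousN (cE (- c) x)).
  move=> t' /andP[_ t0]; apply: le_trans (ler_norm _) _.
  by rewrite normrN (le_trans (hh t'))// (ler0_norm t0) !(mulrN, mulNr, opprK).
move=> lf hf; have nf s : `|- f s| <= A * c * expR (c * `|s|) by rewrite normrN.
have [t0|/ltW t0] := leP 0 t.
  rewrite (ger0_norm t0) ler_norml lerNl -sintN//.
  by rewrite !pos//; exact: lbmN.
rewrite (ler0_norm t0) ler_norml lerNl -sintN//.
by rewrite !neg//; exact: lbmN.
Qed.

Section PicardTheorem.
Variables (G1 G2 : R -> R -> R -> R) (K M x0 z0 : R).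
Hypothesis K0 : 0 < K.
Hypothesis cG1 : forall v z : R -> R, continuous v -> continuous z ->
  continuous (fun t => G1 t (v t) (z t)).
Hypothesis cG2 : forall v z : R -> R, continuous v -> continuous z ->
  continuous (fun t => G2 t (v t) (z t)).
Hypothesis G1lip : forall t v z v' z',
  `|G1 t v z - G1 t v' z'| <= K * (`|v - v'| + `|z - z'|).
Hypothesis G2lip : forall t v z v' z',
  `|G2 t v z - G2 t v' z'| <= K * (`|v - v'| + `|z - z'|).
Hypothesis G1M : forall t, `|G1 t x0 z0| <= M.
Hypothesis G2M : forall t, `|G2 t x0 z0| <= M.

Fixpoint picard_iter n : (R -> R) * (R -> R) :=
  if n is n'.+1 then
    let X := picard_iter n' in
    (fun t => x0 + sint (fun s => G1 s (X.1 s) (X.2 s)) 0 t,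
     fun t => z0 + sint (fun s => G2 s (X.1 s) (X.2 s)) 0 t)
  else (fun=> x0, fun=> z0).

Let X n := (picard_iter n).1.
Let Z n := (picard_iter n).2.

Lemma picard_iter_continuous n : continuous (X n) /\ continuous (Z n).
Proof.
elim: n => [|n [IH1 IH2]]; first by split=> t; exact: cvg_cst.
have h (G : R -> R) k : continuous G -> continuous (fun t => k + sint G 0 t).
  move=> cG t; apply: is_derive_continuous.
  exact: is_derive1D (is_derive1cst _ _) (sint_derive 0 t cG).
by split; apply: h; [exact: cG1|exact: cG2].
Qed.

(** With the weight of rate [4 * K], integration divides by [4 * K] while the Lipschitz bound on two
    components costs [2 * K]: the ratio is exactly one half. *)
Lemma picard_iter_bound n t :
  `|X n.+1 t - X n t| <= M / (4 * K) / 2 ^+ n * expR (4 * K * `|t|) /\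
  `|Z n.+1 t - Z n t| <= M / (4 * K) / 2 ^+ n * expR (4 * K * `|t|).
Proof.
have M0 : 0 <= M by apply: le_trans (G1M 0).
have K4 : 0 < 4 * K by rewrite mulr_gt0.
have A0 m : 0 <= M / (4 * K) / 2 ^+ m.
  by rewrite !divr_ge0// ?exprn_ge0// ltW.
elim: n t => [|n IH] t.
  have h (G : R -> R) k : continuous G -> (forall t, `|G t| <= M) ->
      `|k + sint G 0 t - k| <= M / (4 * K) / 2 ^+ 0 * expR (4 * K * `|t|).
    move=> cG GM; rewrite addrC addKr expr0 divr1.
    have := @sint_exp_le G (M / (4 * K)) (4 * K) t (lbm_continuous cG).
    rewrite divfK ?gt_eqF// => hh.
    apply: (le_trans (hh _)) => [s|]; last by rewrite gerBl divr_ge0// ltW.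
    rewrite (le_trans (GM _))// ler_peMr// -[leLHS]expR0 ler_expR.
    exact: mulr_ge0 (ltW K4) (normr_ge0 _).
  have [c1 c2] := picard_iter_continuous 0.
  by split; apply: h => //; [exact: cG1|exact: cG2].
have [c1 c2] := picard_iter_continuous n.
have [c3 c4] := picard_iter_continuous n.+1.
have h (G G' : R -> R) k : continuous G -> continuous G' ->
    (forall t, `|G t - G' t| <= K * (`|X n.+1 t - X n t| + `|Z n.+1 t - Z n t|)) ->
    `|k + sint G 0 t - (k + sint G' 0 t)| <=
      M / (4 * K) / 2 ^+ n.+1 * expR (4 * K * `|t|).
  move=> cG cG' GG.
  have -> : k + sint G 0 t - (k + sint G' 0 t) = sint (fun s => G s - G' s) 0 t.
    by rewrite sintB; [ring|exact: lbm_continuous|exact: lbm_continuous].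
  apply: (@le_trans _ _ (M / (4 * K) / 2 ^+ n.+1 * expR (4 * K * `|t|) -
      M / (4 * K) / 2 ^+ n.+1)); last by rewrite gerBl.
  apply: sint_exp_le => [|s].
    by apply: lbmB; exact: lbm_continuous.
  apply: le_trans (GG s) _; have [h1 h2] := IH s.
  apply: (le_trans (ler_wpM2l (ltW K0) (lerD h1 h2))).
  rewrite exprS (invfM 2).
  by move: (2 ^+ n)^-1 (M / (4 * K)) (expR _) => a b e; lra.
by split; apply: h => // *; do ?[exact: cG1|exact: cG2|exact: G1lip|exact: G2lip].
Qed.

Theorem picard : exists v z : R -> R, [/\ v 0 = x0, z 0 = z0,
  forall t : R, is_derive t 1 v (G1 t (v t) (z t)) &
  forall t : R, is_derive t 1 z (G2 t (v t) (z t))].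
Proof.
have M0 : 0 <= M by apply: le_trans (G1M 0).
pose C t := M / (4 * K) * expR (4 * K * `|t|).
have hX t n : `|X n.+1 t - X n t| <= C t / 2 ^+ n.
  by rewrite /C mulrAC; have [] := picard_iter_bound n t.
have hZ t n : `|Z n.+1 t - Z n t| <= C t / 2 ^+ n.
  by rewrite /C mulrAC; have [] := picard_iter_bound n t.
have [v hv] := choice (fun t => exp2_limit (hX t)).
have [z hz] := choice (fun t => exp2_limit (hZ t)).
have C0 t : 0 <= C t.
  by rewrite mulr_ge0 ?expR_ge0// divr_ge0// mulr_ge0// ltW.
have Cle T t : `|t| <= T -> C t <= C T.
  move=> tT; rewrite ler_wpM2l ?divr_ge0 ?mulr_ge0 ?(ltW K0)// ler_expR.
  by rewrite ler_wpM2l ?mulr_ge0 ?(ltW K0)// (le_trans tT)// ler_norm.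
have cle T n t : `|t| <= T -> 2 * C t / 2 ^+ n <= 2 * C T / 2 ^+ n.
  by move=> tT; rewrite ler_pM2r ?invr_gt0 ?exprn_gt0// ler_pM2l// Cle.
have at0 (u : nat -> R) (l k : R) : (forall n, u n = k) ->
    (forall n, `|u n - l| <= 2 * C 0 / 2 ^+ n) -> l = k.
  move=> uk h; apply/eqP; rewrite -subr_eq0 -normr_eq0 eq_le normr_ge0 andbT.
  apply: (@le_of_exp2 _ _ (2 * C 0)) => n.
  by rewrite add0r -(uk n) distrC; exact: h.
have X0 n : X n 0 = x0 by case: n => //= n; rewrite /X/= sintxx addr0.
have Z0 n : Z n 0 = z0 by case: n => //= n; rewrite /Z/= sintxx addr0.
have lim (Y : nat -> R -> R) (G : R -> R -> R -> R) (y : R -> R) (k : R) :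
   (forall v z : R -> R, continuous v -> continuous z ->
     continuous (fun t => G t (v t) (z t))) ->
   (forall t v z v' z', `|G t v z - G t v' z'| <= K * (`|v - v'| + `|z - z'|)) ->
   (forall n, Y n.+1 = fun t => k + sint (fun s => G s (X n s) (Z n s)) 0 t) ->
   (forall t n, `|Y n t - y t| <= 2 * C t / 2 ^+ n) ->
   forall t, is_derive t 1 y (G t (v t) (z t)).
  move=> cG Glip YE hY.
  (* The derivative of iterate [n.+1] is the field evaluated at iterate [n], hence the shift of
     index; the constant covers both error bounds. *)
  apply: (@limit_derive (fun n => Y n.+1) (fun n t => G t (X n t) (Z n t)) _ _
    (fun T => 2 * C T + 4 * K * C T)).
  - move=> n t; rewrite YE; apply: (is_derive1_eq (is_derive1D (is_derive1cst _ _)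
      (sint_derive 0 t _))); last by rewrite add0r.
    by have [c1 c2] := picard_iter_continuous n; exact: cG.
  - move=> T n t tT; apply: le_trans (hY t n.+1) _.
    apply: le_trans (cle T _ _ tT) _; rewrite exprS invfM.
    have h0 : 0 <= C T / 2 ^+ n by rewrite divr_ge0// exprn_ge0.
    have h1 : 0 <= K * (C T / 2 ^+ n) by rewrite mulr_ge0// ltW.
    by move: (C T) (2 ^+ n)^-1 h0 h1 => u i; lra.
  - move=> T n t tT; apply: le_trans (Glip _ _ _ _ _) _.
    apply: le_trans (ler_wpM2l (ltW K0) (lerD (hv t n) (hz t n))) _.
    apply: le_trans (ler_wpM2l (ltW K0) (lerD (cle T n t tT) (cle T n t tT))) _.
    have h0 : 0 <= C T / 2 ^+ n by rewrite divr_ge0// exprn_ge0.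
    by move: (C T) (2 ^+ n)^-1 h0 => u i; lra.
exists v, z; split.
- exact: (at0 (fun n => X n 0)).
- exact: (at0 (fun n => Z n 0)).
- exact: (lim X G1 v x0).
- exact: (lim Z G2 z z0).
Qed.

End PicardTheorem.

(* E = p^2 + q^2 satisfies E' <= (4 K + 1) E + 2 eta^2. *)
Lemma gronwall (p q dp dq : R -> R) K eta T : 0 <= K -> 0 <= eta ->
  (forall t, 0 <= t <= T -> is_derive t 1 p (dp t)) ->
  (forall t, 0 <= t <= T -> is_derive t 1 q (dq t)) ->
  (forall t, 0 <= t <= T -> `|dp t| <= K * (`|p t| + `|q t|) + eta) ->
  (forall t, 0 <= t <= T -> `|dq t| <= K * (`|p t| + `|q t|) + eta) ->
  p 0 = 0 -> q 0 = 0 ->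
  forall t, 0 <= t <= T ->
    p t ^+ 2 + q t ^+ 2 <= 2 * eta ^+ 2 * expR ((4 * K + 1) * T).
Proof.
move=> K0 eta0 hp hq dpb dqb p0 q0 t /andP[t0 tT].
(* Adding [2 * eta ^+ 2] absorbs the source term, so that the weighted energy is nonincreasing. *)
pose E s := (p s * p s + q s * q s + 2 * eta ^+ 2) * expR (- (4 * K + 1) * s).
pose dE s := - (((4 * K + 1) * (p s * p s + q s * q s + 2 * eta ^+ 2) -
  (2 * p s * dp s + 2 * q s * dq s)) * expR (- (4 * K + 1) * s)).
have hE s : 0 <= s <= T -> is_derive s 1 E (dE s).
  move=> sT; apply: (is_derive1_eq (is_derive1M (is_derive1D (is_derive1D
    (is_derive1M (hp _ sT) (hp _ sT)) (is_derive1M (hq _ sT) (hq _ sT)))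
    (is_derive1cst (2 * eta ^+ 2) s))
    (is_derive1_expR (is_derive1Z (- (4 * K + 1)) (is_derive1id s))))).
  by rewrite /dE; ring.
have : - E 0 <= - E t.
  apply: (derive_ge0_le (f := fun s => - E s) (df := fun s => - dE s) t0).
    move=> s /andP[s0 st]; apply/is_derive1N/hE; by rewrite s0 (le_trans st).
  move=> s /andP[s0 st]; have sT : 0 <= s <= T by rewrite s0 (le_trans st).
  rewrite opprK mulr_ge0 ?expR_ge0// subr_ge0.
  have b1 := dpb _ sT; have b2 := dqb _ sT.
  have c1 : p s * dp s <= `|p s| * (K * (`|p s| + `|q s|) + eta).
    by rewrite (le_trans (ler_norm _))// normrM ler_wpM2l.
  have c2 : q s * dq s <= `|q s| * (K * (`|p s| + `|q s|) + eta).
    by rewrite (le_trans (ler_norm _))// normrM ler_wpM2l.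
  have -> : p s * p s = `|p s| ^+ 2 by rewrite real_normK ?num_real.
  have -> : q s * q s = `|q s| ^+ 2 by rewrite real_normK ?num_real.
  move: c1 c2; set a := `|p s|; set b := `|q s| => c1 c2.
  have h1 : 0 <= K * (a - b) ^+ 2 by rewrite mulr_ge0// sqr_ge0.
  have h2 : 0 <= (a - eta) ^+ 2 by rewrite sqr_ge0.
  have h3 : 0 <= (b - eta) ^+ 2 by rewrite sqr_ge0.
  have h4 : 0 <= K * eta ^+ 2 by rewrite mulr_ge0// sqr_ge0.
  move: c1 c2 h1 h2 h3 h4; rewrite !expr2; lra.
rewrite lerN2 /E p0 q0 !mulr0 expR0 !add0r mulr1.
move=> h; have e0 := expR_gt0 (- (4 * K + 1) * t).
have h' : p t * p t + q t * q t + 2 * eta ^+ 2 <=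
    2 * eta ^+ 2 * expR ((4 * K + 1) * t).
  by rewrite -[(4 * K + 1) * t]opprK -mulNr expRN ler_pdivlMr.
rewrite !expr2; have eta2 : 0 <= 2 * eta ^+ 2 by rewrite mulr_ge0// sqr_ge0.
have : 2 * eta ^+ 2 * expR ((4 * K + 1) * t) <= 2 * eta ^+ 2 * expR ((4 * K + 1) * T).
  by rewrite ler_wpM2l// ler_expR ler_wpM2l// addr_ge0// mulr_ge0.
move: h' eta2; rewrite expr2; lra.
Qed.

(** Gronwall with [eta = 0] for positive times; reversing time gives the negative ones. *)
Lemma ode_unique (G1 G2 : R -> R -> R -> R) K (v z v' z' : R -> R) :
  0 <= K ->
  (forall t v z v' z', `|G1 t v z - G1 t v' z'| <= K * (`|v - v'| + `|z - z'|)) ->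
  (forall t v z v' z', `|G2 t v z - G2 t v' z'| <= K * (`|v - v'| + `|z - z'|)) ->
  (forall t : R, is_derive t 1 v (G1 t (v t) (z t))) ->
  (forall t : R, is_derive t 1 z (G2 t (v t) (z t))) ->
  (forall t : R, is_derive t 1 v' (G1 t (v' t) (z' t))) ->
  (forall t : R, is_derive t 1 z' (G2 t (v' t) (z' t))) ->
  v 0 = v' 0 -> z 0 = z' 0 -> v = v' /\ z = z'.
Proof.
move=> K0 l1 l2 hv hz hv' hz' v0 z0.
suff h t : (v t - v' t) ^+ 2 + (z t - z' t) ^+ 2 <= 0.
  have sq0 (a b : R) : a ^+ 2 + b ^+ 2 <= 0 -> a = 0.
    move=> hab; apply/eqP; rewrite -sqrf_eq0 eq_le sqr_ge0 andbT.
    by apply: le_trans hab; rewrite lerDl sqr_ge0.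
  split; apply/funext => t; apply/eqP; rewrite -subr_eq0; apply/eqP.
    exact: sq0 (h t).
  by apply: (@sq0 _ (v t - v' t)); rewrite addrC.
wlog t0 : G1 G2 v z v' z' t l1 l2 hv hz hv' hz' v0 z0 / 0 <= t.
  move=> H; case: (leP 0 t) => [|/ltW t0]; first exact: (H G1 G2).
  rewrite -(opprK t); have nt0 : 0 <= - t by rewrite oppr_ge0.
  apply: (H (fun t x y => - G1 (- t) x y) (fun t x y => - G2 (- t) x y)
    (fun t => v (- t)) (fun t => z (- t)) (fun t => v' (- t)) (fun t => z' (- t)))
    => //; do ?[by move=> *; exact: is_derive1_opp]; try by rewrite oppr0.
  - by move=> *; rewrite -opprD normrN.
  - by move=> *; rewrite -opprD normrN.
have := @gronwall (fun t => v t - v' t) (fun t => z t - z' t) _ _ K 0 t K0 (lexx _)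
  (fun t _ => is_derive1B (hv t) (hv' t)) (fun t _ => is_derive1B (hz t) (hz' t)).
rewrite v0 z0 !subrr expr0n/= mulr0 mul0r; apply => //.
- by move=> s _; rewrite addr0.
- by move=> s _; rewrite addr0.
- by rewrite t0 lexx.
Qed.

End Picard.

(** * Periodic Sturm-Liouville problems *)

Section SturmLiouville.
Variables (R : realType) (L : R) (E p W : R -> R).
Hypothesis L0 : 0 < L.
Hypothesis dE : forall t : R, is_derive t 1 E (p t).
Hypothesis cW : continuous W.
Hypothesis perE : periodic E L.
Hypothesis perW : periodic W L.
Implicit Types (a b d mu t : R) (w z : R -> R).

(* The equation (e^E w')' = e^E (W - mu) w, with z = e^E w'. *)
Definition sl_solution mu w z : Prop :=
  (forall t : R, is_derive t 1 w (expR (- E t) * z t)) /\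
  (forall t : R, is_derive t 1 z (expR (E t) * (W t - mu) * w t)).

Let cE : continuous E.
Proof. by move=> t; exact: is_derive_continuous (dE t). Qed.

Let cexpE : continuous (fun t => expR (E t)).
Proof. by move=> t; exact: is_derive_continuous (is_derive1_expR (dE t)). Qed.

Let cexpNE : continuous (fun t => expR (- E t)).
Proof.
by move=> t; exact: is_derive_continuous (is_derive1_expR (is_derive1N (dE t))).
Qed.

(** Uniformity over parameters at distance at most 1 is what continuity in [mu] requires. *)
Lemma sl_coef_bound mu : exists2 K, 0 < K & forall mu', `|mu' - mu| <= 1 ->
  forall t, [/\ expR (E t) <= K, expR (- E t) <= K &
    expR (E t) * `|W t - mu'| <= K].
Proof.
have [|k1 k10 h1] := periodic_bounded L0 (f := fun t => expR (E t)) _ cexpE.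
  by move=> t; rewrite perE.
have [|k2 k20 h2] := periodic_bounded L0 (f := fun t => expR (- E t)) _ cexpNE.
  by move=> t; rewrite perE.
have [k3 k30 h3] := periodic_bounded L0 perW cW.
exists (k1 * (k3 + `|mu| + 1) + k1 + k2 + 1).
  by rewrite ltr_wpDl// !addr_ge0// mulr_ge0// !addr_ge0.
move=> mu' mu'1 t.
have a1 : 0 <= k1 * (k3 + `|mu| + 1) by rewrite mulr_ge0// !addr_ge0.
have b1 : expR (E t) <= k1 by rewrite (le_trans (ler_norm _)).
have b2 : expR (- E t) <= k2 by rewrite (le_trans (ler_norm _)).
have b3 : expR (E t) * `|W t - mu'| <= k1 * (k3 + `|mu| + 1).
  apply: ler_pM => //.
  have m1 : `|mu'| <= `|mu| + 1.
    by rewrite -(subrK mu mu') (le_trans (ler_normD _ _))// addrC lerD2l.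
  apply: le_trans (ler_normB _ _) _; rewrite -addrA; exact: lerD.
by split; lra.
Qed.

Lemma sl_exists mu (x0 z0 : R) : exists w z, [/\ sl_solution mu w z, w 0 = x0 & z 0 = z0].
Proof.
have [K K0 hK] := sl_coef_bound mu.
have mu1 : `|mu - mu| <= 1 by rewrite subrr normr0.
have g1 t (v z v' z' : R) : `|expR (- E t) * z - expR (- E t) * z'| <=
    K * (`|v - v'| + `|z - z'|).
  rewrite -mulrBr normrM ger0_norm ?expR_ge0//.
  have [_ k2 _] := hK mu mu1 t; by apply: ler_pM; rewrite ?expR_ge0 ?lerDr.
have g2 t (v z v' z' : R) : `|expR (E t) * (W t - mu) * v - expR (E t) * (W t - mu) * v'| <=
    K * (`|v - v'| + `|z - z'|).
  rewrite -mulrBr !normrM ger0_norm ?expR_ge0//.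
  have [_ _ k3] := hK mu mu1 t; by apply: ler_pM; rewrite ?mulr_ge0 ?expR_ge0 ?lerDl.
have [||||||w [z [w0 z0' hw hz]]] := @picard R (fun t _ (y : R) => expR (- E t) * y)
  (fun t v _ => expR (E t) * (W t - mu) * v) K (K * (`|x0| + `|z0|)) x0 z0 K0.
- by move=> v z cv cz; exact: continuous1M.
- move=> v z cv cz; apply: continuous1M => //; apply: continuous1M => //.
  by apply: continuous1B => //; exact: continuous1cst.
- by move=> *; exact: g1.
- by move=> *; exact: g2.
- move=> t; have := g1 t x0 z0 0 0; by rewrite mulr0 !subr0.
- move=> t; have := g2 t x0 z0 0 0; by rewrite mulr0 !subr0.
by exists w, z.
Qed.

Lemma sl_unique mu w z w' z' : sl_solution mu w z -> sl_solution mu w' z' ->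
  w 0 = w' 0 -> z 0 = z' 0 -> w = w' /\ z = z'.
Proof.
move=> [hw hz] [hw' hz'] w0 z0.
have [K K0 hK] := sl_coef_bound mu.
have mu1 : `|mu - mu| <= 1 by rewrite subrr normr0.
apply: (@ode_unique R (fun t _ (y : R) => expR (- E t) * y)
  (fun t v _ => expR (E t) * (W t - mu) * v) K) => // [|t v y v' y'|t v y v' y'].
- exact: ltW.
- rewrite -mulrBr normrM ger0_norm ?expR_ge0//.
  have [_ k2 _] := hK mu mu1 t; by apply: ler_pM; rewrite ?expR_ge0 ?lerDr.
- rewrite -mulrBr !normrM ger0_norm ?expR_ge0//.
  have [_ _ k3] := hK mu mu1 t; by apply: ler_pM; rewrite ?mulr_ge0 ?expR_ge0 ?lerDl.
Qed.

Lemma sl_comb mu w z w' z' (c c' : R) : sl_solution mu w z -> sl_solution mu w' z' ->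
  sl_solution mu (fun t => c * w t + c' * w' t) (fun t => c * z t + c' * z' t).
Proof.
move=> [hw hz] [hw' hz']; split=> t.
  apply: (is_derive1_eq (is_derive1D (is_derive1Z c (hw t)) (is_derive1Z c' (hw' t)))).
  by ring.
apply: (is_derive1_eq (is_derive1D (is_derive1Z c (hz t)) (is_derive1Z c' (hz' t)))).
by ring.
Qed.

Lemma sl_shift mu w z : sl_solution mu w z ->
  sl_solution mu (fun t => w (t + L)) (fun t => z (t + L)).
Proof.
move=> [hw hz]; split=> t.
  by rewrite -(perE t); exact: is_derive1_shift (hw _).
by rewrite -(perE t) -(perW t); exact: is_derive1_shift (hz _).
Qed.

Lemma sl_continuous mu w z : sl_solution mu w z -> continuous w /\ continuous z.
Proof.
by move=> [hw hz]; split=> t;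
  [exact: is_derive_continuous (hw t)|exact: is_derive_continuous (hz t)].
Qed.

Lemma sl_wronskian mu w z w' z' : sl_solution mu w z -> sl_solution mu w' z' ->
  forall t, w t * z' t - w' t * z t = w 0 * z' 0 - w' 0 * z 0.
Proof.
move=> [hw hz] [hw' hz'] t.
apply: (derive_0_cst (f := fun t => w t * z' t - w' t * z t)) => s.
apply: (is_derive1_eq (is_derive1B (is_derive1M (hw s) (hz' s))
  (is_derive1M (hw' s) (hz s)))).
by ring.
Qed.

(** The difference of the two solutions solves the system for [mu'] with a source proportional to
    [(mu' - mu) * w], where [w] is bounded on the period; Gronwall then applies. *)
Lemma sl_param_continuous mu w z : sl_solution mu w z ->
  exists2 C, 0 <= C & forall mu' w' z', `|mu' - mu| <= 1 ->
  sl_solution mu' w' z' -> w' 0 = w 0 -> z' 0 = z 0 ->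
  forall t, 0 <= t <= L ->
    `|w' t - w t| <= C * `|mu' - mu| /\ `|z' t - z t| <= C * `|mu' - mu|.
Proof.
move=> sol; have [cw _] := sl_continuous sol; case: sol => hw hz.
have [K K0 hK] := sl_coef_bound mu.
have [c _ hc] := max_segment (f := fun t => `|w t|) (ltW L0) (fun t => cvg_norm (cw t)).
pose e := expR ((4 * K + 1) * L).
have e0 : 0 <= 2 * e by rewrite mulr_ge0// expR_ge0.
exists (K * `|w c| * (1 + 2 * e)).
  by rewrite !mulr_ge0 ?addr_ge0// ltW.
move=> mu' w' z' mu1 [hw' hz'] w0 z0.
pose eta := K * `|w c| * `|mu' - mu|.
have eta0 : 0 <= eta by rewrite !mulr_ge0// ltW.
have := @gronwall R (fun t => w' t - w t) (fun t => z' t - z t) _ _ K eta L (ltW K0) eta0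
  (fun t _ => is_derive1B (hw' t) (hw t)) (fun t _ => is_derive1B (hz' t) (hz t)).
rewrite w0 z0 !subrr => h t tL.
have {h} : (w' t - w t) ^+ 2 + (z' t - z t) ^+ 2 <= 2 * eta ^+ 2 * e.
  apply: h => // s sL; have [k1 k2 k3] := hK _ mu1 s.
    rewrite -mulrBr normrM ger0_norm ?expR_ge0//.
    apply: ler_wpDr => //; by apply: ler_pM; rewrite ?expR_ge0 ?lerDr.
  have -> : expR (E s) * (W s - mu') * w' s - expR (E s) * (W s - mu) * w s =
     expR (E s) * (W s - mu') * (w' s - w s) - expR (E s) * w s * (mu' - mu) by ring.
  apply: le_trans (ler_normB _ _) _; apply: lerD.
    rewrite !normrM ger0_norm ?expR_ge0//; by apply: ler_pM; rewrite ?mulr_ge0 ?expR_ge0 ?lerDl.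
  rewrite !normrM ger0_norm ?expR_ge0// /eta ler_wpM2r//.
  by apply: ler_pM => //; exact: hc.
(* A bound linear in [eta] without a square root, since [2 * e <= (1 + 2 * e) ^+ 2]. *)
have sq (x y : R) : x ^+ 2 + y ^+ 2 <= 2 * eta ^+ 2 * e -> `|x| <= eta * (1 + 2 * e).
  move=> h; have b0 : 0 <= eta * (1 + 2 * e) by rewrite mulr_ge0// addr_ge0.
  rewrite -(@ler_pXn2r _ 2) ?nnegrE// real_normK ?num_real//.
  apply: (@le_trans _ _ (2 * eta ^+ 2 * e)).
    by apply: le_trans h; rewrite lerDl sqr_ge0.
  have h1 : 0 <= eta ^+ 2 * (2 * e + (2 * e) ^+ 2 + 1).
    by rewrite mulr_ge0 ?sqr_ge0// !addr_ge0// sqr_ge0.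
  by move: h1; rewrite !expr2; move: e0; nra.
move=> h; rewrite (_ : K * _ * _ * _ = eta * (1 + 2 * e)); last by rewrite /eta; ring.
by split; [exact: sq h|apply: (@sq _ (w' t - w t)); rewrite addrC].
Qed.

(** The product [w * z] is nondecreasing, its derivative being a sum of two squares with nonnegative
    weights. Hence it stays nonnegative, and it governs the sign of the derivatives of both
    squares. *)
Lemma sl_monotone mu w z : (forall t, 0 <= W t - mu) -> sl_solution mu w z ->
  0 <= w 0 * z 0 -> forall t, 0 <= t ->
  w 0 ^+ 2 <= w t ^+ 2 /\ z 0 ^+ 2 <= z t ^+ 2.
Proof.
move=> Wmu [hw hz] wz0.
have wz t : 0 <= t -> 0 <= w t * z t.
  move=> t0; apply: le_trans wz0 _.
  apply: (derive_ge0_le t0 (fun s _ => is_derive1M (hw s) (hz s))) => s _.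
  rewrite addr_ge0//.
    by rewrite -mulrA mulr_ge0 ?expR_ge0// -expr2 sqr_ge0.
  by rewrite mulrCA -expr2 mulr_ge0 ?sqr_ge0// mulr_ge0 ?expR_ge0.
move=> t t0; rewrite !expr2; split.
  apply: (derive_ge0_le t0 (fun s _ => is_derive1M (hw s) (hw s))) => s /andP[s0 _].
  rewrite (_ : _ + _ = 2 * expR (- E s) * (w s * z s)); last by ring.
  by apply: mulr_ge0; [rewrite !mulr_ge0 ?expR_ge0|exact: wz].
apply: (derive_ge0_le t0 (fun s _ => is_derive1M (hz s) (hz s))) => s /andP[s0 _].
rewrite (_ : _ + _ = 2 * expR (E s) * (W s - mu) * (w s * z s)); last by ring.
by apply: mulr_ge0; [rewrite !mulr_ge0 ?expR_ge0|exact: wz].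
Qed.

(** Passing from 1 to a negative value would force a zero, where the square is not at least 1. *)
Lemma sqr_ge1_ge1 (f : R -> R) : continuous f -> f 0 = 1 ->
  (forall t, 0 <= t -> 1 <= f t ^+ 2) -> forall t, 0 <= t -> 1 <= f t.
Proof.
move=> cf f0 h t t0; have [//|ft] := leP 1 (f t).
have : f t ^+ 2 < 1 -> False by rewrite ltNge h.
have [ft0|ft0] := leP 0 (f t).
  by rewrite expr_lt1//; case.
have [|s /andP[s0 _] fs] := IVT_ge t0 cf (_ : 0 <= f 0) (ltW ft0); first by rewrite f0.
by have := h s s0; rewrite fs expr0n/= ler10.
Qed.

(* The Riccati variable y = w'/w satisfies y' <= - (y^2 + d^2) / 2, so that
   atan (y / d) decreases at rate at least d / 2. *)
Lemma sl_positive_short mu w z a b d : sl_solution mu w z -> 0 < d -> a <= b ->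
  (forall t, a <= t <= b -> 0 < w t) ->
  (forall t, a <= t <= b -> W t - mu <= - d ^+ 2) ->
  (forall t, a <= t <= b -> p t ^+ 2 <= d ^+ 2) ->
  d * (b - a) < 2 * pi.
Proof.
move=> [hw hz] d0 ab w0 Wd pd.
pose v t := expR (- E t) * z t.
have hv t : is_derive t 1 v (- p t * v t + (W t - mu) * w t).
  apply: (is_derive1_eq (is_derive1M (is_derive1_expR (is_derive1N (dE t))) (hz t))).
  have e1 : expR (- E t) * expR (E t) = 1 by rewrite -expRD addNr expR0.
  rewrite /v; set c := expR (- E t) in e1 *; set c' := expR (E t) in e1 *.
  have -> : c * (c' * (W t - mu) * w t) = (c * c') * ((W t - mu) * w t) by ring.
  by rewrite e1; ring.
pose y t := v t / w t.
pose dy t := - p t * y t + (W t - mu) - y t ^+ 2.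
have hy t : a <= t <= b -> is_derive t 1 y (dy t).
  move=> tab; have wn0 : w t != 0 by rewrite gt_eqF// w0.
  apply: (is_derive1_eq (is_derive1M (hv t) (is_derive1V wn0 (hw t)))).
  by rewrite /dy /y; rewrite -/(v t); field.
have dyle t : a <= t <= b -> dy t <= - ((y t ^+ 2 + d ^+ 2) / 2).
  move=> tab; have h1 := Wd _ tab; have h2 := pd _ tab.
  (* Completing the square bounds [- p * y] by [(y ^+ 2 + p ^+ 2) / 2]; half of [y ^+ 2] and half of
     [d ^+ 2] are left. *)
  have h3 : 0 <= (y t + p t) ^+ 2 by rewrite sqr_ge0.
  by move: h1 h2 h3; rewrite /dy !expr2; lra.
have hat t : a <= t <= b ->
    is_derive t 1 (fun t => atan (d^-1 * y t)) ((1 + (d^-1 * y t) ^+ 2)^-1 * (d^-1 * dy t)).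
  move=> tab; exact: (is_derive1_compf (g := fun t => d^-1 * y t)
    (is_derive1_atan _) (is_derive1Z d^-1 (hy _ tab))).
have := @derive_le R (fun t => atan (d^-1 * y t)) (fun t => - (d / 2) * t) _ _ a b ab
  hat (fun t _ => is_derive1Z (- (d / 2)) (is_derive1id t)).
have := atan_gtNpi2 (d^-1 * y b); have := atan_ltpi2 (d^-1 * y a).
move=> h1 h2 h3.
suff : atan (d^-1 * y b) - atan (d^-1 * y a) <= - (d / 2) * b - - (d / 2) * a.
  by move: h1 h2; set u := atan _; set u' := atan _; lra.
apply: h3 => t tab; have h := dyle _ tab.
rewrite mulr1 -ler_pdivlMl ?invr_gt0; last by rewrite ltr_pwDl// sqr_ge0.
rewrite invrK ler_pdivrMl//; apply: le_trans h _.
apply: eq_ler; field; exact: lt0r_neq0.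
Qed.

End SturmLiouville.

(** Connectedness of a segment, in the form used for continuation in the spectral parameter:
    closedness is tested only on points adherent to [P] within the segment. *)
Lemma clopen_segment (R : realType) (P : R -> Prop) (b : R) : 0 <= b -> P 0 ->
  (forall x, 0 <= x <= b -> P x ->
    exists2 e, 0 < e & forall y, `|y - x| < e -> P y) ->
  (forall x, 0 <= x <= b -> (forall e, 0 < e ->
    exists y, [/\ 0 <= y <= b, `|y - x| < e & P y]) -> P x) ->
  P b.
Proof.
move=> b0 P0 op cl; pose S := [set x | 0 <= x <= b /\ P x].
have S0 : S 0 by split => //; rewrite lexx.
have ubS : ubound S b by move=> x [/andP[]].
have hsS : has_sup S by split; [exists 0|exists b].
have s0 : 0 <= sup S by apply: ub_le_sup => //; exists b.
have sb : sup S <= b by apply: ge_sup => //; exists 0.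
have Ps : P (sup S).
  apply: cl; first by rewrite s0.
  move=> e e0; have [x [xb Px] xs] := sup_adherent e0 hsS.
  exists x; split => //; rewrite ler0_norm ?subr_le0; first lra.
  by apply: ub_le_sup; [exists b|split].
move: sb; rewrite le_eqVlt => /predU1P[<-//|sb].
have [|e e0 he] := op (sup S) _ Ps; first by rewrite s0 ltW.
pose x := sup S + Num.min (e / 2) (b - sup S).
have m0 : 0 < Num.min (e / 2) (b - sup S) by rewrite lt_min divr_gt0//= subr_gt0.
have me : Num.min (e / 2) (b - sup S) <= e / 2 by rewrite ge_min lexx.
have mb : Num.min (e / 2) (b - sup S) <= b - sup S by rewrite ge_min lexx orbT.
have : x <= sup S.
  apply: ub_le_sup; first by exists b.
  split; first by apply/andP; split; rewrite /x; lra.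
  apply: he; rewrite /x addrC addKr ger0_norm; lra.
rewrite /x; lra.
Qed.

(** One side suffices: at the end of an interval only the left is known, and a right-hand minimum
    reduces to this case by reflection. *)
Lemma left_min_derive_le0 (R : realType) (f : R -> R) (t c eta : R) :
  is_derive t 1 f c -> 0 < eta ->
  (forall y, t - eta < y < t -> f t <= f y) -> c <= 0.
Proof.
move=> hd eta0 h; rewrite leNgt; apply/negP => c0.
have c20 : 0 < c / 2 by rewrite divr_gt0.
have [d d0 hdd] := (is_derive_near _ _ _).1 hd _ c20.
pose k := Num.min d eta / 2.
have k0 : 0 < k by rewrite divr_gt0// lt_min d0.
have kd : k < d.
  by rewrite /k ltr_pdivrMr// gt_min; apply/orP; left; lra.
have ke : k < eta.
  by rewrite /k ltr_pdivrMr// gt_min; apply/orP; right; lra.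
have := hdd (t - k); rewrite addrAC subrr sub0r normrN (ger0_norm (ltW k0)) => /(_ kd).
have h1 : f t <= f (t - k) by apply: h; apply/andP; split; lra.
rewrite ler_norml => /andP[_ h2].
have : 0 < c / 2 * k by rewrite mulr_gt0.
lra.
Qed.

(** * Shooting: the monodromy matrix and its trace *)

Section Fundamental.
Variables (R : realType) (L : R) (E p W : R -> R).
Hypothesis L0 : 0 < L.
Hypothesis dE : forall t : R, is_derive t 1 E (p t).
Hypothesis cW : continuous W.
Hypothesis perE : periodic E L.
Hypothesis perW : periodic W L.
Variables (X1 X2 Y1 Y2 : R -> R -> R).
Hypothesis solX : forall mu, sl_solution E W mu (X1 mu) (X2 mu).
Hypothesis solY : forall mu, sl_solution E W mu (Y1 mu) (Y2 mu).
Hypothesis X10 : forall mu, X1 mu 0 = 1.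
Hypothesis X20 : forall mu, X2 mu 0 = 0.
Hypothesis Y10 : forall mu, Y1 mu 0 = 0.
Hypothesis Y20 : forall mu, Y2 mu 0 = 1.
Implicit Types (mu t : R).

(** In classical terms, [mu] lies below the first Dirichlet eigenvalue of the segment from 0 to
    [L]. *)
Definition sl_positive mu := forall t : R, 0 < t <= L -> 0 < Y1 mu t.

(** At [t = L] this is the determinant of the monodromy matrix. *)
Let wronskian mu t : X1 mu t * Y2 mu t - Y1 mu t * X2 mu t = 1.
Proof.
by rewrite (sl_wronskian (solX mu) (solY mu) t) X10 Y20 Y10 mul0r subr0 mulr1.
Qed.

Let parY mu : exists2 C, 0 <= C & forall mu', `|mu' - mu| <= 1 ->
  forall t : R, 0 <= t <= L -> `|Y1 mu' t - Y1 mu t| <= C * `|mu' - mu| /\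
    `|Y2 mu' t - Y2 mu t| <= C * `|mu' - mu|.
Proof.
have [C C0 hC] := sl_param_continuous L0 dE cW perE perW (solY mu).
by exists C => // mu' m1; apply: hC => //; rewrite ?Y10 ?Y20.
Qed.

Let parX mu : exists2 C, 0 <= C & forall mu', `|mu' - mu| <= 1 ->
  forall t : R, 0 <= t <= L -> `|X1 mu' t - X1 mu t| <= C * `|mu' - mu|.
Proof.
have [C C0 hC] := sl_param_continuous L0 dE cW perE perW (solX mu).
exists C => // mu' m1 t tL.
by have [] := hC mu' (X1 mu') (X2 mu') m1 (solX mu') _ _ t tL; rewrite ?X10 ?X20.
Qed.

(* The trace of the monodromy matrix: as its determinant is 1, a periodic solution
   exists when the trace is 2. *)
Definition discriminant mu := X1 mu L + Y2 mu L.

Lemma discriminant_continuous : continuous discriminant.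
Proof.
move=> mu; apply: near_continuous => e e0.
have [C C0 hC] := parX mu; have [C' C'0 hC'] := parY mu.
have CC : 0 < C + C' + 1 by rewrite ltr_wpDl// addr_ge0.
exists (Num.min 1 (e / (C + C' + 1))); first by rewrite lt_min ltr01 divr_gt0.
move=> mu'; rewrite lt_min => /andP[/ltW m1 m2].
have LL : 0 <= L <= L by rewrite (ltW L0) lexx.
have h1 := hC mu' m1 L LL; have [_ h2] := hC' mu' m1 L LL.
rewrite /discriminant (_ : _ - _ = (X1 mu' L - X1 mu L) + (Y2 mu' L - Y2 mu L)); last by ring.
apply: le_trans (ler_normD _ _) _; apply: le_trans (lerD h1 h2) _.
rewrite ltr_pdivlMr// in m2.
have := normr_ge0 (mu' - mu); move: m2; lra.
Qed.

(** Near 0, where [Y1] vanishes, positivity is kept by the slope: [Y2] exceeds 1/2 there and moves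
    by at most 1/4. Farther away [Y1] has a positive minimum by compactness. *)
Lemma sl_positive_open mu : sl_positive mu ->
  exists2 e, 0 < e & forall mu', `|mu' - mu| < e -> sl_positive mu'.
Proof.
move=> pos; have [cY1 cY2] := sl_continuous (solY mu).
have half0 : (0 : R) < 2^-1 by rewrite invr_gt0.
have [d d0 hd] := continuous_near (cY2 0) half0.
pose d' := Num.min (d / 2) L.
have d'0 : 0 < d' by rewrite lt_min divr_gt0.
have d'L : d' <= L by rewrite ge_min lexx orbT.
have d'd : d' < d by rewrite gt_min; apply/orP; left; lra.
have [c /andP[c1 c2] hc] := min_segment d'L cY1.
pose m := Y1 mu c; have m0 : 0 < m by apply: pos; rewrite c2 andbT (lt_le_trans d'0).
have [C C0 hC] := parY mu; have C1 : 0 < C + 1 by rewrite ltr_wpDl.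
pose e := Num.min 1 (Num.min (4^-1 / (C + 1)) (m / 2 / (C + 1))).
exists e; first by rewrite !lt_min ltr01 !divr_gt0// invr_gt0.
move=> mu'; rewrite !lt_min => /and3P[/ltW m1 m2 m3].
rewrite ltr_pdivlMr// in m2; rewrite ltr_pdivlMr// in m3.
have n0 := normr_ge0 (mu' - mu).
move=> t /andP[t0 tL]; have [td|td] := leP t d'.
  rewrite -[ltLHS](Y10 mu'); apply: (derive_gt0_lt t0 (fun s _ => (solY mu').1 s)).
  move=> s /andP[s0 st]; rewrite mulr_gt0 ?expR_gt0//.
  have sL : 0 <= s <= L by rewrite (ltW s0) ltW// (lt_le_trans st).
  have [_ h1] := hC mu' m1 s sL.
  have : `|s - 0| < d by rewrite subr0 ger0_norm ?(ltW s0)//; lra.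
  move=> /hd; rewrite Y20 ltr_norml => /andP[h2 _].
  by move: h1; rewrite ler_norml => /andP[h1 _]; lra.
have tL' : 0 <= t <= L by rewrite (ltW t0).
have [h1 _] := hC mu' m1 t tL'.
have h2 : m <= Y1 mu t by apply: hc; rewrite (ltW td).
by move: h1; rewrite ler_norml => /andP[h1 _]; lra.
Qed.

(** A zero inside the period would be a minimum, hence a double zero, against the Wronskian. A zero
    at [L] forces [Y2 <= 0] there and [X1 * Y2 = 1], so both are nonpositive and the trace cannot
    exceed 2. *)
Lemma sl_positive_closed mu : (forall t : R, 0 < t <= L -> 0 <= Y1 mu t) ->
  2 < discriminant mu -> sl_positive mu.
Proof.
move=> nonneg; rewrite /discriminant => tr t /andP[t0 tL].
rewrite lt_neqAle nonneg ?t0// andbT eq_sym; apply/negP => /eqP Yt.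
have e0 := expR_gt0 (- E t).
have Y2t : Y2 mu t <= 0.
  have h := (solY mu).1 t.
  have : expR (- E t) * Y2 mu t <= 0.
    apply: (left_min_derive_le0 h t0) => y /andP[y0 yt]; rewrite Yt.
    by apply: nonneg; apply/andP; split; lra.
  by rewrite pmulr_rle0.
have := wronskian mu t; rewrite Yt mul0r subr0 => w1.
move: tL; rewrite le_eqVlt => /predU1P[tL|tL].
  rewrite tL in w1 Y2t.
  have : X1 mu L <= 0.
    rewrite leNgt; apply/negP => x0.
    have : X1 mu L * Y2 mu L <= 0 by rewrite pmulr_rle0.
    by rewrite w1 ler10.
  lra.
have Y2t' : 0 <= Y2 mu t.
  have h := (solY mu).1 t; rewrite -(opprK t) in h.
  have Lt : 0 < L - t by rewrite subr_gt0.
  have : - (expR (- E (- - t)) * Y2 mu (- - t)) <= 0.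
    apply: (left_min_derive_le0 (is_derive1_opp h) Lt) => y /andP[y0 yt].
    rewrite opprK Yt; apply: nonneg; apply/andP; split; lra.
  by rewrite !opprK oppr_le0 pmulr_rge0.
have Y2e : Y2 mu t = 0 by apply/eqP; rewrite eq_le Y2t.
by move: w1; rewrite Y2e mulr0 => /eqP; rewrite eq_sym oner_eq0.
Qed.

(** At [mu = 0] the potential is nonnegative, so [X1] and [Y2] are at least 1 and the trace at least
    2. Were it above 2 on the whole segment up to [mu1], positivity of [Y1] would propagate to
    [mu1], which [sl_positive_short] forbids in the well. The intermediate value theorem then gives
    the value 2. *)
Lemma discriminant_le2 mu1 a b d : 0 <= mu1 -> (forall t, 0 <= W t) ->
  0 < d -> 0 < a -> a <= b -> b <= L ->
  (forall t, a <= t <= b -> W t - mu1 <= - d ^+ 2) ->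
  (forall t, a <= t <= b -> p t ^+ 2 <= d ^+ 2) ->
  2 * pi <= d * (b - a) ->
  exists2 mu, 0 <= mu <= mu1 & discriminant mu = 2.
Proof.
move=> mu10 W0 d0 a0 ab bL Wd pd dab.
have W0' t : 0 <= W t - 0 by rewrite subr0.
have x1 t : 0 <= t -> 1 <= X1 0 t.
  apply: sqr_ge1_ge1 => [|//|s s0]; first by have [] := sl_continuous (solX 0).
  have [|+ _] := sl_monotone W0' (solX 0) _ s0; first by rewrite X20 mulr0.
  by rewrite X10 expr1n.
have y1 t : 0 <= t -> 1 <= Y2 0 t.
  apply: sqr_ge1_ge1 => [|//|s s0]; first by have [] := sl_continuous (solY 0).
  have [|_ +] := sl_monotone W0' (solY 0) _ s0; first by rewrite Y10 mul0r.
  by rewrite Y20 expr1n.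
have tr0 : 2 <= discriminant 0.
  by have := x1 L (ltW L0); have := y1 L (ltW L0); rewrite /discriminant; lra.
have [mu /andP[m0 m1] trmu] : exists2 mu, 0 <= mu <= mu1 & discriminant mu <= 2.
  apply: contrapT => no.
  have trgt mu : 0 <= mu <= mu1 -> 2 < discriminant mu.
    by move=> mu01; rewrite ltNge; apply/negP => h; apply: no; exists mu.
  have : sl_positive mu1.
    apply: (clopen_segment mu10).
    - move=> t /andP[t0 _]; rewrite -[ltLHS](Y10 0).
      apply: (derive_gt0_lt t0 (fun s _ => (solY 0).1 s)) => s /andP[s0 _].
      by rewrite mulr_gt0 ?expR_gt0// (lt_le_trans ltr01)// y1// ltW.
    - by move=> mu _; exact: sl_positive_open.
    - move=> mu mu01 adh; apply: sl_positive_closed; last exact: trgt.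
      move=> t /andP[t0 tL]; rewrite leNgt; apply/negP => Yt.
      have [C C0 hC] := parY mu; have C1 : 0 < C + 1 by rewrite ltr_wpDl.
      have [|mu' [_ + pos]] := adh (Num.min 1 (- Y1 mu t / (C + 1))).
        by rewrite lt_min ltr01 divr_gt0// oppr_gt0.
      rewrite lt_min => /andP[/ltW m1 m2]; rewrite ltr_pdivlMr// in m2.
      have tL' : 0 <= t <= L by rewrite (ltW t0).
      have [h1 _] := hC mu' m1 t tL'.
      have : 0 < Y1 mu' t by apply: pos; rewrite t0.
      have n0 := normr_ge0 (mu' - mu).
      by move: h1; rewrite ler_norml => /andP[_ h1]; lra.
  move=> pos.
  have : d * (b - a) < 2 * pi.
    apply: (sl_positive_short dE (solY mu1) d0 ab _ Wd pd) => t /andP[at_ tb].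
    by apply: pos; rewrite (lt_le_trans a0 at_) (le_trans tb).
  by rewrite ltNge dab.
have [nu /andP[n0 n1] nu2] := IVT_ge m0 discriminant_continuous tr0 trmu.
by exists nu => //; rewrite n0 (le_trans n1).
Qed.

(** With trace 2 and determinant 1 the monodromy matrix has the eigenvalue 1; an eigenvector
    provides initial data that recur after one period, and uniqueness makes the solution
    periodic. *)
Lemma discriminant2_periodic mu : discriminant mu = 2 ->
  exists w z, [/\ sl_solution E W mu w z, periodic w L, periodic z L &
    exists t, w t != 0].
Proof.
rewrite /discriminant => tr2; have w1 := wronskian mu L.
have [c1 [c2 [c0 e1 e2]]] : exists c1 c2, [/\ (c1 != 0) || (c2 != 0),
    X1 mu L * c1 + Y1 mu L * c2 = c1 & X2 mu L * c1 + Y2 mu L * c2 = c2].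
  have Y2L : Y2 mu L = 2 - X1 mu L by lra.
  rewrite Y2L in w1 *.
  (* If [Y1] does not vanish at [L], the first row gives the eigenvector. Otherwise the determinant
     reads [(X1 - 1) ^+ 2 = 0], so the matrix is unipotent and lower triangular, possibly the
     identity. *)
  have [Y1L|Y1L] := eqVneq (Y1 mu L) 0; last first.
    exists (- Y1 mu L), (X1 mu L - 1); rewrite oppr_eq0 Y1L; split => //.
      by ring.
    by move: w1; lra.
  rewrite Y1L in w1 *; have x1 : X1 mu L = 1.
    apply/eqP; rewrite -subr_eq0 -sqrf_eq0; apply/eqP.
    by move: w1; rewrite expr2; lra.
  rewrite x1; have [X2L|X2L] := eqVneq (X2 mu L) 0.
    by exists 1, 0; rewrite X2L oner_neq0; split => //; ring.
  by exists 0, 1; rewrite oner_neq0 orbT; split => //; ring.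
pose w t := c1 * X1 mu t + c2 * Y1 mu t; pose z t := c1 * X2 mu t + c2 * Y2 mu t.
have sol : sl_solution E W mu w z by exact: sl_comb.
have [ew ez] : (fun t => w (t + L)) = w /\ (fun t => z (t + L)) = z.
  apply: (sl_unique L0 dE cW perE perW (sl_shift perE perW sol) sol).
    by rewrite add0r /w X10 Y10 mulr0 addr0 mulr1 -[RHS]e1; ring.
  by rewrite add0r /z X20 Y20 mulr0 add0r mulr1 -[RHS]e2; ring.
exists w, z; split => //.
- by move=> t; exact: (congr1 (@^~ t) ew).
- by move=> t; exact: (congr1 (@^~ t) ez).
apply: contrapT => no.
have w0 t : w t = 0 by apply: contrapT => /eqP h; apply: no; exists t.
have z0 t : z t = 0.
  have h := sol.1 t.
  have : expR (- E t) * z t = 0.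
    rewrite -(@derive_val _ _ _ _ _ _ _ h).
    rewrite (_ : w = fun=> 0); last exact/funext.
    exact: (@derive_val _ _ _ _ _ _ _ (is_derive1cst 0 t)).
  by move/eqP; rewrite mulf_eq0 gt_eqF ?expR_gt0//= => /eqP.
have := w0 0; have := z0 0; rewrite /w /z X10 X20 Y10 Y20 !mulr0 !mulr1 add0r addr0 => c20 c10.
by move: c0; rewrite c10 c20 eqxx.
Qed.

End Fundamental.

Lemma periodic_eigenfunction (R : realType) (L : R) (E p W : R -> R) (mu1 a b d : R) :
  0 < L -> (forall t : R, is_derive t 1 E (p t)) -> continuous W ->
  periodic E L -> periodic W L ->
  0 <= mu1 -> (forall t, 0 <= W t) ->
  0 < d -> 0 < a -> a <= b -> b <= L ->
  (forall t, a <= t <= b -> W t - mu1 <= - d ^+ 2) ->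
  (forall t, a <= t <= b -> p t ^+ 2 <= d ^+ 2) ->
  2 * pi <= d * (b - a) ->
  exists mu w z, [/\ 0 <= mu <= mu1, sl_solution E W mu w z,
    periodic w L, periodic z L & exists t, w t != 0].
Proof.
move=> L0 dE cW perE perW mu10 W0 d0 a0 ab bL Wd pd dab.
have fund (x0 z0 : R) : exists X : R -> (R -> R) * (R -> R), forall mu,
    [/\ sl_solution E W mu (X mu).1 (X mu).2, (X mu).1 0 = x0 & (X mu).2 0 = z0].
  have ex mu : exists X : (R -> R) * (R -> R),
      [/\ sl_solution E W mu X.1 X.2, X.1 0 = x0 & X.2 0 = z0].
    have [w [z [h1 h2 h3]]] := sl_exists L0 dE cW perE perW mu x0 z0.
    by exists (w, z).
  by have [X hX] := choice ex; exists X.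
have [X hX] := fund 1 0; have [Y hY] := fund 0 1.
pose X1 mu := (X mu).1; pose X2 mu := (X mu).2.
pose Y1 mu := (Y mu).1; pose Y2 mu := (Y mu).2.
have sX mu : sl_solution E W mu (X1 mu) (X2 mu) by have [] := hX mu.
have sY mu : sl_solution E W mu (Y1 mu) (Y2 mu) by have [] := hY mu.
have X10 mu : X1 mu 0 = 1 by have [] := hX mu.
have X20 mu : X2 mu 0 = 0 by have [] := hX mu.
have Y10 mu : Y1 mu 0 = 0 by have [] := hY mu.
have Y20 mu : Y2 mu 0 = 1 by have [] := hY mu.
have [mu mu01 tr2] := discriminant_le2 L0 dE cW perE perW sX sY X10 X20 Y10 Y20
  mu10 W0 d0 a0 ab bL Wd pd dab.
have [w [z [h1 h2 h3 h4]]] := discriminant2_periodic L0 dE cW perE perW sX sY X10 X20 Y10 Y20 tr2.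
by exists mu, w, z.
Qed.

(** * Decay of eigenfunctions *)

Lemma global_max_derive0 (R : realType) (f : R -> R) (c l : R) :
  is_derive c 1 f l -> (forall t, f t <= f c) -> l = 0.
Proof.
move=> h hm; apply/eqP; rewrite eq_le; apply/andP; split; last first.
  rewrite -oppr_le0; apply: (left_min_derive_le0 (is_derive1N h) ltr01) => y _.
  by rewrite lerN2.
rewrite -(opprK c) in h.
have := left_min_derive_le0 (is_derive1N (is_derive1_opp h)) ltr01.
by rewrite !opprK; apply => y _; rewrite lerN2.
Qed.

Section EigenfunctionEstimates.
Variables (R : realType) (L : R) (E p W : R -> R) (mu : R) (w z : R -> R).
Hypothesis L0 : 0 < L.
Hypothesis dE : forall t : R, is_derive t 1 E (p t).
Hypothesis sol : sl_solution E W mu w z.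
Implicit Types (a b c g m t y K N : R).

(** Maximum principle. The lower bound on [W - mu] makes both exponentials supersolutions, and their
    sum dominates [u] at both ends. *)
Lemma sl_barrier a b g m (u x : R -> R) : sl_solution E W mu u x ->
  0 < g -> 0 <= m -> a <= b ->
  u a <= m -> u b <= m ->
  (forall t, a <= t <= b -> g ^+ 2 + `|p t| * g <= W t - mu) ->
  forall t, a <= t <= b -> u t <= m * expR (- g * (t - a)) + m * expR (g * (t - b)).
Proof.
move=> [hu hx] g0 m0 ab ua ub gW.
pose A t := m * expR (- g * (t - a)); pose B t := m * expR (g * (t - b)).
have dlin k c t : is_derive t 1 (fun t => k * (t - c)) k.
  by apply: (is_derive1_eq (is_derive1Z k (is_derive1B (is_derive1id t)
    (is_derive1cst c t)))); rewrite subr0 mulr1.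
have dA t : is_derive t 1 A (- g * A t).
  by apply: (is_derive1_eq (is_derive1Z m (is_derive1_expR (dlin (- g) a t))));
    rewrite /A; ring.
have dB t : is_derive t 1 B (g * B t).
  by apply: (is_derive1_eq (is_derive1Z m (is_derive1_expR (dlin g b t))));
    rewrite /B; ring.
have A0 t : 0 <= A t by rewrite mulr_ge0 ?expR_ge0.
have B0 t : 0 <= B t by rewrite mulr_ge0 ?expR_ge0.
pose phi t := A t + B t - u t.
pose dphi t := - g * A t + g * B t - expR (- E t) * x t.
have hphi t : is_derive t 1 phi (dphi t).
  exact: is_derive1B (is_derive1D (dA t) (dB t)) (hu t).
have cphi : continuous phi := continuous1_derive hphi.
have eE t : expR (E t) * expR (- E t) = 1 by rewrite -expRD subrr expR0.
(* The flux [expR E * phi']: it is differentiable whereas [phi'] is only handled through it. *)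
pose zeta t := expR (E t) * (- g * A t + g * B t) - x t.
pose dzeta t := expR (E t) * (g ^+ 2 * (A t + B t) + p t * (g * B t - g * A t) - (W t - mu) * u t).
have hzeta t : is_derive t 1 zeta (dzeta t).
  apply: (is_derive1_eq (is_derive1B (is_derive1M (is_derive1_expR (dE t))
    (is_derive1D (is_derive1Z (- g) (dA t)) (is_derive1Z g (dB t)))) (hx t))).
  by rewrite /dzeta; ring.
have zetaE t : zeta t = expR (E t) * dphi t.
  by rewrite /zeta /dphi mulrBr [in X in _ = _ - X]mulrA eE mul1r.
move=> t tab; rewrite -subr_ge0 -/(A t) -/(B t) -/(phi t) leNgt; apply/negP => phit.
have [c /andP[ac cb] hc] := min_segment ab cphi.
have phic : phi c < 0 by apply: le_lt_trans phit; exact: hc.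
have ac' : a < c.
  rewrite lt_neqAle ac andbT; apply/eqP => e; move: phic; rewrite -e ltNge.
  by rewrite /phi /A subrr mulr0 expR0 mulr1 subr_ge0 (le_trans ua)// lerDl.
have cb' : c < b.
  rewrite lt_neqAle cb andbT; apply/eqP => e; move: phic; rewrite e ltNge.
  by rewrite /phi /B subrr mulr0 expR0 mulr1 subr_ge0 (le_trans ub)// lerDr.
have dphic : dphi c <= 0.
  have ca0 : 0 < c - a by rewrite subr_gt0.
  apply: (left_min_derive_le0 (hphi c) ca0) => y /andP[y1 y2].
  by apply: hc; apply/andP; split; lra.
have nphic : 0 < - phi c by rewrite oppr_gt0.
have [d d0 hd] := continuous_near (cphi c) nphic.
pose k := Num.min (d / 2) (b - c).
have k0 : 0 < k by rewrite lt_min divr_gt0// subr_gt0.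
have kd : k < d by rewrite gt_min; apply/orP; left; lra.
have kb : c + k <= b by rewrite -lerBrDl ge_min lexx orbT.
have ck : c < c + k by rewrite ltrDl.
have near y : c <= y <= c + k -> phi y < 0 /\ a <= y <= b.
  move=> /andP[y1 y2]; split; last by apply/andP; split; lra.
  have : `|y - c| < d by rewrite ger0_norm ?subr_ge0//; lra.
  by move=> /hd; rewrite ltr_norml => /andP[_]; lra.
(* Where [phi] is negative the flux strictly decreases. As it is nonpositive at the minimum [c],
   [phi] keeps decreasing to the right of [c], a contradiction. *)
have dz y : c <= y <= c + k -> 0 < - dzeta y.
  move=> yc; have [phiy yab] := near y yc.
  rewrite -mulrN mulr_gt0 ?expR_gt0// oppr_gt0.
  have h1 := gW _ yab.
  have h2 : p y * (g * B y - g * A y) <= `|p y| * g * (A y + B y).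
    rewrite (_ : p y * _ = (p y * g) * (B y - A y)); last by ring.
    apply: le_trans (ler_norm _) _; rewrite !normrM (ger0_norm (ltW g0)).
    apply: ler_wpM2l; first by rewrite mulr_ge0// ltW.
    rewrite (le_trans (ler_normB _ _))// !ger0_norm//; lra.
  have h3 : (g ^+ 2 + `|p y| * g) * (A y + B y) <= (W y - mu) * (A y + B y).
    by rewrite ler_wpM2r// addr_ge0.
  have Wp : 0 < W y - mu.
    by apply: lt_le_trans h1; rewrite ltr_pwDl ?exprn_gt0// mulr_ge0// ltW.
  have h4 : (W y - mu) * phi y < 0 by rewrite pmulr_rlt0.
  by move: h2 h3 h4; rewrite /phi; lra.
have zneg y : c < y <= c + k -> zeta y < 0.
  move=> /andP[y1 y2].
  have : - zeta c < - zeta y.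
    apply: (derive_gt0_lt y1 (fun s _ => is_derive1N (hzeta s))) => s /andP[s1 s2].
    by apply: dz; rewrite (ltW s1) (le_trans (ltW s2)).
  have : zeta c <= 0 by rewrite zetaE pmulr_rle0 ?expR_gt0.
  lra.
have : - phi c < - phi (c + k).
  apply: (derive_gt0_lt ck (fun s _ => is_derive1N (hphi s))) => s /andP[s1 s2].
  have : zeta s < 0 by apply: zneg; rewrite s1 ltW.
  by rewrite zetaE pmulr_rlt0 ?expR_gt0// oppr_gt0.
have : phi c <= phi (c + k) by apply: hc; rewrite kb andbT; lra.
lra.
Qed.

Lemma agmon_estimate a b g m : 0 < g -> a <= b ->
  (forall t, `|w t| <= m) ->
  (forall t, a <= t <= b -> g ^+ 2 + `|p t| * g <= W t - mu) ->
  forall t, a <= t <= b ->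
    `|w t| <= m * expR (- g * (t - a)) + m * expR (g * (t - b)).
Proof.
move=> g0 ab wm gW t tab.
have m0 : 0 <= m by apply: le_trans (wm 0).
have wm' s : - m <= w s <= m by rewrite -ler_norml.
rewrite ler_norml lerNl; apply/andP; split.
  have nsol : sl_solution E W mu (fun t => - w t) (fun t => - z t).
    by case: sol => hw hz; split=> s;
      [apply: (is_derive1_eq (is_derive1N (hw s)))|apply: (is_derive1_eq (is_derive1N (hz s)))]; ring.
  have wmN s : - w s <= m by rewrite lerNl; have /andP[] := wm' s.
  exact: (sl_barrier nsol).
have wmP s : w s <= m by have /andP[] := wm' s.
exact: (sl_barrier sol).
Qed.

(** At a maximum point of [|w|] the flux [z] vanishes, so over one period [|z|] and then [|w'|] are
    bounded by multiples of the maximum. Thus [|w|] stays above half its maximum on a length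
    [1 / (2 * Gam)], which fits in a period since [1 <= 2 * Gam * L]. *)
Lemma sl_mass N K Gam : periodic w L ->
  (forall t, expR (- E t) <= N) -> (forall t, expR (E t) * `|W t - mu| <= K) ->
  N * K * L <= Gam -> 1 <= 2 * Gam * L ->
  (exists t, w t != 0) ->
  exists m, [/\ 0 < m, forall t, `|w t| <= m &
    m ^+ 2 / (8 * Gam) <= sint (fun t => w t ^+ 2) 0 L].
Proof.
move=> pw hN hK hG GL [t0 wt0]; case: sol => hw hz.
have cw : continuous w := continuous1_derive hw.
have [c hc] : exists c, forall t, `|w t| <= `|w c|.
  apply: (@periodic_max R L L0 (fun t => `|w t|)); first by move=> t; rewrite pw.
  by move=> t; exact: cvg_norm (cw t).
have m0 : 0 < `|w c| by apply: lt_le_trans (hc t0); rewrite normr_gt0.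
have N0 : 0 < N := lt_le_trans (expR_gt0 _) (hN 0).
have K0 : 0 <= K by apply: le_trans (hK 0); rewrite mulr_ge0 ?expR_ge0.
have G0 : 0 < Gam.
  rewrite ltNge; apply/negP => G0; have : 2 * Gam * L <= 0.
    by rewrite mulr_le0_ge0 ?(ltW L0)// mulr_ge0_le0.
  lra.
(* The square is used because [|w|] has no derivative at hand. *)
have zc : z c = 0.
  have max2 t : w t * w t <= w c * w c.
    by rewrite -!expr2 -[leLHS]real_normK ?num_real// -[leRHS]real_normK ?num_real//
      ler_pXn2r ?nnegrE.
  have := global_max_derive0 (is_derive1M (hw c) (hw c)) max2.
  move/eqP; rewrite mulrC -mulr2n mulrn_eq0/= mulf_eq0 mulf_eq0 -normr_eq0 (gt_eqF m0)/=.
  by rewrite gt_eqF ?expR_gt0//= => /eqP.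
exists `|w c|; split => //.
have cw2 : continuous (fun t => w t ^+ 2).
  by move=> t; rewrite /=; under eq_fun do rewrite expr2; exact: continuous1M.
have lw2 := lbm_continuous cw2.
pose d := (2 * Gam)^-1.
have d0 : 0 < d by rewrite invr_gt0 mulr_gt0.
have dL : d <= L by rewrite /d -[leLHS]mul1r ler_pdivrMr ?mulr_gt0// mulrC.
have zb t : c <= t <= c + L -> `|z t| <= K * `|w c| * L.
  move=> /andP[t1 t2]; rewrite -[z t]subr0 -zc.
  apply: (@le_trans _ _ (K * `|w c| * `|t - c|)).
    apply: (derive_normr_le (fun s _ => hz s)) => s _.
    by rewrite !normrM (ger0_norm (expR_ge0 _)) ler_pM ?mulr_ge0 ?expR_ge0.
  by rewrite ler_wpM2l ?mulr_ge0// ger0_norm ?subr_ge0//; lra.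
have wb t : c <= t <= c + d -> `|w c| / 2 <= `|w t|.
  move=> /andP[t1 t2].
  have h : `|w t - w c| <= Gam * `|w c| * `|t - c|.
    apply: (derive_normr_le (fun s _ => hw s)) => s.
    rewrite (min_l t1) (max_r t1) => /andP[s1 s2].
    rewrite normrM (ger0_norm (expR_ge0 _)).
    apply: le_trans (_ : N * K * L * `|w c| <= _); last by rewrite ler_wpM2r.
    rewrite -2!mulrA ler_pM ?expR_ge0// mulrA mulrAC; apply: zb.
    by rewrite s1 (le_trans s2)// (le_trans t2)// lerD2l.
  have h2 : Gam * `|w c| * `|t - c| <= `|w c| / 2.
    rewrite (@ger0_norm _ (t - c)) ?subr_ge0//.
    apply: (@le_trans _ _ (Gam * `|w c| * d)).
      by rewrite ler_wpM2l ?mulr_ge0 ?(ltW G0)//; lra.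
    by apply: eq_ler; rewrite /d; field; exact: lt0r_neq0.
  have := ler_normB (w t) (w t - w c); rewrite subKr.
  lra.
rewrite -(sint_periodic c lw2); last by move=> t; rewrite /= pw.
rewrite -(sint_chasles c (c + d) (c + L) lw2).
have i1 : `|w c| ^+ 2 / (8 * Gam) <= sint (fun t => w t ^+ 2) c (c + d).
  have -> : `|w c| ^+ 2 / (8 * Gam) = sint (fun=> (`|w c| / 2) ^+ 2) c (c + d).
    rewrite sint_cst addrC addKr /d expr_div_n; field; exact: lt0r_neq0.
  apply: le_sint => //; first exact: lbm_cst.
    by rewrite lerDl ltW.
  move=> t tcd; rewrite -[leRHS]real_normK ?num_real// ler_pXn2r ?nnegrE ?divr_ge0//.
  exact: wb.
have i2 : 0 <= sint (fun t => w t ^+ 2) (c + d) (c + L).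
  rewrite -[leLHS](mul0r (c + L - (c + d))) -(sint_cst 0).
  apply: le_sint => //; [exact: lbm_cst|by rewrite lerD2l|].
  by move=> t _; exact: sqr_ge0.
lra.
Qed.

End EigenfunctionEstimates.

(** * The profile of the metric *)

Section SmoothFunctions.
Variable R : realType.
Implicit Types (f g : R -> R) (L s : R).

Lemma derivable_is_derive1 f s : derivable f s 1 -> is_derive s 1 f (f^`()%classic s).
Proof. by move=> /derivableP; rewrite derive1E. Qed.

Lemma is_derive1_derive1 f s l : is_derive s 1 f l -> f^`()%classic s = l.
Proof. by move=> h; rewrite derive1E; exact: derive_val. Qed.

Lemma smooth_derive1 L f : smooth_circle L f -> smooth_circle L (f^`()%classic).
Proof.
move=> [pf df]; split.
  move=> s; have h := derivable_is_derive1 (df 0%N (s + L)).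
  have -> : f^`()%classic (s + L) = f^`()%classic s; last by [].
  apply/esym/is_derive1_derive1.
  exact: is_derive1_ext pf (is_derive1_shift h).
by move=> n s; rewrite /derive1n -iterSr; exact: (df n.+1).
Qed.

Lemma smooth_is_derive L f s : smooth_circle L f -> is_derive s 1 f (f^`()%classic s).
Proof. by move=> [_ df]; exact: derivable_is_derive1 (df 0%N s). Qed.

Lemma smooth_continuous L f : smooth_circle L f -> continuous f.
Proof. by move=> sf s; exact: is_derive_continuous (smooth_is_derive s sf). Qed.

(* A class of functions closed under differentiation, hence smooth. *)
Inductive trigonometric : (R -> R) -> Prop :=
| Tcst (k : R) : trigonometric (fun=> k)
| Tcos (a b : R) : trigonometric (fun s => cos (a * s + b))
| Tadd f g : trigonometric f -> trigonometric g -> trigonometric (fun s => f s + g s)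
| Tmul f g : trigonometric f -> trigonometric g -> trigonometric (fun s => f s * g s).

Lemma trigonometric_derive f : trigonometric f ->
  exists2 df, trigonometric df & forall s : R, is_derive s 1 f (df s).
Proof.
elim=> [k|a b|g h tg [dg tdg hg] th [dh tdh hh]|g h tg [dg tdg hg] th [dh tdh hh]].
- by exists (fun=> 0); [exact: Tcst|move=> s; exact: is_derive1cst].
- exists (fun s => a * cos (a * s + (b + pi / 2))).
    by apply: Tmul; [exact: Tcst|exact: Tcos].
  move=> s; apply: (is_derive1_eq (is_derive1_compf (g := fun s => a * s + b)
    (is_derive_cos _) (is_derive1D (is_derive1Z a (is_derive1id s)) (is_derive1cst b s)))).
  by rewrite addrA cosDpihalf mulr1 addr0 mulrC.
- exists (fun s => dg s + dh s); first exact: Tadd.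
  by move=> s; exact: is_derive1D (hg s) (hh s).
- exists (fun s => dg s * h s + g s * dh s); first by apply: Tadd; exact: Tmul.
  by move=> s; exact: is_derive1M (hg s) (hh s).
Qed.

Lemma trigonometric_smooth L f : trigonometric f -> periodic f L -> smooth_circle L f.
Proof.
move=> tf pf; split => // n s.
have : trigonometric (f^`(n)%classic).
  elim: n => [|n IH]; first by rewrite derive1n0.
  rewrite derive1nS; have [df tdf hdf] := trigonometric_derive IH.
  rewrite (_ : (f^`(n)%classic)^`()%classic = df) //.
  by apply/funext => t; exact: is_derive1_derive1.
by move=> /trigonometric_derive[df _ h]; have [] := h s.
Qed.

Lemma trigonometric_exp f n : trigonometric f -> trigonometric (fun s => f s ^+ n).
Proof.
move=> tf; elim: n => [|n IH]; first exact: Tcst.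
by rewrite (_ : (fun _ => _) = (fun s => f s * f s ^+ n));
  [exact: Tmul|apply/funext => s; rewrite exprS].
Qed.

Lemma exp_small (rho e : R) : 0 <= rho -> rho < 1 -> 0 < e -> exists N, rho ^+ N < e.
Proof.
move=> r0 r1 e0; have := @cvg_expr R rho; rewrite ger0_norm// => /(_ r1).
move=> /cvgrPdist_lt/(_ _ e0)[N _ /(_ N (leqnn N))] /=.
by rewrite sub0r normrN ger0_norm ?exprn_ge0// => h; exists N.
Qed.

(** The symmetry about pi brings [x] to the branch where cosine decreases. *)
Lemma cos_le_far (x0 x : R) : 0 <= x0 <= pi -> x0 <= x <= 2 * pi - x0 -> cos x <= cos x0.
Proof.
move=> /andP[x00 x0p]; wlog xp : x / x <= pi.
  move=> H /andP[h1 h2]; have [xp|px] := leP x pi; first by apply: H; rewrite ?h1.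
  have -> : cos x = cos (2 * pi - x).
    by rewrite -[RHS]cosN opprB -(cosD2pi (x - 2 * pi)) mulr_natl subrK.
  by apply: H; [lra|apply/andP; split; lra].
move=> /andP[h1 _]; rewrite leNgt ltr_cos ?in_itv/= ?x00 ?xp ?x0p//; first by rewrite -leNgt.
by rewrite (le_trans x00 h1).
Qed.

(** A high power of the raised cosine [c] peaked at [s0] acts as a bump: [r = e + 5 * c ^+ N] equals
    [e + 5] at [s0] and exactly [e] at the opposite point. *)
Lemma profile_exists (L s0 l e : R) : 0 < l -> 2 * l < L -> 0 < e -> e < 1 ->
  exists r : R -> R, [/\ smooth_circle L r,
    forall s, e <= r s <= 6,
    exists s1, r s1 = e,
    forall s, s0 + l <= s <= s0 + L - l -> r s <= 2 * e &
    exists2 eta, 0 < eta & forall s, `|s - s0| < eta -> 4 <= r s].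
Proof.
move=> l0 lL e0 e1; have L0 : 0 < L by lra.
pose om : R := 2 * pi / L; pose c s := 2^-1 + 2^-1 * cos (om * s + - (om * s0)).
have omE s : om * s + - (om * s0) = om * (s - s0) by rewrite mulrBr.
have om0 : 0 < om by rewrite divr_gt0// mulr_gt0// pi_gt0.
have omL : om * L = 2 * pi by rewrite /om divfK// gt_eqF.
have tc : trigonometric c.
  by apply: Tadd; [exact: Tcst|apply: Tmul; [exact: Tcst|exact: Tcos]].
have c01 s : 0 <= c s <= 1.
  have := cos_max (om * s + - (om * s0)); rewrite ler_norml => /andP[h1 h2].
  by rewrite /c; apply/andP; split; lra.
have pc : periodic c L.
  move=> s; rewrite /c (_ : om * (s + L) + _ = om * s + - (om * s0) + pi *+ 2).
    by rewrite cosD2pi.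
  by rewrite mulrDr omL mulr_natl; ring.
pose rho := 2^-1 + 2^-1 * cos (om * l).
have oml : 0 <= om * l <= pi.
  rewrite mulr_ge0 ?(ltW om0) ?(ltW l0)//=.
  have : om * (2 * l) <= om * L by rewrite ler_pM2l// ltW.
  by rewrite omL; lra.
have coslt : cos (om * l) < 1.
  rewrite -cos0 ltr_cos ?in_itv/= ?lexx ?pi_ge0//; exact: mulr_gt0.
have rho0 : 0 <= rho.
  have := cos_max (om * l); rewrite ler_norml => /andP[h1 h2].
  by rewrite /rho; lra.
have rho1 : rho < 1 by rewrite /rho; lra.
have e5 : 0 < e / 5 by rewrite divr_gt0.
(* [rho] is the value of [c] at distance [l] from [s0]; the power brings [5 * c ^+ N] below [e]
   beyond that distance. *)
have [N hN] := exp_small rho0 rho1 e5.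
pose r s := e + 5 * c s ^+ N.
have r1 s : e <= r s <= 6.
  have /andP[h0 h1] := c01 s.
  have h2 : c s ^+ N <= 1 by rewrite exprn_ile1.
  have h3 : 0 <= c s ^+ N by rewrite exprn_ge0.
  by rewrite /r; apply/andP; split; lra.
have tr : trigonometric r.
  by apply: Tadd; [exact: Tcst|apply: Tmul; [exact: Tcst|exact: trigonometric_exp]].
have sr : smooth_circle L r.
  by apply: trigonometric_smooth => // s; rewrite /r pc.
(* A positive power is needed for [0 ^+ N = 0] at the opposite point, where the minimum is
   attained. *)
have N0 : (0 < N)%N.
  by rewrite lt0n; apply/eqP => N0; move: hN; rewrite N0 expr0; lra.
exists r; split => //.
- exists (s0 + L / 2); rewrite /r /c omE (_ : om * _ = pi).
    by rewrite cospi mulrN1 subrr expr0n gtn_eqF// mulr0 addr0.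
  rewrite addrC addKr mulrA omL; by field.
- move=> s /andP[s1 s2]; suff : 5 * c s ^+ N <= e by rewrite /r; lra.
  have h1 : c s <= rho.
    rewrite /c /rho lerD2l ler_pM2l ?invr_gt0// omE; apply: cos_le_far => //.
    rewrite -omL -mulrBr !ler_pM2l//; apply/andP; split; lra.
  have h2 : c s ^+ N <= rho ^+ N.
    by apply: lerXn2r => //; rewrite nnegrE; have /andP[] := c01 s.
  lra.
have rs0 : r s0 = e + 5.
  by rewrite /r /c omE subrr mulr0 cos0 (_ : 2^-1 + _ = 1) ?expr1n ?mulr1//; field.
have [d d0 hd] := continuous_near (smooth_continuous sr (x := s0)) (@ltr01 R).
exists d => // s /hd; rewrite rs0 ltr_norml => /andP[h _]; lra.
Qed.

End SmoothFunctions.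

(** * Geometric control on the circle *)

Section ScalarFlow.
Variable R : realType.
Implicit Types (phi h c : R -> R) (a b t x y s K T L : R).

Definition integral_curve phi c := forall t : R, is_derive t 1 c (phi (c t)).

Definition lipschitz1 phi K := forall x y, `|phi x - phi y| <= K * `|x - y|.

Lemma lipschitz1_continuous phi K : 0 < K -> lipschitz1 phi K -> continuous phi.
Proof.
move=> K0 hphi x; apply: near_continuous => e e0; exists (e / K); first exact: divr_gt0.
move=> y; rewrite ltr_pdivlMr// => h; apply: le_trans (hphi y x) _.
by rewrite mulrC ltW.
Qed.

Lemma integral_curve_exists phi K x : 0 < K -> lipschitz1 phi K ->
  exists2 c, integral_curve phi c & c 0 = x.
Proof.
move=> K0 hphi.
have [||||||c [z [c0 _ hc _]]] := @picard R (fun _ v _ => phi v) (fun _ _ _ => 0) K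
  `|phi x| x 0 K0.
- by move=> v z cv _; exact: continuous1_comp (lipschitz1_continuous K0 hphi) cv.
- by move=> *; exact: continuous1cst.
- move=> _ v z v' z'; apply: le_trans (hphi _ _) _.
  by rewrite ler_wpM2l ?(ltW K0)// lerDl.
- by move=> *; rewrite subrr normr0 mulr_ge0 ?(ltW K0)// addr_ge0.
- by [].
- by move=> _; rewrite normr0.
by exists c.
Qed.

Lemma integral_curve_unique phi K c c' t0 : 0 < K -> lipschitz1 phi K ->
  integral_curve phi c -> integral_curve phi c' -> c t0 = c' t0 -> c = c'.
Proof.
move=> K0 hphi hc hc' e.
pose sh (d : R -> R) t := d (t + t0).
have hs d : integral_curve phi d -> forall t : R, is_derive t 1 (sh d) (phi (sh d t)).
  by move=> hd t; exact: is_derive1_shift (hd _).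
have z0 t : is_derive t 1 (fun _ : R => 0 : R) 0 by exact: is_derive1cst.
have [|||e1 _] := @ode_unique R (fun _ v _ => phi v) (fun _ _ _ => 0) K (sh c) (fun=> 0)
  (sh c') (fun=> 0) (ltW K0) _ _ (hs _ hc) z0 (hs _ hc') z0 _ erefl.
- move=> _ v z v' z'; apply: le_trans (hphi _ _) _.
  by rewrite ler_wpM2l ?(ltW K0)// lerDl.
- by move=> *; rewrite subrr normr0 mulr_ge0 ?(ltW K0)// addr_ge0.
- by rewrite /sh add0r.
apply/funext => t; have := congr1 (@^~ (t - t0)) e1.
by rewrite /sh subrK.
Qed.

(** The constant curve is the only one through a zero of the field. *)
Lemma integral_curve_zero phi K c t0 : 0 < K -> lipschitz1 phi K ->
  integral_curve phi c -> phi (c t0) = 0 -> forall t, c t = c t0.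
Proof.
move=> K0 hphi hc e t.
have h : integral_curve phi (fun=> c t0).
  by move=> s; rewrite e; exact: is_derive1cst.
by have := integral_curve_unique (t0 := t0) K0 hphi hc h erefl => /(congr1 (@^~ t)).
Qed.

Lemma integral_curve_pos phi K c : 0 < K -> lipschitz1 phi K ->
  integral_curve phi c -> 0 < phi (c 0) -> forall t, 0 < phi (c t).
Proof.
move=> K0 hphi hc p0 t; rewrite ltNge; apply/negP => pt.
have cpc : continuous (fun t => phi (c t)).
  exact: continuous1_comp (lipschitz1_continuous K0 hphi) (continuous1_derive hc).
have [s hs] : exists s, phi (c s) = 0.
  have [t0|/ltW t0] := leP 0 t.
    by have [s _ hs] := IVT_ge t0 cpc (ltW p0) pt; exists s.
  by have [s _ hs] := IVT_le t0 cpc pt (ltW p0); exists s.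
by move: p0; rewrite (integral_curve_zero K0 hphi hc hs) hs ltxx.
Qed.

Definition circle_interval L a b : set R :=
  [set s | exists k : int, a < s + k%:~R * L /\ s + k%:~R * L < b].

Definition gcc1 phi (I : set R) T : Prop := 0 < T /\
  forall x, exists t c, [/\ 0 < t < T, integral_curve phi c, c 0 = x & I (c (- t))].

Lemma circle_intervalN L a b s : circle_interval L (- b) (- a) s <->
  circle_interval L a b (- s).
Proof.
split=> -[k [h1 h2]]; exists (- k); rewrite rmorphN mulNr; split; lra.
Qed.

(** A primitive [H] of [h] is a clock: along a curve with positive speed it advances at rate 1 on
    the arc from [b] to [a + L], the complement of the interval, and at rate at most 1 elsewhere.
    Backwards, the worst start is [a + L], which must travel past [b]; since the interval is open,
    this takes strictly more than the crossing time. *)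
Lemma gccP_pos L phi K a b h T : 0 < L -> 0 < K -> lipschitz1 phi K ->
  periodic phi L -> a < b -> b < a + L ->
  (forall s, b <= s <= a + L -> 0 < phi s) ->
  continuous h -> (forall s, 0 < h s) ->
  (forall s, b <= s <= a + L -> h s * phi s = 1) ->
  (forall s, 0 < phi s -> h s * phi s <= 1) ->
  gcc1 phi (circle_interval L a b) T <-> sint h b (a + L) < T.
Proof.
move=> L0 K0 hphi pphi ab baL phi0 ch h0 h1 h2.
have lh := lbm_continuous ch.
pose H x := sint h 0 x.
have dH x : is_derive x 1 H (h x) by exact: sint_derive.
have HE x y : sint h x y = H y - H x.
  by rewrite /H -(sint_chasles 0 x y lh) addrC addKr.
have Hlt x y : x < y -> H x < H y.
  by move=> xy; apply: (derive_gt0_lt xy (fun s _ => dH s)).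
have HltP x y : H x < H y -> x < y.
  move=> xy; rewrite ltNge; apply/negP; rewrite le_eqVlt => /predU1P[e|/Hlt yx].
    by move: xy; rewrite e ltxx.
  by move: (lt_trans xy yx); rewrite ltxx.
have dHc c t : integral_curve phi c ->
    is_derive t 1 (fun t => H (c t)) (h (c t) * phi (c t)).
  by move=> hc; exact: is_derive1_compf (dH _) (hc t).
have notI s : b <= s <= a + L -> ~ circle_interval L a b s.
  move=> /andP[s1 s2] [k [k1 k2]].
  have e1 : (-1)%:~R * L < k%:~R * L by rewrite mulrNz mulN1r; lra.
  have e2 : k%:~R * L < 0%:~R * L by rewrite mul0r; lra.
  rewrite !ltr_pM2r// !ltr_int in e1 e2.
  by case: k e1 e2 {k1 k2} => [[|n]|[|n]].
have inc c : integral_curve phi c -> 0 < phi (c 0) -> forall s t, s < t -> c s < c t.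
  move=> hc pc s t st; apply: (derive_gt0_lt st (fun s _ => hc s)) => u _.
  exact: (integral_curve_pos K0 hphi hc pc).
split.
  move=> [T0 hT]; have [t [c [/andP[t0 tT] hc c0 It]]] := hT (a + L).
  have pc0 : 0 < phi (c 0) by rewrite c0; apply: phi0; rewrite lexx ltW.
  have pc := integral_curve_pos K0 hphi hc pc0.
  have nt0 : - t < 0 by rewrite oppr_lt0.
  have ctaL : c (- t) < a + L by rewrite -c0; exact: inc.
  have ctb : c (- t) < b.
    rewrite ltNge; apply/negP => bc; apply: (notI _ _ It); by rewrite bc ltW.
  apply: le_lt_trans tT; rewrite HE.
  have : H (c 0) - H (c (- t)) <= 0 - (- t).
    apply: (derive_le (ltW nt0) (fun s _ => dHc c s hc) (fun s _ => is_derive1id s)) => s _.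
    by apply: h2; exact: pc.
  by have := Hlt _ _ ctb; rewrite c0; lra.
move=> T0T.
have T00 : 0 < sint h b (a + L) by rewrite HE subr_gt0 Hlt.
have T0 : 0 < T by exact: lt_trans T0T.
split => // x.
(* A start inside the open interval stays there for a short time, but a positive time has to be
   exhibited. *)
have [[k [k1 k2]]|nIx] := pselect (circle_interval L a b x).
  have [c hc c0] := integral_curve_exists x K0 hphi.
  have e0 : 0 < Num.min (x + k%:~R * L - a) (b - (x + k%:~R * L)).
    by rewrite lt_min !subr_gt0 k1.
  have [d d0 hd] := continuous_near (continuous1_derive hc (x := 0)) e0.
  pose t := Num.min d T / 2.
  have t0 : 0 < t by rewrite divr_gt0// lt_min d0.
  have td : t < d by rewrite /t ltr_pdivrMr// gt_min; apply/orP; left; lra.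
  have tT : t < T by rewrite /t ltr_pdivrMr// gt_min; apply/orP; right; lra.
  exists t, c; split => //; first by rewrite t0.
  have : `|- t - 0| < d by rewrite subr0 normrN gtr0_norm.
  move=> /hd; rewrite c0 lt_min !ltr_norml => /andP[/andP[d1 d2] /andP[d3 d4]].
  by exists k; split; lra.
have [k /andP[k1 k2]] := circle_representative L0 x b.
have yaL : x + k%:~R * L <= a + L.
  rewrite leNgt; apply/negP => hy; apply: nIx; exists (k - 1).
  by rewrite intrB mulrBl mul1r; split; lra.
have [c hc c0] := integral_curve_exists (x + k%:~R * L) K0 hphi.
have pc0 : 0 < phi (c 0) by rewrite c0; apply: phi0; rewrite k1.
(* Otherwise the curve would spend on the arc a time halfway between the crossing time and [T], more
   than the clock allows. *)
have [t1 /andP[t10 t1T] ct1] : exists2 t1, 0 < t1 < T & c (- t1) < b.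
  apply: contrapT => no.
  have cb t : 0 < t < T -> b <= c (- t).
    by move=> tT; rewrite leNgt; apply/negP => ctb; apply: no; exists t.
  pose t := (sint h b (a + L) + T) / 2.
  have t0T : sint h b (a + L) < t < T by rewrite /t; apply/andP; split; lra.
  move: t0T => /andP[t1 t2]; have t0 : 0 < t by exact: lt_trans t1.
  have nt0 : - t < 0 by rewrite oppr_lt0.
  have : 0 - (- t) <= H (c 0) - H (c (- t)).
    apply: (derive_le (ltW nt0) (fun s _ => is_derive1id s) (fun s _ => dHc c s hc)) => s /andP[s1 s2].
    rewrite h1//; apply/andP; split.
      move: s2; rewrite le_eqVlt => /predU1P[->|s2]; first by rewrite c0.
      by rewrite -(opprK s); apply: cb; apply/andP; split; lra.
    move: s2; rewrite le_eqVlt => /predU1P[->|s2]; first by rewrite c0.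
    apply: le_trans yaL; rewrite -c0; apply: ltW; exact: inc.
  have : H (c 0) <= H (a + L).
    by rewrite c0; move: yaL; rewrite le_eqVlt => /predU1P[->//|/Hlt/ltW].
  have tt : 0 < t < T by rewrite t0.
  have : H b <= H (c (- t)).
    by have := cb _ tt; rewrite le_eqVlt => /predU1P[->//|/Hlt/ltW].
  move: t1; rewrite HE; lra.
have nt10 : - t1 <= 0 by rewrite oppr_le0 ltW.
(* At time [- t1] the curve may have run past [a]; the intermediate value theorem finds a time at
   which it is inside. *)
pose v := Num.max (c (- t1)) ((a + b) / 2).
have vb : v < b by rewrite gt_max ct1/=; lra.
have av : a < v by rewrite lt_max; apply/orP; right; lra.
have [||s /andP[s1 s2] cs] := IVT_le (v := v) nt10 (continuous1_derive hc).
- by rewrite le_max lexx.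
- by rewrite c0 (le_trans (ltW vb)).
have s0 : s < 0.
  rewrite lt_neqAle s2 andbT; apply/eqP => s0; move: cs; rewrite s0 c0 => e.
  by move: k1; rewrite e leNgt vb.
(* The curve started from a translate of [x]; by periodicity of [phi] it is moved back. *)
exists (- s), (fun t => c t - k%:~R * L); split.
- by apply/andP; split; lra.
- move=> t; have := is_derive1B (hc t) (is_derive1cst (k%:~R * L) t).
  have -> : phi (c t - k%:~R * L) = phi (c t).
    by rewrite -(periodic_int pphi k) subrK.
  by rewrite subr0.
- by rewrite c0 addrK.
- by rewrite opprK cs; exists k; rewrite subrK.
Qed.

End ScalarFlow.

(** * From arcs of the circle to intervals of the line *)

Section CircleIntervals.
Variable R : realType.
Notation mu := (@lebesgue_measure R).
Implicit Types (phi psi h c : R -> R) (a b t x y s K T L : R).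

(** An interval of length at least [L] would have dense translates, against the hypothesis on the
    closure. A translation by a period then places the right end [b] in the fundamental domain. *)
Lemma open_interval_circle_normal L (I : set R) : 0 < L -> open_interval_circle L I ->
  I !=set0 -> closure I <> setT ->
  exists a b, [/\ I = circle_interval L a b, a < b, b < a + L & 0 <= b < L].
Proof.
move=> L0 [a [b IE]] [x0 Ix0] cI.
have ab : a < b.
  by move: Ix0; rewrite IE => -[k [k1 k2]]; exact: lt_trans k2.
have baL : b < a + L.
  rewrite ltNge; apply/negP => aLb; apply: cI; apply/seteqP; split => // x _.
  have [k /andP[k1 k2]] := circle_representative L0 x a.
  move=> B /nbhs_ballP[e /= e0 eB].
  pose d := Num.min (e / 2) ((b - (x + k%:~R * L)) / 2).
  have d0 : 0 < d by rewrite lt_min !divr_gt0// subr_gt0; lra.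
  have de : d <= e / 2 by rewrite ge_min lexx.
  have db : d <= (b - (x + k%:~R * L)) / 2 by rewrite ge_min lexx orbT.
  exists (x + d); split; first by rewrite IE; exists k; split; lra.
  by apply: eB; rewrite /ball/= opprD addrA subrr sub0r normrN gtr0_norm//; lra.
have [k /andP[k1 k2]] := circle_representative L0 b 0.
exists (a + k%:~R * L), (b + k%:~R * L); split; [|lra|lra|by rewrite k1 /=; lra].
rewrite IE; apply/seteqP; split => s [j [j1 j2]].
  by exists (j + k); rewrite intrD mulrDl; split; lra.
by exists (j - k); rewrite intrB mulrBl; split; lra.
Qed.

Lemma integral_itv_sint f x y : lbm f -> x <= y ->
  (\int[mu]_(s in `[x, y]) (f s)%:E = (sint f x y)%:E)%E.
Proof.
move=> lf xy; rewrite sint_le// /Rintegral fineK//.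
exact: integrable_fin_num (lbm_integrable _ _ lf).
Qed.

Lemma integral_itvco_sint f x y : lbm f -> x <= y ->
  (\int[mu]_(s in `[x, y[) (f s)%:E = (sint f x y)%:E)%E.
Proof.
move=> lf xy; rewrite -integral_itv_sint//.
rewrite integral_itv_bndo_bndc//.
apply/measurable_EFinP; apply: measurable_funTS; by case: lf.
Qed.

(** The fundamental domain may cut the arc from [b] to [a + L] in two pieces, which the translation
    by [L] glues together. Nothing is assumed of [psi] off the arc except periodicity, so the
    continuous [h] replaces it. *)
Lemma integral_circle_complement L psi h a b : 0 < L -> a < b -> b < a + L ->
  0 <= b < L -> periodic psi L -> continuous h ->
  (forall s, b <= s <= a + L -> h s = psi s) ->
  (\int[mu]_(s in circle_dom L `&` ~` circle_interval L a b) (psi s)%:E =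
    (sint h b (a + L))%:E)%E.
Proof.
move=> L0 ab baL /andP[b0 bL] pp ch hpsi; have lh := lbm_continuous ch.
have intk (k : int) : (k = 0) \/ (1%:~R * L <= k%:~R * L) \/ (k%:~R * L <= (-1)%:~R * L).
  rewrite !ler_pM2r// !ler_int; case: k => [[|n]|n]; [by left|by right; left|].
  by right; right; rewrite NegzE lerN2 lez_nat.
have [a0|a0] := ltP a 0.
  have -> : circle_dom L `&` ~` circle_interval L a b = `[b, a + L]%classic.
    apply/seteqP; split => s; rewrite /circle_dom /= !in_itv/=.
      move=> [/andP[s0 sL] nI]; apply/andP; split.
        rewrite leNgt; apply/negP => sb; apply: nI; exists 0; rewrite mul0r addr0; split => //.
        exact: lt_le_trans s0.
      rewrite leNgt; apply/negP => sb; apply: nI; exists (-1).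
      by rewrite mulrNz mulN1r; split; lra.
    move=> /andP[s0 sL]; split; first by apply/andP; split; lra.
    move=> [k [k1 k2]]; case: (intk k) => [k0|].
      by move: k1 k2; rewrite k0 mul0r; lra.
    by rewrite mulrNz mulN1r mul1r => -[]; lra.
  rewrite -integral_itv_sint ?(ltW baL)//; apply: eq_integral => s.
  by rewrite inE/= in_itv/= => /hpsi ->.
have -> : circle_dom L `&` ~` circle_interval L a b = `[0, a]%classic `|` `[b, L[%classic.
  apply/seteqP; split => s; rewrite /circle_dom /= !in_itv/=.
    move=> [/andP[s0 sL] nI]; have [sa|sa] := leP s a; first by left; rewrite s0.
    right; rewrite sL andbT leNgt; apply/negP => sb; apply: nI; exists 0.
    by rewrite mul0r addr0.
  move=> h'; have s01 : 0 <= s < L.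
    by case: h' => /andP[h1 h2]; apply/andP; split; lra.
  split => // -[k [k1 k2]]; move: s01 => /andP[s0 sL]; case: (intk k) => [k0|].
    by move: k1 k2; rewrite k0 mul0r addr0; case: h' => /andP[h1 h2]; lra.
  rewrite mulrNz mulN1r mul1r => -[kL|kL]; first lra.
  by case: h' => /andP[h1 h2]; lra.
have mpsi D (F : R -> R) : continuous F -> measurable D -> {in D, psi =1 F} ->
    measurable_fun D (EFin \o psi).
  move=> cF mD e; apply/measurable_EFinP.
  apply: (eq_measurable_fun F); first by move=> s /e ->.
  by apply: measurable_funTS; exact: continuous_measurable_fun.
have chL : continuous (fun s => h (s + L)).
  apply: continuous1_comp ch _; apply: continuous1D; last exact: continuous1cst.
  by move=> x; exact: cvg_id.
have e1 : {in `[0, a]%classic, psi =1 fun s => h (s + L)}.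
  by move=> s; rewrite inE/= in_itv/= => /andP[s0 sa]; rewrite hpsi ?pp//; apply/andP; split; lra.
have e2 : {in `[b, L[%classic, psi =1 h}.
  by move=> s; rewrite inE/= in_itv/= => /andP[s0 sa]; rewrite hpsi//; apply/andP; split; lra.
rewrite integral_setU_EFin//; last 2 first.
- rewrite measurable_funU//; split; apply/measurable_EFinP.
    exact: mpsi chL _ e1.
  exact: mpsi ch _ e2.
- apply/disj_setPS => s [] /=; rewrite !in_itv/= => /andP[? ?] /andP[? ?]; lra.
have -> : (\int[mu]_(x in `[0%R, a]) (psi x)%:E =
    \int[mu]_(x in `[0%R, a]) (h (x + L)%R)%:E)%E.
  by apply: eq_integral => s /e1 ->.
have -> : (\int[mu]_(x in `[b, L[) (psi x)%:E = \int[mu]_(x in `[b, L[) (h x)%:E)%E.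
  by apply: eq_integral => s /e2 ->.
rewrite integral_itv_sint//; last exact: lbm_continuous.
rewrite integral_itvco_sint// ?(ltW bL)// -EFinD sint_shift// add0r addrC.
by rewrite sint_chasles.
Qed.

(** Reflection of space keeps the direction of time, so that a negative field becomes a positive
    one. *)
Lemma gcc1N phi I T : gcc1 phi I T ->
  gcc1 (fun s => - phi (- s)) [set s | I (- s)] T.
Proof.
move=> [T0 h]; split => // x; have [t [c [tT hc c0 It]]] := h (- x).
exists t, (fun t => - c t); split => //.
- by move=> s; rewrite opprK; exact: is_derive1N (hc s).
- by rewrite c0 opprK.
- by rewrite /= opprK.
Qed.

Lemma gcc1_positive L phi K a b : 0 < L -> 0 < K -> lipschitz1 phi K ->
  periodic phi L -> a < b -> b < a + L ->
  (forall s, b <= s <= a + L -> 0 < phi s) ->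
  exists h, [/\ continuous h, periodic h L,
    forall s, b <= s <= a + L -> h s = (phi s)^-1,
    0 < sint h b (a + L) &
    forall T, gcc1 phi (circle_interval L a b) T <-> sint h b (a + L) < T].
Proof.
move=> L0 K0 hphi pphi ab baL phi0; have cphi := lipschitz1_continuous K0 hphi.
have [c /andP[c1 c2] hc] := min_segment (ltW baL) cphi.
have m0 : 0 < phi c by apply: phi0; rewrite c1.
(* This is the maximum of [phi] and of its minimum on the arc: continuous, positive everywhere, at
   least [phi], and equal to it on the arc. *)
pose M s := 2^-1 * (phi s + phi c + `|phi s - phi c|).
have Mphi s : phi s <= M s by have := ler_norm (phi s - phi c); rewrite /M; lra.
have Mc s : phi c <= M s.
  by have := ler_norm (- (phi s - phi c)); rewrite normrN /M; lra.
have M0 s : 0 < M s by exact: lt_le_trans (Mc s).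
have cM : continuous M.
  apply: continuous1M; first exact: continuous1cst.
  apply: continuous1D; first by apply: continuous1D => //; exact: continuous1cst.
  move=> s; apply: cvg_norm; apply: continuous1B => //; exact: continuous1cst.
have ME s : b <= s <= a + L -> M s = phi s.
  by move=> /hc h; rewrite /M ger0_norm ?subr_ge0//; lra.
pose h s := (M s)^-1.
have ch : continuous h by apply: continuous1V => // s; rewrite gt_eqF.
have h0 s : 0 < h s by rewrite invr_gt0.
exists h; split => //.
- by move=> s; rewrite /h /M pphi.
- by move=> s /ME e; rewrite /h e.
- rewrite -[ltLHS](mul0r (a + L - b)) -(sint_cst 0).
  have [x /andP[x1 x2] hx] := min_segment (ltW baL) ch.
  apply: (@lt_le_trans _ _ (sint (fun=> h x) b (a + L))).
    by rewrite !sint_cst mul0r mulr_gt0// subr_gt0.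
  by apply: le_sint; [exact: lbm_cst|exact: lbm_continuous|exact: ltW|].
- move=> T; apply: (gccP_pos (K := K)) => //.
    by move=> s sJ; rewrite /h ME// mulVf// gt_eqF// phi0.
  by move=> s ps; rewrite /h mulrC ler_pdivrMr// mul1r.
Qed.

(** By the intermediate value theorem the field has one sign on the arc; the negative case is
    reflected, which explains the absolute value around the integral. *)
Lemma gcc1_nonvanishing L phi K a b : 0 < L -> 0 < K -> lipschitz1 phi K ->
  periodic phi L -> a < b -> b < a + L -> 0 <= b < L ->
  (forall s, ~ circle_interval L a b s -> phi s != 0) ->
  exists T0, [/\ 0 < T0,
    (`| \int[mu]_(s in circle_dom L `&` ~` circle_interval L a b) ((phi s)^-1)%:E |
      = T0%:E)%E &
    forall T, gcc1 phi (circle_interval L a b) T <-> T0 < T].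
Proof.
move=> L0 K0 hphi pphi ab baL b0L phi0; have cphi := lipschitz1_continuous K0 hphi.
have notI s : b <= s <= a + L -> ~ circle_interval L a b s.
  move=> /andP[s1 s2] [k [k1 k2]].
  have e1 : (-1)%:~R * L < k%:~R * L by rewrite mulrNz mulN1r; lra.
  have e2 : k%:~R * L < 0%:~R * L by rewrite mul0r; lra.
  rewrite !ltr_pM2r// !ltr_int in e1 e2.
  by case: k e1 e2 {k1 k2} => [[|n]|[|n]].
have pinv : periodic (fun s => (phi s)^-1) L by move=> s; rewrite pphi.
have noz s : b <= s <= a + L -> phi s != 0 by move=> /notI/phi0.
have [pb|pb] := ltP 0 (phi b).
  have pos s : b <= s <= a + L -> 0 < phi s.
    move=> /andP[s1 s2]; rewrite ltNge; apply/negP => ps.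
    have [t /andP[t1 t2] e] := IVT_ge s1 cphi (ltW pb) ps.
    by have := noz t; rewrite t1 (le_trans t2)// e eqxx => /(_ isT).
  have [h [ch ph hE T0 hT]] := gcc1_positive L0 K0 hphi pphi ab baL pos.
  exists (sint h b (a + L)); split => //.
  by rewrite (integral_circle_complement (h := h))//= ger0_norm// ltW.
have neg s : b <= s <= a + L -> phi s < 0.
  move=> /andP[s1 s2]; rewrite ltNge; apply/negP => ps.
  have [t /andP[t1 t2] e] := IVT_le s1 cphi pb ps.
  by have := noz t; rewrite t1 (le_trans t2)// e eqxx => /(_ isT).
pose phi' s := - phi (- s).
have hphi' : lipschitz1 phi' K.
  move=> x y; rewrite /phi' -opprD normrN; apply: le_trans (hphi _ _) _.
  by rewrite -opprD normrN.
have pphi' : periodic phi' L.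
  by move=> s; rewrite /phi' opprD -(periodic_int pphi 1) mul1r subrK.
have pos s : - a <= s <= - b + L -> 0 < phi' s.
  move=> /andP[s1 s2]; rewrite oppr_gt0 -(periodic_int pphi 1) mul1r; apply: neg.
  by apply/andP; split; lra.
have [||h [ch ph hE T0 hT]] := gcc1_positive L0 K0 hphi' pphi' _ _ pos; do ?lra.
exists (sint h (- a) (- b + L)); split => //.
  have cho : continuous (fun s => - h (- s)).
    by apply: continuous1N; apply: continuous1_comp ch _; apply: continuous1N => x; exact: cvg_id.
  rewrite (integral_circle_complement (h := fun s => - h (- s)))//; last first.
    move=> s /andP[s1 s2]; rewrite -(periodic_int ph 1) mul1r hE; last by apply/andP; split; lra.
    by rewrite /phi' opprD opprK invrN opprK -(periodic_int pphi 1 (s - L)) mul1r subrK.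
  have dF (t : R) : is_derive t 1 (fun s => sint h 0 (- s)) (- h (- t)).
    exact: is_derive1_opp (sint_derive 0 _ ch).
  rewrite (sint_FTC _ _ cho dF).
  have lh := lbm_continuous ch.
  have -> : sint h 0 (- (a + L)) - sint h 0 (- b) = - sint h (- a) (- b + L).
    have -> : sint h (- a) (- b + L) = sint h (- (a + L)) (- b).
      have -> : - a = - (a + L) + L by ring.
      by rewrite -sint_shift//; apply: sint_ext => s; rewrite ph.
    by rewrite -(sint_chasles 0 (- (a + L)) (- b) lh); ring.
  by rewrite /= normrN ger0_norm// ltW.
have IN : [set s | circle_interval L a b (- s)] = circle_interval L (- b) (- a).
  by apply/seteqP; split => s /circle_intervalN.
have IN' : [set s | circle_interval L (- b) (- a) (- s)] = circle_interval L a b.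
  apply/seteqP; split => s /=; first by move=> /circle_intervalN; rewrite opprK.
  by move=> Is; apply/circle_intervalN; rewrite opprK.
move=> T; rewrite -hT; split; first by move=> /gcc1N; rewrite IN.
move=> /gcc1N; rewrite IN' (_ : (fun s => _) = phi)//.
by apply/funext => s; rewrite /phi' opprK opprK.
Qed.

End CircleIntervals.

(** * Metrics of revolution *)

Section RevolutionMetric.
Variables (R : realType) (r : R -> R).
Hypothesis r0 : forall s, 0 < r s.
Local Notation g := (revolution_metric r).
Implicit Types (u : R * R -> R) (p : R * R).

(** Both difference quotients are the same function, so the limits agree even where no derivative
    exists. *)
Lemma pderivE0 u p : pderiv 0 u p = 'D_1 (fun x : R => u (x, p.2)) p.1.
Proof.
have e : (fun h : R => h^-1 *: ((u \o shift p) (h *: ((1 : R), (0 : R))) - u p)) =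
    (fun h : R => h^-1 *: (((fun x : R => u (x, p.2)) \o shift p.1) (h *: (1 : R)) - u (p.1, p.2))).
  apply/funext => h; case: p => s t /=.
  have -> : h *: ((1 : R), (0 : R)) + (s, t) = (h *: (1 : R) + s, t) :> R * R.
    by rewrite -[LHS]/(h *: (1 : R) + s, h *: (0 : R) + t) scaler0 add0r.
  by [].
exact: (congr1 (fun F : R -> R => lim (F @ 0^')) e).
Qed.

Lemma pderivE1 u p : pderiv 1 u p = 'D_1 (fun y : R => u (p.1, y)) p.2.
Proof.
have e : (fun h : R => h^-1 *: ((u \o shift p) (h *: ((0 : R), (1 : R))) - u p)) =
    (fun h : R => h^-1 *: (((fun y : R => u (p.1, y)) \o shift p.2) (h *: (1 : R)) - u (p.1, p.2))).
  apply/funext => h; case: p => s t /=.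
  have -> : h *: ((0 : R), (1 : R)) + (s, t) = (s, h *: (1 : R) + t) :> R * R.
    by rewrite -[LHS]/(h *: (0 : R) + s, h *: (1 : R) + t) scaler0 add0r.
  by [].
exact: (congr1 (fun F : R -> R => lim (F @ 0^')) e).
Qed.

Lemma pderiv_is_derive0 u p : differentiable u p ->
  is_derive p.1 1 (fun x : R => u (x, p.2)) (pderiv 0 u p).
Proof.
move=> du; have dx : differentiable (fun x : R => (x, p.2)) p.1.
  exact: differentiable_pair.
rewrite pderivE0; suff h : derivable (fun x : R => u (x, p.2)) p.1 1 by exact: derivableP h.
apply: diff_derivable; apply: (@differentiable_comp _ _ _ _ (fun x : R => (x, p.2)) u) => //.
by case: p du {dx}.
Qed.

Lemma pderiv_is_derive1 u p : differentiable u p ->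
  is_derive p.2 1 (fun y : R => u (p.1, y)) (pderiv 1 u p).
Proof.
move=> du; have dx : differentiable (fun y : R => (p.1, y)) p.2.
  exact: differentiable_pair.
rewrite pderivE1; suff h : derivable (fun y : R => u (p.1, y)) p.2 1 by exact: derivableP h.
apply: diff_derivable; apply: (@differentiable_comp _ _ _ _ (fun y : R => (p.1, y)) u) => //.
by case: p du {dx}.
Qed.

Lemma pderiv_fst0 (f : R -> R) p : pderiv 0 (fun z => f z.1) p = f^`()%classic p.1.
Proof. by rewrite pderivE0 derive1E. Qed.

Lemma pderiv_fst1 (f : R -> R) p : pderiv 1 (fun z => f z.1) p = 0.
Proof. by rewrite pderivE1 /=; exact: derive_cst. Qed.

Lemma pderiv_eq0 u p l : is_derive p.1 1 (fun x : R => u (x, p.2)) l -> pderiv 0 u p = l.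
Proof. by move=> h; rewrite pderivE0; exact: derive_val. Qed.

Lemma pderiv_eq1 u p l : is_derive p.2 1 (fun y : R => u (p.1, y)) l -> pderiv 1 u p = l.
Proof. by move=> h; rewrite pderivE1; exact: derive_val. Qed.

Lemma vol_revolution p : vol g p = r p.1.
Proof.
rewrite /vol; have -> : g p = diag_mx (\row_j if j == 0 then 1 else r p.1 ^+ 2).
  by apply/matrixP => i j; rewrite !mxE; case: eqP => [->|]; rewrite ?mulr1n ?mulr0n.
rewrite det_diag !big_ord_recl big_ord0 !mxE /= mul1r mulr1 sqrtr_sqr.
by rewrite ger0_norm// ltW.
Qed.

Lemma invmx_revolution p : invmx (g p) = \matrix_(i < 2, j < 2)
  if i == j then (if i == 0 then 1 else (r p.1 ^+ 2)^-1) else 0.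
Proof.
set h := \matrix_(_, _) _.
have r2 : r p.1 ^+ 2 != 0 by rewrite sqrf_eq0 gt_eqF.
have gh : g p *m h = 1%:M.
  apply/matrixP => i j; rewrite !mxE !big_ord_recl big_ord0 !mxE.
  by case: i => [[|[|]]] // ?; case: j => [[|[|]]] // ?;
    rewrite /= ?mulr0 ?mul0r ?mulr1 ?addr0 ?add0r ?divff.
have gu : g p \in unitmx by have [] := mulmx1_unit gh.
by rewrite -[LHS]mulmx1 -gh mulmxA mulVmx// mul1mx.
Qed.

Lemma grad_revolution0 u p : grad g u p 0 0 = pderiv 0 u p.
Proof.
rewrite /grad invmx_revolution !mxE !big_ord_recl big_ord0 !mxE /=.
by rewrite mul1r mul0r !addr0.
Qed.

Lemma grad_revolution1 u p : grad g u p 1 0 = (r p.1 ^+ 2)^-1 * pderiv 1 u p.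
Proof.
rewrite /grad invmx_revolution !mxE !big_ord_recl big_ord0 !mxE /=.
by rewrite mul0r addr0 add0r; congr (_ * pderiv _ _ _); apply/val_inj.
Qed.

Lemma inner_revolution p (v w : 'cV[R]_2) :
  inner g p v w = v 0 0 * w 0 0 + r p.1 ^+ 2 * v 1 0 * w 1 0.
Proof.
rewrite /inner !mxE !big_ord_recl big_ord0 !mxE !big_ord_recl !big_ord0 !mxE /=.
rewrite (_ : lift ord0 ord0 = 1); last exact/val_inj.
rewrite (_ : ord0 = 0); last exact/val_inj.
by ring.
Qed.

Lemma divergence_revolution (X : R * R -> 'cV[R]_2) p : divergence g X p =
  (r p.1)^-1 * (pderiv 0 (fun z => r z.1 * X z 0 0) p +
                pderiv 1 (fun z => r z.1 * X z 1 0) p).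
Proof.
have e i : (fun z => vol g z * X z i 0) = (fun z => r z.1 * X z i 0).
  by apply/funext => z; rewrite vol_revolution.
rewrite /divergence vol_revolution !big_ord_recl big_ord0 addr0 !e.
by rewrite (_ : lift ord0 ord0 = 1)//; exact/val_inj.
Qed.

Lemma inner_grad_revolution (f : R -> R) u p :
  inner g p (grad g (fun z => f z.1) p) (grad g u p) = f^`()%classic p.1 * pderiv 0 u p.
Proof.
rewrite inner_revolution !grad_revolution0 !grad_revolution1.
by rewrite pderiv_fst0 pderiv_fst1 !(mulr0, mul0r) addr0.
Qed.

Lemma smooth_torus_diff L u l p : smooth_torus L u -> differentiable (foldr (@pderiv R) u l) p.
Proof. by move=> [_]; exact. Qed.

(* The leading term is the s-derivative of eps r phi_s - r f' phi. *)
Lemma adjoint_generator_revolution L (f q dr df ddf : R -> R) (eps : R) (phi : R * R -> R) p :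
  (forall s : R, is_derive s 1 r (dr s)) ->
  (forall s : R, is_derive s 1 f (df s)) ->
  (forall s : R, is_derive s 1 df (ddf s)) ->
  smooth_torus L phi ->
  r p.1 * adjoint_generator g (fun z => f z.1) (fun z => q z.1) eps phi p =
    eps * (dr p.1 * pderiv 0 phi p + r p.1 * pderiv 0 (pderiv 0 phi) p)
    - ((dr p.1 * df p.1 + r p.1 * ddf p.1) * phi p + r p.1 * df p.1 * pderiv 0 phi p)
    + eps * (r p.1)^-1 * pderiv 1 (pderiv 1 phi) p + q p.1 * phi p * r p.1.
Proof.
move=> hr hf hdf sphi; case: p => s t.
set p := (s, t).
have d1 := smooth_torus_diff [::] p sphi; rewrite /= in d1.
have d2 := smooth_torus_diff [:: 0] p sphi; rewrite /= in d2.
have d3 := smooth_torus_diff [:: 1] p sphi; rewrite /= in d3.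
have rn : r p.1 != 0 by rewrite gt_eqF.
have dfE x : f^`()%classic x = df x by exact: is_derive1_derive1.
rewrite /adjoint_generator /laplacian !divergence_revolution.
have -> : pderiv 0 (fun z => r z.1 * grad g phi z 0 0) p =
    dr p.1 * pderiv 0 phi p + r p.1 * pderiv 0 (pderiv 0 phi) p.
  apply: pderiv_eq0; under eq_fun do rewrite grad_revolution0 /=.
  exact: is_derive1M (hr _) (pderiv_is_derive0 d2).
have -> : pderiv 1 (fun z => r z.1 * grad g phi z 1 0) p =
    (r p.1)^-1 * pderiv 1 (pderiv 1 phi) p.
  apply: pderiv_eq1; under eq_fun do rewrite grad_revolution1 /= mulrA.
  apply: is_derive1_eq (is_derive1Z _ (pderiv_is_derive1 d3)) _.
  by congr (_ * _); field.
have -> : pderiv 0 (fun z => r z.1 * (phi z *: grad g (fun z => f z.1) z) 0 0) p =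
   (dr p.1 * df p.1 + r p.1 * ddf p.1) * phi p + r p.1 * df p.1 * pderiv 0 phi p.
  apply: pderiv_eq0; under eq_fun do rewrite mxE grad_revolution0 pderiv_fst0 /= dfE.
  apply: is_derive1_eq (is_derive1M (hr _) (is_derive1M (pderiv_is_derive0 d1) (hdf _))) _.
  by rewrite /=; ring.
have -> : pderiv 1 (fun z => r z.1 * (phi z *: grad g (fun z => f z.1) z) 1 0) p = 0.
  apply: pderiv_eq1; under eq_fun do rewrite mxE grad_revolution1 pderiv_fst1 !mulr0.
  exact: is_derive1cst.
move: (pderiv 0 phi p) (pderiv 0 (pderiv 0 phi) p) (pderiv 1 (pderiv 1 phi) p) (phi p).
move: (r p.1) rn (dr p.1) (df p.1) (ddf p.1) (q p.1) => x xn dx y dy z a b c d.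
by field.
Qed.

End RevolutionMetric.

(** * Geometric control for a metric of revolution *)

Section GeometricControl.
Variables (R : realType) (L : R) (f r : R -> R) (I : set R).
Hypothesis L0 : 0 < L.
Hypothesis sf : smooth_circle L f.
Hypothesis r0 : forall s, 0 < r s.
Local Notation df := (f^`()%classic).
Local Notation g := (revolution_metric r).
Local Notation X := (grad g (fun p : R * R => f p.1)).

Lemma smooth_lipschitz1 : exists2 K, 0 < K & lipschitz1 df K.
Proof.
have s2 := smooth_derive1 (smooth_derive1 sf).
have [K K0 hK] := periodic_bounded L0 s2.1 (smooth_continuous s2).
exists (K + 1); first by rewrite ltr_wpDl.
move=> x y; rewrite distrC (distrC x).
apply: (derive_normr_le (fun s _ => smooth_is_derive s (smooth_derive1 sf))) => s _.
by rewrite (le_trans (hK s))// lerDl.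
Qed.

(** The gradient of a function of [s] has no theta component, so trajectories keep theta and project
    to scalar integral curves. *)
Lemma gcc_time1 T : gcc_time X (I `*` [set: R]) T <-> gcc1 df I T.
Proof.
have X0 p : X p 0 0 = df p.1 by rewrite grad_revolution0// pderiv_fst0.
have X1 p : X p 1 0 = 0 by rewrite grad_revolution1// pderiv_fst1 mulr0.
split=> -[T0 h]; split => // x.
  have [t [t0 tT [y [c [c0 hc cy]] [Iy _]]]] := h (x, 0).
  exists t, (fun s => (c s).1); split.
  - by rewrite t0.
  - by move=> s; rewrite -X0; have [] := hc s.
  - by rewrite c0.
  - by rewrite cy.
have [t [c [/andP[t0 tT] hc c0 It]]] := h x.1.
exists t; split => //; exists (c (- t), x.2) => //.
exists (fun s => (c s, x.2)); split => //; first by rewrite c0; case: x {c0}.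
move=> s; rewrite X0 X1 /=; split; first exact: hc.
exact: is_derive1cst.
Qed.

Hypothesis hI : open_interval_circle L I.
Hypothesis hI0 : I !=set0.
Hypothesis hIcl : closure I <> setT.

(** A critical point of [f] outside [I] is stationary for the flow and never reaches the control
    region. *)
Lemma GCC_nonvanishing : GCC X (I `*` [set: R]) <-> (forall s, ~ I s -> df s != 0).
Proof.
have [K K0 hK] := smooth_lipschitz1.
have pdf : periodic df L := (smooth_derive1 sf).1.
split.
  move=> [T /gcc_time1[T0 h]] s nIs; apply/negP => /eqP dfs.
  have [t [c [_ hc c0]]] := h s; rewrite (integral_curve_zero (t0 := 0) K0 hK hc) c0//.
have [a [b [IE ab baL b0L]]] := open_interval_circle_normal L0 hI hI0 hIcl.
move=> nz; rewrite IE in nz.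
have [T0 [T00 _ hT]] := gcc1_nonvanishing L0 K0 hK pdf ab baL b0L nz.
by exists (T0 + 1); apply/gcc_time1; rewrite IE; apply/hT; rewrite ltrDl.
Qed.

Lemma T_GCC_integral : GCC X (I `*` [set: R]) ->
  T_GCC X (I `*` [set: R]) =
    `| \int[lebesgue_measure]_(s in circle_dom L `&` ~` I) ((df s)^-1)%:E |%E /\
  (T_GCC X (I `*` [set: R]) < +oo)%E.
Proof.
move=> /GCC_nonvanishing nz.
have [K K0 hK] := smooth_lipschitz1.
have pdf : periodic df L := (smooth_derive1 sf).1.
have [a [b [IE ab baL b0L]]] := open_interval_circle_normal L0 hI hI0 hIcl.
rewrite IE in nz.
have [T0 [T00 e hT]] := gcc1_nonvanishing L0 K0 hK pdf ab baL b0L nz.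
suff -> : T_GCC X (I `*` [set: R]) = T0%:E by rewrite IE e ltry.
apply/eqP; rewrite eq_le; apply/andP; split.
  apply/lee_addgt0Pr => d d0; rewrite -EFinD; apply: ereal_inf_lbound.
  by exists (T0 + d) => //; apply/gcc_time1; rewrite IE; apply/hT; rewrite ltrDl.
apply: le_ereal_inf_tmp => _ [T] /(gcc_time1 T).1 hT' <-.
by rewrite lee_fin ltW//; apply/hT; rewrite -IE.
Qed.

End GeometricControl.

(** * Integrals over the torus *)

Section PlaneIntegral.
Variable R : realType.
Notation mu := (@lebesgue_measure R).
Implicit Types (F G : R * R -> R) (A B : R -> R) (a b s t M : R).

(** An open set is the countable union of the rational boxes it contains, which lie in the product
    sigma-algebra. *)
Lemma open_plane_measurable (U : set (R * R)) : open U -> measurable U.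
Proof.
move=> oU.
pose box (q : (rat * rat) * (rat * rat)) : set (R * R) :=
  `](ratr q.1.1 : R), (ratr q.1.2 : R)[%classic `*` `](ratr q.2.1 : R), (ratr q.2.2 : R)[%classic.
have -> : U = \bigcup_q (if pselect (box q `<=` U) then box q else set0).
  apply/seteqP; split => [p Up|p [q _]]; last by case: pselect => // qU /qU.
  have /nbhs_ballP[e /= e0 eU] : nbhs p U by move: (oU); rewrite openE; exact.
  have rat_between (x y : R) : x < y -> exists q : rat, x < ratr q < y.
    by move=> /rat_in_itvoo[q]; rewrite in_itv/= => h; exists q.
  have [q1 /andP[q11 q12]] := rat_between (p.1 - e) p.1 ltac:(lra).
  have [q2 /andP[q21 q22]] := rat_between p.1 (p.1 + e) ltac:(lra).
  have [q3 /andP[q31 q32]] := rat_between (p.2 - e) p.2 ltac:(lra).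
  have [q4 /andP[q41 q42]] := rat_between p.2 (p.2 + e) ltac:(lra).
  exists ((q1, q2), (q3, q4)) => //; case: pselect => [_|no] /=.
    by split; rewrite /= in_itv/= ?q12 ?q21 ?q32 ?q41.
  apply: no => x [] /=; rewrite !in_itv/= => /andP[x1 x2] /andP[x3 x4].
  by apply: eU; split; rewrite /ball/= ltr_distlC; apply/andP; split; lra.
apply: countable_bigcupT_measurable => [|q]; first exact: countableP.
case: pselect => qU /=; last exact: measurable0.
by apply: (@measurableX _ _ R R); exact: measurable_itv.
Qed.

Lemma continuous_plane_measurable F : continuous F -> measurable_fun setT F.
Proof.
move=> cF; apply: (measurability _ (RGenOpens.measurableE R)).
move=> _ [_ [a [b ->] <-]]; rewrite setTI; apply: open_plane_measurable.
by move/continuousP : cF; apply; exact: interval_open.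
Qed.

Definition bounded_measurable F := measurable_fun setT F /\ exists M, forall p, `|F p| <= M.
Local Notation bm := bounded_measurable.

Lemma bmD F G : bm F -> bm G -> bm (fun p => F p + G p).
Proof.
move=> [mF [M hM]] [mG [N hN]]; split; first exact: measurable_funD.
by exists (M + N) => p; rewrite (le_trans (ler_normD _ _))// lerD.
Qed.

Lemma bmM F G : bm F -> bm G -> bm (fun p => F p * G p).
Proof.
move=> [mF [M hM]] [mG [N hN]]; split; first exact: measurable_funM.
by exists (M * N) => p; rewrite normrM ler_pM.
Qed.

Lemma bm_cst (k : R) : bm (fun=> k).
Proof. by split; [exact: measurable_cst|exists `|k|]. Qed.

Lemma bmZ (k : R) F : bm F -> bm (fun p => k * F p).
Proof. exact: bmM (bm_cst k). Qed.

Lemma bmB F G : bm F -> bm G -> bm (fun p => F p - G p).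
Proof.
move=> mF mG; rewrite (_ : (fun p => _) = fun p => F p + (-1) * G p).
  by apply: bmD => //; exact: bmZ.
by apply/funext => p; rewrite mulN1r.
Qed.

Lemma bm_fst A : measurable_fun setT A -> (exists M, forall s, `|A s| <= M) ->
  bm (fun p => A p.1).
Proof.
move=> mA [M hM]; split; last by exists M.
exact: measurableT_comp mA measurable_fst.
Qed.

Lemma bm_snd A : measurable_fun setT A -> (exists M, forall s, `|A s| <= M) ->
  bm (fun p => A p.2).
Proof.
move=> mA [M hM]; split; last by exists M.
exact: measurableT_comp mA measurable_snd.
Qed.

Lemma bm_lbm1 F t : bm F -> lbm (fun s => F (s, t)).
Proof.
move=> [mF [M hM]]; split; last by move=> a b; exists M.
exact: measurableT_comp mF (measurable_fun_pair _ _).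
Qed.

Lemma bm_lbm2 F s : bm F -> lbm (fun t => F (s, t)).
Proof.
move=> [mF [M hM]]; split; last by move=> a b; exists M.
exact: measurableT_comp mF (measurable_fun_pair _ _).
Qed.

Definition rect a b : set (R * R) := `[0, a[%classic `*` `[0, b[%classic.

Lemma rect_measurable a b : measurable (rect a b).
Proof. by apply: measurableX; exact: measurable_itv. Qed.

Lemma rect_finite a b : ((mu \x mu)%E (rect a b) < +oo)%E.
Proof.
rewrite product_measure1E//= !lebesgue_measure_itv/=.
by do 2 case: ifP => _; rewrite ?(mule0, mul0e)// -!EFinB -EFinM ltry.
Qed.

Lemma bm_integrable F a b : bm F ->
  (mu \x mu)%E.-integrable (rect a b) (EFin \o F).
Proof.
move=> [mF [M hM]]; apply: measurable_bounded_integrable.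
- exact: rect_measurable.
- exact: rect_finite.
- exact: measurable_funTS.
- exists M; split; first exact: num_real.
  by move=> N MN p _ /=; exact: le_trans (hM p) (ltW MN).
Qed.

Definition rect_int a b F : R := fine (\int[(mu \x mu)%E]_(p in rect a b) (F p)%:E)%E.

Lemma rect_intE a b F : bm F ->
  (\int[(mu \x mu)%E]_(p in rect a b) (F p)%:E = (rect_int a b F)%:E)%E.
Proof.
move=> bF; rewrite /rect_int fineK//.
apply: integrable_fin_num; [exact: rect_measurable|exact: bm_integrable].
Qed.

Lemma rect_intD a b F G : bm F -> bm G ->
  rect_int a b (fun p => F p + G p) = rect_int a b F + rect_int a b G.
Proof.
move=> bF bG; apply: EFin_inj; rewrite EFinD -!rect_intE//; last exact: bmD.
rewrite -integralD_EFin//; [exact: rect_measurable|exact: bm_integrable|exact: bm_integrable].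
Qed.

Lemma rect_intZ a b k F : bm F -> rect_int a b (fun p => k * F p) = k * rect_int a b F.
Proof.
move=> bF; apply: EFin_inj; rewrite EFinM -!rect_intE//; last exact: bmZ.
rewrite -integralZl//; [exact: rect_measurable|exact: bm_integrable].
Qed.

Lemma rect_intB a b F G : bm F -> bm G ->
  rect_int a b (fun p => F p - G p) = rect_int a b F - rect_int a b G.
Proof.
move=> bF bG; rewrite -[RHS]/(_ + - _) -(mulN1r (rect_int a b G)) -rect_intZ// -rect_intD//.
  by congr rect_int; apply/funext => p; rewrite mulN1r.
exact: bmZ.
Qed.

Lemma rect_integrable_patch F a b : bm F ->
  (mu \x mu)%E.-integrable setT ((EFin \o F) \_ (rect a b)).
Proof.
by move=> bF; rewrite -integrable_mkcond; [exact: bm_integrable|exact: rect_measurable].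
Qed.

Lemma rect_patch1 F a b s : bm F -> 0 <= b ->
  (\int[mu]_t ((EFin \o F) \_ (rect a b)) (s, t) =
    (((fun s => (sint (fun t => F (s, t)) 0%R b)%:E) \_ `[0%R, a[%classic) s))%E.
Proof.
move=> bF b0; rewrite [RHS]patchE; case: ifPn => sa.
  rewrite -integral_itvco_sint//; last exact: bm_lbm2.
  rewrite [RHS]integral_mkcond; apply: eq_integral => t _.
  rewrite !patchE; congr (if _ then _ else _).
  apply/idP/idP; rewrite !inE /rect /=; first by case.
  by move=> h; split => //; rewrite inE in sa.
rewrite integral0_eq// => t _; rewrite patchE memNset// => -[] /= h _.
by move/negP: sa; apply; rewrite inE.
Qed.

Lemma rect_patch2 F a b t : bm F -> 0 <= a ->
  (\int[mu]_s ((EFin \o F) \_ (rect a b)) (s, t) =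
    (((fun t => (sint (fun s => F (s, t)) 0%R a)%:E) \_ `[0%R, b[%classic) t))%E.
Proof.
move=> bF b0; rewrite [RHS]patchE; case: ifPn => sa.
  rewrite -integral_itvco_sint//; last exact: bm_lbm1.
  rewrite [RHS]integral_mkcond; apply: eq_integral => s _.
  rewrite !patchE; congr (if _ then _ else _).
  apply/idP/idP; rewrite !inE /rect /=; first by case.
  by move=> h; split => //; rewrite inE in sa.
rewrite integral0_eq// => s _; rewrite patchE memNset// => -[] /= _ h.
by move/negP: sa; apply; rewrite inE.
Qed.

(** Fubini with the inner integral already evaluated. Both orders occur: theta first removes the
    angular derivatives, [s] first uses the weak radial equation. *)
Lemma rect_int_fiber1 a b F A : bm F -> 0 <= a -> 0 <= b -> lbm A ->
  (forall s, sint (fun t => F (s, t)) 0 b = A s) -> rect_int a b F = sint A 0 a.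
Proof.
move=> bF a0 b0 lA h; apply: EFin_inj; rewrite -rect_intE// integral_mkcond.
rewrite -integral12_prod_meas1; last exact: rect_integrable_patch.
rewrite -integral_itvco_sint// [RHS]integral_mkcond; apply: eq_integral => s _.
by rewrite /fubini_F rect_patch1//; congr (_ \_ _); apply/funext => x; rewrite h.
Qed.

Lemma rect_int_fiber2 a b F A : bm F -> 0 <= a -> 0 <= b -> lbm A ->
  (forall t, sint (fun s => F (s, t)) 0 a = A t) -> rect_int a b F = sint A 0 b.
Proof.
move=> bF a0 b0 lA h; apply: EFin_inj; rewrite -rect_intE// integral_mkcond.
rewrite -integral21_prod_meas1; last exact: rect_integrable_patch.
rewrite -integral_itvco_sint// [RHS]integral_mkcond; apply: eq_integral => s _.
by rewrite /fubini_G rect_patch2//; congr (_ \_ _); apply/funext => x; rewrite h.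
Qed.

Lemma sint0 a b : sint (fun=> 0 : R) a b = 0.
Proof. by rewrite sint_cst mul0r. Qed.

(** The fibres of the difference vanish, which avoids studying the fibre integrals as functions of
    [t]. *)
Lemma rect_int_eq2 a b F G : bm F -> bm G -> 0 <= a -> 0 <= b ->
  (forall t, sint (fun s => F (s, t)) 0 a = sint (fun s => G (s, t)) 0 a) ->
  rect_int a b F = rect_int a b G.
Proof.
move=> bF bG a0 b0 h; apply/eqP; rewrite -subr_eq0 -rect_intB//; apply/eqP.
rewrite (rect_int_fiber2 (A := fun=> 0)) ?sint0//; [exact: bmB|exact: lbm_cst|].
by move=> s; rewrite sintB ?h ?subrr//; exact: bm_lbm1.
Qed.

Lemma bounded_periodic_torus L u : 0 < L -> continuous u -> periodic_torus L u ->
  exists M, forall p : R * R, `|u p| <= M.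
Proof.
move=> L0 cu [p1 p2].
have pi20 : 0 < 2 * pi :> R by rewrite mulr_gt0// pi_gt0.
pose D : set (R * R) := `[0, L]%classic `*` `[0, 2 * pi]%classic.
have D0 : D !=set0 by exists (0, 0); split; rewrite /= in_itv/= lexx ltW.
have cD : compact D by apply: compact_setX; exact: segment_compact.
have cnu : {within D, continuous (fun p => `|u p|)}.
  by apply: continuous_subspaceT => p; apply: cvg_norm; exact: cu.
have [c _ hc] := compact_EVT_max D0 cD cnu.
exists `|u c| => -[s t].
have [k /andP[k1 k2]] := circle_representative L0 s 0.
have [j /andP[j1 j2]] := circle_representative pi20 t 0.
have e1 : u (s, t) = u (s + k%:~R * L, t).
  have pp : periodic (fun s => u (s, t)) L.
    by move=> x; have := p1 (x, t); rewrite -[_ + _]/(x + L, t + 0) addr0.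
  by rewrite (periodic_int pp k s).
have e2 : u (s + k%:~R * L, t) = u (s + k%:~R * L, t + j%:~R * (2 * pi)).
  have pp : periodic (fun t => u (s + k%:~R * L, t)) (2 * pi).
    by move=> x; have := p2 (s + k%:~R * L, x); rewrite -[_ + _]/(_ + 0, x + 2 * pi) addr0.
  by rewrite (periodic_int pp j t).
rewrite e1 e2; apply: hc; rewrite inE; split; rewrite /= in_itv/=.
  by rewrite k1 ltW//; lra.
by rewrite j1 ltW//; lra.
Qed.

End PlaneIntegral.
Notation bm := bounded_measurable.

(** * Separated solutions *)

Lemma continuous_slice1 (R : realType) (u : R * R -> R) (t : R) :
  continuous u -> continuous (fun s => u (s, t)).
Proof.
move=> cu s; apply: (continuous_comp (f := fun s => (s, t)) (g := u)); last exact: cu.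
by apply: differentiable_continuous; exact: differentiable_pair.
Qed.

Lemma continuous_slice2 (R : realType) (u : R * R -> R) (s : R) :
  continuous u -> continuous (fun t => u (s, t)).
Proof.
move=> cu t; apply: (continuous_comp (f := fun t => (s, t)) (g := u)); last exact: cu.
by apply: differentiable_continuous; exact: differentiable_pair.
Qed.

(** * Smooth functions on the torus *)

Section SmoothTorus.
Variables (R : realType) (L : R).
Hypothesis L0 : 0 < L.
Implicit Types (phi u : R * R -> R).

Lemma periodic_torusE u : periodic_torus L u <->
  (forall s t, u (s + L, t) = u (s, t)) /\ (forall s t, u (s, t + 2 * pi) = u (s, t)).
Proof.
split=> -[h1 h2]; split.
- by move=> s t; have := h1 (s, t); rewrite -[_ + _]/(s + L, t + 0) addr0.
- by move=> s t; have := h2 (s, t); rewrite -[_ + _]/(s + 0, t + 2 * pi) addr0.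
- by case=> s t; rewrite -[_ + _]/(s + L, t + 0) addr0.
- by case=> s t; rewrite -[_ + _]/(s + 0, t + 2 * pi) addr0.
Qed.

Lemma derive_shift_periodic (f : R -> R) (c x : R) :
  (forall y, f (y + c) = f y) -> 'D_1 f (x + c) = 'D_1 f x.
Proof.
move=> pf; rewrite /derive.
have e : (fun h : R => h^-1 *: ((f \o shift (x + c)) (h *: (1 : R)) - f (x + c))) =
    (fun h : R => h^-1 *: ((f \o shift x) (h *: (1 : R)) - f x)).
  by apply/funext => h /=; rewrite addrA !pf.
exact: (congr1 (fun F : R -> R => lim (F @ 0^')) e).
Qed.

Lemma periodic_pderiv i u : periodic_torus L u -> periodic_torus L (pderiv i u).
Proof.
move=> /periodic_torusE[h1 h2]; apply/periodic_torusE.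
have [->|i1] := eqVneq i 0.
  split=> s t; rewrite !pderivE0 /=; first exact: derive_shift_periodic.
  by under eq_fun do rewrite h2.
have -> : i = 1 by apply/val_inj; case: i i1 => [[|[|]]].
split=> s t; rewrite !pderivE1 /=; last exact: derive_shift_periodic.
by under eq_fun do rewrite h1.
Qed.

Lemma smooth_periodic phi l : smooth_torus L phi -> periodic_torus L (foldr (@pderiv R) phi l).
Proof. by move=> [pphi _]; elim: l => //= i l IH; exact: periodic_pderiv. Qed.

Lemma smooth_torus_continuous phi l : smooth_torus L phi ->
  continuous (foldr (@pderiv R) phi l).
Proof.
by move=> sphi p; apply: differentiable_continuous; exact: smooth_torus_diff sphi.
Qed.

Lemma smooth_torus_bm phi l : smooth_torus L phi -> bm (foldr (@pderiv R) phi l).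
Proof.
move=> sphi; have cphi := smooth_torus_continuous (l := l) sphi; split.
  exact: continuous_plane_measurable.
exact: bounded_periodic_torus L0 cphi (smooth_periodic l sphi).
Qed.

End SmoothTorus.

Section SeparatedSolution.
Variables (R : realType) (L : R) (r dr f df ddf q qb V dV : R -> R).
Variables (eps lam : R) (k : nat).
Notation mu := (@lebesgue_measure R).
Hypothesis L0 : 0 < L.
Hypothesis r0 : forall s, 0 < r s.
Hypothesis hr : forall s : R, is_derive s 1 r (dr s).
Hypothesis hf : forall s : R, is_derive s 1 f (df s).
Hypothesis hdf : forall s : R, is_derive s 1 df (ddf s).
Hypothesis hV : forall s : R, is_derive s 1 V (dV s).
Hypotheses (cdr : continuous dr) (cddf : continuous ddf) (cdV : continuous dV).
Hypotheses (pr : periodic r L) (pdr : periodic dr L).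
Hypotheses (pdf : periodic df L) (pddf : periodic ddf L).
Hypotheses (pV : periodic V L) (pq : periodic q L).
Hypotheses (mq : measurable_fun setT q) (mqb : measurable_fun setT qb).
Hypothesis bqb : exists M : R, forall s, `|qb s| <= M.
Hypothesis qqb : {ae mu, forall s, q s = qb s}.
(* The weak form of eps (r V')' + r f' V' + (q r - eps k^2 / r) V = - lam r V. *)
Hypothesis weak : forall chi dchi : R -> R, continuous dchi ->
  (forall s : R, is_derive s 1 chi (dchi s)) -> periodic chi L ->
  sint (fun s => (qb s * r s - eps * k%:R ^+ 2 / r s + lam * r s) * (V s * chi s)
    + (r s * df s * dV s * chi s - eps * r s * dV s * dchi s)) 0 L = 0.
Local Notation g := (revolution_metric r).
Local Notation w := (fun t : R => cos (k%:R * t)).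

Let pi20 : 0 < 2 * pi :> R. Proof. by rewrite mulr_gt0// pi_gt0. Qed.
Let cr : continuous r := continuous1_derive hr.
Let cdf : continuous df := continuous1_derive hdf.
Let cV : continuous V := continuous1_derive hV.

Let hw (t : R) : is_derive t 1 w (- (k%:R * sin (k%:R * t))).
Proof.
apply: (is_derive1_eq (is_derive1_compf (g := fun t => k%:R * t) (is_derive_cos _)
  (is_derive1Z k%:R (is_derive1id t)))).
by rewrite mulr1 mulNr mulrC.
Qed.

Let hws (t : R) : is_derive t 1 (fun t => sin (k%:R * t)) (k%:R * w t).
Proof.
apply: (is_derive1_eq (is_derive1_compf (g := fun t => k%:R * t) (is_derive_sin _)
  (is_derive1Z k%:R (is_derive1id t)))).
by rewrite mulr1 mulrC.
Qed.

Let cw : continuous w := continuous1_derive hw.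

Lemma periodic_cos_nat (t : R) : w (t + 2 * pi) = w t.
Proof.
have -> : k%:R * (t + 2 * pi) = k%:R * t + (pi *+ 2) *+ k :> R.
  by rewrite -mulr_natr -mulr_natr; ring.
exact: (periodicn (@cosD2pi R)).
Qed.

Let bmr1 (A : R -> R) : continuous A -> periodic A L -> bm (fun p : R * R => A p.1).
Proof.
move=> cA pA; apply: bm_fst; first exact: continuous_measurable_fun.
by have [M _ hM] := periodic_bounded L0 pA cA; exists M.
Qed.

Let bmw : bm (fun p : R * R => w p.2).
Proof.
apply: bm_snd; first exact: continuous_measurable_fun.
by exists 1 => s; exact: cos_max.
Qed.

Let bmqb : bm (fun p : R * R => qb p.1). Proof. exact: bm_fst. Qed.
Let bmr := bmr1 cr pr.
Let bmV := bmr1 cV pV.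
Let bmrV : bm (fun p : R * R => (r p.1)^-1).
Proof.
apply: (bmr1 (A := fun s => (r s)^-1)); last by move=> s; rewrite pr.
by apply: continuous1V => // s; rewrite gt_eqF.
Qed.

Definition separated (t : R) (p : R * R) : R := expR (- lam * t) * (V p.1 * w p.2).

Lemma separated_periodic t : periodic_torus L (separated t).
Proof.
apply/periodic_torusE; split=> s x; rewrite /separated /=; first by rewrite pV.
by rewrite periodic_cos_nat.
Qed.

Lemma separated_bm t : bm (separated t).
Proof. by apply: bmZ; apply: bmM. Qed.

Lemma int_vol_rect (F : R * R -> R) : bm F ->
  int_vol g L setT F = (rect_int L (2 * pi) (fun p => F p * r p.1))%:E.
Proof.
move=> bF; rewrite /int_vol setIT -rect_intE; last exact: bmM.
by apply: eq_integral => p _; rewrite vol_revolution.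
Qed.

Lemma separated_L2 t : L2_torus g L (separated t).
Proof.
split; first exact: separated_periodic.
  by have [] := separated_bm t.
rewrite int_vol_rect ?ltry//.
by under eq_fun do rewrite expr2; apply: bmM; exact: separated_bm.
Qed.

Let cstV := rect_int L (2 * pi) (fun p => (V p.1 * w p.2) ^+ 2 * r p.1).

Let bmVw2 : bm (fun p => (V p.1 * w p.2) ^+ 2 * r p.1).
Proof. by apply: bmM => //; under eq_fun do rewrite expr2; do 2 apply: bmM. Qed.

Lemma separated_normE t : int_vol g L setT (fun p => separated t p ^+ 2) =
  (expR (- lam * t) ^+ 2 * cstV)%:E.
Proof.
rewrite int_vol_rect; last first.
  by under eq_fun do rewrite expr2; apply: bmM; exact: separated_bm.
congr EFin; rewrite -rect_intZ//; congr rect_int; apply/funext => p.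
by rewrite /separated exprMn mulrA.
Qed.

Lemma separated_diffE t t' : int_vol g L setT (fun p => (separated t' p - separated t p) ^+ 2) =
  ((expR (- lam * t') - expR (- lam * t)) ^+ 2 * cstV)%:E.
Proof.
rewrite int_vol_rect; last first.
  by under eq_fun do rewrite expr2; apply: bmM; apply: bmB; exact: separated_bm.
congr EFin; rewrite -rect_intZ//; congr rect_int; apply/funext => p.
by rewrite /separated -mulrBl exprMn mulrA.
Qed.

Let gen (phi : R * R -> R) p := adjoint_generator g (fun z => f z.1) (fun z => qb z.1) eps phi p.

Let slead (phi : R * R -> R) p :=
  eps * (dr p.1 * pderiv 0 phi p + r p.1 * pderiv 0 (pderiv 0 phi) p)
    - ((dr p.1 * df p.1 + r p.1 * ddf p.1) * phi p + r p.1 * df p.1 * pderiv 0 phi p).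

(** The term [eps * k ^+ 2 / r] is subtracted in [F1] and added back in [F2]: [F1] then contains
    only [s]-derivatives, and [F2] is an exact derivative along theta. *)
Let F1 (phi : R * R -> R) p := w p.2 * (V p.1 * slead phi p +
  (qb p.1 * r p.1 - eps * k%:R ^+ 2 * (r p.1)^-1) * (V p.1 * phi p)).
Let F2 (phi : R * R -> R) p := eps * (V p.1 * (r p.1)^-1 *
  (w p.2 * pderiv 1 (pderiv 1 phi) p + k%:R ^+ 2 * (w p.2 * phi p))).

Let genE phi p : smooth_torus L phi -> V p.1 * w p.2 * gen phi p * r p.1 =
  F1 phi p + F2 phi p.
Proof.
move=> sphi; rewrite -mulrA [gen _ _ * _]mulrC /gen.
rewrite (adjoint_generator_revolution r0 qb eps p hr hf hdf sphi) /F1 /F2 /slead.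
by move: (pderiv 1 (pderiv 1 phi) p) (pderiv 0 phi p) (pderiv 0 (pderiv 0 phi) p) => a b c; ring.
Qed.

Let bmphi phi : smooth_torus L phi -> [/\ bm phi, bm (pderiv 0 phi),
  bm (pderiv 0 (pderiv 0 phi)) & bm (pderiv 1 (pderiv 1 phi))].
Proof.
move=> sphi; split.
- exact: (smooth_torus_bm L0 [::] sphi).
- exact: (smooth_torus_bm L0 [:: 0] sphi).
- exact: (smooth_torus_bm L0 [:: 0; 0] sphi).
- exact: (smooth_torus_bm L0 [:: 1; 1] sphi).
Qed.

Let bmslead phi : smooth_torus L phi -> bm (slead phi).
Proof.
move=> /bmphi[b1 b2 b3 b4].
have bdr := bmr1 cdr pdr; have bdf := bmr1 cdf pdf; have bddf := bmr1 cddf pddf.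
by apply: bmB; [apply: bmZ; apply: bmD; apply: bmM|
  apply: bmD; apply: bmM => //; do ?apply: bmD; apply: bmM].
Qed.

Let bmF1 phi : smooth_torus L phi -> bm (F1 phi).
Proof.
move=> sphi; have [b1 b2 b3 b4] := bmphi sphi; have bs := bmslead sphi.
apply: bmM => //; apply: bmD; first exact: bmM.
apply: bmM; last exact: bmM.
by apply: bmB; [apply: bmM|apply: bmZ].
Qed.

Let bmF2 phi : smooth_torus L phi -> bm (F2 phi).
Proof.
move=> sphi; have [b1 b2 b3 b4] := bmphi sphi.
apply: bmZ; apply: bmM; first exact: bmM.
by apply: bmD; [apply: bmM|apply: bmZ; apply: bmM].
Qed.

(** On each theta fibre the integrand is, up to a factor, the derivative of
    [w * phi_theta + k * sin (k theta) * phi], which is periodic. *)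
Let fiberF2 phi : smooth_torus L phi -> rect_int L (2 * pi) (F2 phi) = 0.
Proof.
move=> sphi; rewrite (rect_int_fiber1 (A := fun=> 0)) ?sint0 ?(ltW L0) ?(ltW pi20)//.
- exact: bmF2.
- exact: lbm_cst.
move=> s; rewrite /F2 /=.
have c0 := continuous_slice2 (s := s) (smooth_torus_continuous (l := [::]) sphi).
have c11 := continuous_slice2 (s := s) (smooth_torus_continuous (l := [:: 1; 1]) sphi).
have cin : continuous (fun t => w t * pderiv 1 (pderiv 1 phi) (s, t) +
    k%:R ^+ 2 * (w t * phi (s, t))).
  apply: continuous1D; first exact: continuous1M.
  by apply: continuous1M; [exact: continuous1cst|exact: continuous1M].
have h1 (t : R) : is_derive t 1 (fun t => phi (s, t)) (pderiv 1 phi (s, t)).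
  exact: (pderiv_is_derive1 (p := (s, t)) (smooth_torus_diff [::] (s, t) sphi)).
have h11 (t : R) : is_derive t 1 (fun t => pderiv 1 phi (s, t)) (pderiv 1 (pderiv 1 phi) (s, t)).
  exact: (pderiv_is_derive1 (p := (s, t)) (smooth_torus_diff [:: 1] (s, t) sphi)).
have lin := lbm_continuous cin.
rewrite sintZ; last by apply: lbmM => //; exact: lbm_cst.
have hprim (t : R) : is_derive t 1 (fun t => w t * pderiv 1 phi (s, t) +
    k%:R * (sin (k%:R * t) * phi (s, t)))
    (w t * pderiv 1 (pderiv 1 phi) (s, t) + k%:R ^+ 2 * (w t * phi (s, t))).
  apply: (is_derive1_eq (is_derive1D (is_derive1M (hw t) (h11 t))
    (is_derive1Z k%:R (is_derive1M (hws t) (h1 t))))).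
  by ring.
rewrite sintZ// (sint_FTC _ _ cin hprim).
have /periodic_torusE[_ p1] := smooth_periodic [:: 1] sphi.
have /periodic_torusE[_ p0] := smooth_periodic [::] sphi.
have := p1 s 0; have := p0 s 0; rewrite /= !add0r => -> ->.
have := periodic_cos_nat 0; rewrite add0r => ->.
have -> : sin (k%:R * (2 * pi)) = sin (k%:R * 0) :> R.
  have -> : k%:R * (2 * pi) = 0 + (pi *+ 2) *+ k :> R.
    by rewrite add0r -mulr_natr -mulr_natr; ring.
  by rewrite (periodicn (@sinD2pi R)) mulr0.
by rewrite subrr !mulr0.
Qed.

Let fiberF1 phi : smooth_torus L phi -> rect_int L (2 * pi) (F1 phi) =
  - lam * rect_int L (2 * pi) (fun p => V p.1 * w p.2 * phi p * r p.1).
Proof.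
move=> sphi; have [b1 b2 b3 b4] := bmphi sphi.
have bR : bm (fun p => V p.1 * w p.2 * phi p * r p.1) by do 3 apply: bmM => //.
rewrite -rect_intZ//; apply: rect_int_eq2; rewrite ?(ltW L0) ?(ltW pi20)//.
- exact: bmF1.
- exact: bmZ.
move=> t; rewrite /F1 /=.
pose chi s := phi (s, t); pose dchi s := pderiv 0 phi (s, t).
pose ddchi s := pderiv 0 (pderiv 0 phi) (s, t).
have hchi (s : R) : is_derive s 1 chi (dchi s).
  exact: (pderiv_is_derive0 (p := (s, t)) (smooth_torus_diff [::] (s, t) sphi)).
have hdchi (s : R) : is_derive s 1 dchi (ddchi s).
  exact: (pderiv_is_derive0 (p := (s, t)) (smooth_torus_diff [:: 0] (s, t) sphi)).
have cchi : continuous chi := continuous1_derive hchi.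
have cdchi : continuous dchi := continuous1_derive hdchi.
have cddchi : continuous ddchi :=
  continuous_slice1 (t := t) (smooth_torus_continuous (l := [:: 0; 0]) sphi).
have /periodic_torusE[p0 _] := smooth_periodic [::] sphi.
have /periodic_torusE[p1 _] := smooth_periodic [:: 0] sphi.
have pchi : periodic chi L by move=> s; exact: p0.
have pdchi : periodic dchi L by move=> s; exact: p1.
pose G s := eps * (r s * dchi s) - r s * df s * chi s.
pose dG s := eps * (dr s * dchi s + r s * ddchi s) -
  ((dr s * df s + r s * ddf s) * chi s + r s * df s * dchi s).
have hG (s : R) : is_derive s 1 G (dG s).
  exact: is_derive1B (is_derive1Z eps (is_derive1M (hr s) (hdchi s)))
    (is_derive1M (is_derive1M (hr s) (hdf s)) (hchi s)).
have cG : continuous G := continuous1_derive hG.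
have cdG : continuous dG.
  apply: continuous1B.
    apply: continuous1M; first exact: continuous1cst.
    by apply: continuous1D; exact: continuous1M.
  apply: continuous1D; last by apply: continuous1M => //; exact: continuous1M.
  by apply: continuous1M => //; apply: continuous1D; exact: continuous1M.
have cVG : continuous (fun s => dV s * G s + V s * dG s).
  by apply: continuous1D; exact: continuous1M.
(* [G] is the flux whose derivative is the leading part [slead]; adding this null integral moves one
   derivative onto [V] and leaves the integrand of [weak]. *)
have byparts : sint (fun s => dV s * G s + V s * dG s) 0 L = 0.
  rewrite (sint_FTC _ _ cVG (fun s => is_derive1M (hV s) (hG s))).
  have e (A : R -> R) : periodic A L -> A L = A 0 by move=> pA; rewrite -(pA 0) add0r.
  by rewrite /G !(e _ pV, e _ pr, e _ pdf, e _ pchi, e _ pdchi) subrr.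
have cc := continuous1M; have lcm (A B : R -> R) : continuous A -> continuous B -> lbm (fun s => A s * B s).
  by move=> cA cB; apply: lbm_continuous; exact: continuous1M.
have lqb : lbm qb by split => //; have [M hM] := bqb; move=> a b; exists M.
have lr : lbm r by exact: lbm_continuous.
have lrV : lbm (fun s => (r s)^-1).
  by apply: lbm_continuous; apply: continuous1V => // s; rewrite gt_eqF.
have lV := lbm_continuous cV; have lchi := lbm_continuous cchi.
have lVG := lbm_continuous cVG.
pose A s := (qb s * r s - eps * k%:R ^+ 2 / r s + lam * r s) * (V s * chi s)
    + (r s * df s * dV s * chi s - eps * r s * dV s * dchi s).
have lA : lbm A.
  apply: lbmD.
    apply: lbmM; last exact: lbmM.
    apply: lbmD; last exact: lbmZ.
    by apply: lbmB; [exact: lbmM|exact: lbmZ].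
  by apply: lbm_continuous; apply: continuous1B; do 3 apply: continuous1M => //;
    exact: continuous1cst.
have lrest : lbm (fun s => lam * (r s * (V s * chi s))).
  by apply: lbmZ; apply: lbmM => //; exact: lbmM.
have key : sint (fun s => A s + (dV s * G s + V s * dG s) - lam * (r s * (V s * chi s))) 0 L =
    sint (fun s => - lam * (r s * (V s * chi s))) 0 L.
  rewrite sintB//; last exact: lbmD.
  rewrite sintD// (weak cdchi hchi pchi) byparts addr0 sub0r -sintN//.
  by apply: sint_ext => s; rewrite mulNr.
rewrite (sint_ext (g := fun s => w t *
    (A s + (dV s * G s + V s * dG s) - lam * (r s * (V s * chi s))))); last first.
  move=> s; rewrite /slead /= -/(chi s) -/(dchi s) -/(ddchi s) /A /dG /G.
  move: (w t) (r s)^-1 (V s) (dV s) (chi s) (dchi s) (ddchi s) (r s) (dr s) (df s) (ddf s) (qb s).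
  by move=> x1 x2 x3 x4 x5 x6 x7 x8 x9 x10 x11 x12; ring.
rewrite sintZ; last by apply: lbmB => //; exact: lbmD.
rewrite key -sintZ; last by apply: lbmZ; apply: lbmM => //; exact: lbmM.
by apply: sint_ext => s; rewrite /chi; ring.
Qed.

Lemma separated_generator phi : smooth_torus L phi ->
  rect_int L (2 * pi) (fun p => V p.1 * w p.2 * gen phi p * r p.1) =
  - lam * rect_int L (2 * pi) (fun p => V p.1 * w p.2 * phi p * r p.1).
Proof.
move=> sphi; rewrite -fiberF1// -[RHS]addr0 -(fiberF2 sphi) -rect_intD//;
  [|exact: bmF1|exact: bmF2].
by congr rect_int; apply/funext => p; exact: genE.
Qed.

Lemma ae_fst (P : R -> Prop) : {ae mu, forall s, P s} ->
  {ae (mu \x mu)%E, forall p : R * R, P p.1}.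
Proof.
move=> [B [mB B0 hB]]; exists (B `*` setT); split.
- exact: measurableX.
- rewrite product_measure1E//; apply: etrans (mul0e (mu setT)).
  by congr (_ * _)%E; exact: B0.
- by move=> [s t] h; split => //; apply: hB.
Qed.

(** [q] may be unbounded on a null set, so the integrand is exchanged almost everywhere for the one
    with [qb], for which all integrals are finite. *)
Lemma int_vol_generator phi t : smooth_torus L phi ->
  int_vol g L setT (fun p => separated t p *
    adjoint_generator g (fun z => f z.1) (fun z => q z.1) eps phi p) =
  (- lam * expR (- lam * t) *
    rect_int L (2 * pi) (fun p => V p.1 * w p.2 * phi p * r p.1))%:E.
Proof.
move=> sphi; have [b1 _ _ _] := bmphi sphi.
have adjE p : adjoint_generator g (fun z => f z.1) (fun z => q z.1) eps phi p =
    gen phi p + (q p.1 - qb p.1) * phi p.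
  by rewrite /gen /adjoint_generator; ring.
pose e := expR (- lam * t).
have bgen : bm (fun p => e * (V p.1 * w p.2 * gen phi p * r p.1)).
  rewrite (_ : (fun p => _) = fun p => e * (F1 phi p + F2 phi p)).
    by apply: bmZ; apply: bmD; [exact: bmF1|exact: bmF2].
  by apply/funext => p; rewrite genE.
transitivity (\int[(mu \x mu)%E]_(p in rect L (2 * pi))
    (e * (V p.1 * w p.2 * gen phi p * r p.1))%:E)%E; last first.
  rewrite rect_intE//; congr EFin; rewrite rect_intZ.
    by rewrite separated_generator// mulrA; congr (_ * _); rewrite mulrC.
  rewrite (_ : (fun p => _) = fun p => F1 phi p + F2 phi p).
    by apply: bmD; [exact: bmF1|exact: bmF2].
  by apply/funext => p; rewrite genE.
have hE p : separated t p * adjoint_generator g (fun z => f z.1) (fun z => q z.1) eps phi p * vol g p =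
    e * (V p.1 * w p.2 * gen phi p * r p.1) + (q p.1 - qb p.1) * (separated t p * phi p * r p.1).
  by rewrite adjE vol_revolution// /separated -/e; ring.
rewrite /int_vol setIT; apply: ae_eq_integral.
- exact: rect_measurable.
- apply/measurable_EFinP; apply: measurable_funTS.
  under eq_fun do rewrite hE.
  apply: measurable_funD; first by have [] := bgen.
  apply: measurable_funM.
    apply: measurable_funB; [exact: measurableT_comp mq measurable_fst|].
    exact: measurableT_comp mqb measurable_fst.
  have : bm (fun p => separated t p * phi p * r p.1).
    by do 2 apply: bmM => //; exact: separated_bm.
  by case.
- by apply/measurable_EFinP; apply: measurable_funTS; have [] := bgen.
- have [B [mB B0 hB]] := ae_fst qqb; exists B; split => // p np.
  apply: hB => /= e1; apply: np => _ /=.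
  by rewrite hE e1 subrr mul0r addr0.
Qed.

Lemma separated_solution : transport_solution L g (fun z => f z.1) (fun z => q z.1)
  eps (separated 0) separated.
Proof.
have cexp : continuous (fun t : R => expR (- lam * t)).
  move=> t; exact: is_derive_continuous (is_derive1_expR (is_derive1Z (- lam) (is_derive1id t))).
split.
- by move=> t _; exact: separated_L2.
- move=> t _; rewrite (_ : (fun tau => _) = fun tau =>
    ((expR (- lam * tau) - expR (- lam * t)) ^+ 2 * cstV)%:E); last first.
    by apply/funext => tau; exact: separated_diffE.
  apply: cvg_within_filter; apply: cvg_EFin; first exact: nearW.
  have ch : continuous (fun tau => (expR (- lam * tau) - expR (- lam * t)) ^+ 2 * cstV).
    apply: continuous1M; last exact: continuous1cst.
    under eq_fun do rewrite expr2.
    by apply: continuous1M; apply: continuous1B => //; exact: continuous1cst.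
  have -> : (0 : R) = (expR (- lam * t) - expR (- lam * t)) ^+ 2 * cstV.
    by rewrite subrr expr0n mul0r.
  exact: ch.
- by rewrite separated_diffE subrr expr0n mul0r.
- move=> phi t sphi t0; have [b1 _ _ _] := bmphi sphi.
  set J := rect_int L (2 * pi) (fun p => V p.1 * w p.2 * phi p * r p.1).
  have JE tau : fine (int_vol g L setT (fun p => separated tau p * phi p)) =
      expR (- lam * tau) * J.
    rewrite int_vol_rect /=; last by apply: bmM => //; exact: separated_bm.
    rewrite /J -rect_intZ; last by do 3 apply: bmM => //.
    by congr rect_int; apply/funext => p; rewrite /separated; ring.
  rewrite !JE mulr0 expR0 mul1r.
  under eq_Rintegral do rewrite int_vol_generator//.
  rewrite -sint_le//= -/J.
  have hE (s : R) : is_derive s 1 (fun s => J * expR (- lam * s)) (- lam * expR (- lam * s) * J).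
    apply: (is_derive1_eq (is_derive1Z J (is_derive1_expR (is_derive1Z (- lam) (is_derive1id s))))).
    by rewrite mulr1; ring.
  have cE : continuous (fun s => - lam * expR (- lam * s) * J).
    apply: continuous1M; last exact: continuous1cst.
    by apply: continuous1M => //; exact: continuous1cst.
  by rewrite (sint_FTC _ _ cE hE) mulr0 expR0 mulr1; ring.
Qed.

(** The factor pi is the integral of [cos (k theta) ^+ 2] over a period, hence [k] positive. *)
Lemma separated_mass : (0 < k)%N ->
  cstV = pi * sint (fun s => V s ^+ 2 * r s) 0 L.
Proof.
move=> k0; have kn : k%:R != 0 :> R by rewrite pnatr_eq0 -lt0n.
have lV2 : lbm (fun s => V s ^+ 2 * r s).
  by apply: lbm_continuous; under eq_fun do rewrite expr2; do 2 apply: continuous1M => //.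
rewrite -sintZ//; apply: rect_int_fiber1; rewrite ?(ltW L0) ?(ltW pi20)//.
  exact: lbmZ.
move=> s /=.
rewrite (sint_ext (g := fun t => (V s ^+ 2 * r s) * (w t * w t))); last first.
  by move=> t; ring.
have cww : continuous (fun t => w t * w t) by exact: continuous1M.
rewrite sintZ; last exact: lbm_continuous.
have hprim (t : R) : is_derive t 1 (fun t => 2^-1 * t + (2 * k%:R)^-1 * (sin (k%:R * t) * w t)) (w t * w t).
  apply: (is_derive1_eq (is_derive1D (is_derive1Z 2^-1 (is_derive1id t))
    (is_derive1Z (2 * k%:R)^-1 (is_derive1M (hws t) (hw t))))).
  rewrite mulr1; have -> : k%:R * w t * w t + sin (k%:R * t) * - (k%:R * sin (k%:R * t)) =
    k%:R * (w t * w t - sin (k%:R * t) ^+ 2) by ring.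
  by rewrite sin2cos2 expr2; field.
rewrite (sint_FTC _ _ cww hprim).
have := periodic_cos_nat 0; rewrite add0r => ->.
have -> : sin (k%:R * (2 * pi)) = sin (k%:R * 0) :> R.
  have -> : k%:R * (2 * pi) = 0 + (pi *+ 2) *+ k :> R.
    by rewrite add0r -mulr_natr -mulr_natr; ring.
  by rewrite (periodicn (@sinD2pi R)) mulr0.
by field.
Qed.

End SeparatedSolution.

(** * Localized eigenfunctions *)

Section Conjugation.
Variables (R : realType) (L : R).
Hypothesis L0 : 0 < L.

(** Two means are removed: [qm] makes [eta] periodic, [c0] makes its primitive [Theta] periodic. The
    equation [eta' = - (qb - qm)] is kept in integrated form, [qb] being only measurable. *)
Lemma periodic_primitive (qb : R -> R) : measurable_fun setT qb ->
  (exists M : R, forall s, `|qb s| <= M) -> periodic qb L ->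
  exists (qm c0 : R) (Theta : R -> R),
    let eta s := c0 - sint (fun t => qb t - qm) 0 s in
    [/\ sint (fun t => qb t - qm) 0 L = 0, continuous eta, periodic eta L,
      (forall s : R, is_derive s 1 Theta (eta s)) & periodic Theta L].
Proof.
move=> mq [M hM] pq; have lq : lbm qb by split => // a b; exists M.
pose qm := sint qb 0 L / L; pose g t := qb t - qm.
have lg : lbm g by apply: lbmB => //; exact: lbm_cst.
have pg : periodic g L by move=> s; rewrite /g pq.
have g0 : sint g 0 L = 0.
  rewrite /g sintB//; last exact: lbm_cst.
  by rewrite sint_cst subr0 /qm divfK ?subrr// gt_eqF.
pose G s := sint g 0 s.
have M0 : 0 <= M by apply: le_trans (hM 0).
have cG : continuous G.
  move=> a; apply: near_continuous => e e0.
  have K1 : 0 < M + `|qm| + 1 by rewrite ltr_wpDl// addr_ge0.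
  exists (e / (M + `|qm| + 1)); first exact: divr_gt0.
  move=> b; rewrite ltr_pdivlMr// => ba.
  rewrite /G -(sint_chasles 0 a b lg) addrC addKr.
  apply: le_trans (sint_normr_le (K := M + `|qm| + 1) lg _) _.
    by move=> t _; rewrite (le_trans (ler_normB _ _))// ler_wpDr// lerD.
  by rewrite mulrC ltW.
pose c0 := sint G 0 L / L; pose eta s := c0 - G s.
have ceta : continuous eta by apply: continuous1B => //; exact: continuous1cst.
have peta : periodic eta L.
  move=> s; rewrite /eta /G -(sint_chasles 0 s (s + L) lg) sint_periodic// g0 addr0//.
have lG := lbm_continuous cG.
have eta0 : sint eta 0 L = 0.
  rewrite /eta sintB//; last exact: lbm_cst.
  by rewrite sint_cst subr0 /c0 divfK ?subrr// gt_eqF.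
exists qm, c0, (fun s => sint eta 0 s); split => //.
- by move=> s; exact: sint_derive.
- move=> s; have le := lbm_continuous ceta.
  by rewrite -(sint_chasles 0 s (s + L) le) sint_periodic// eta0 addr0.
Qed.

Variables (r dr df qb Theta E W w z : R -> R) (qm c0 mu kap beta eps : R) (k : nat).
Hypothesis r0 : forall s, 0 < r s.
Hypothesis hr : forall s : R, is_derive s 1 r (dr s).
Hypotheses (cdr : continuous dr) (cdf : continuous df) (lqb : lbm qb).
Hypotheses (pr : periodic r L).
Hypothesis eb : eps * beta = 1.
Hypothesis kb : k%:R = kap * beta.
Local Notation g := (fun t => qb t - qm).
Local Notation eta := (fun s => c0 - sint g 0 s).
Hypothesis g0 : sint g 0 L = 0.
Hypothesis ceta : continuous eta.
Hypothesis peta : periodic eta L.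
Hypothesis hT : forall s : R, is_derive s 1 Theta (eta s).
Hypothesis pT : periodic Theta L.
Hypothesis hE : forall s : R, is_derive s 1 E (beta * (df s + 2 * eta s) + dr s / r s).
Hypothesis WE : forall s, W s = beta ^+ 2 * (kap ^+ 2 / r s ^+ 2 - eta s ^+ 2 - eta s * df s)
  - beta * (qm + eta s * dr s / r s).
Hypothesis pE : periodic E L.
Hypothesis cW : continuous W.
Hypothesis sol : sl_solution E W mu w z.
Hypotheses (pw : periodic w L) (pz : periodic z L).

(* As eta' = - (qb - qm), the zeroth order term produced by the factor e^(beta Theta)
   cancels qb: the equation of w has continuous coefficients. *)
Definition conj_V s := expR (beta * Theta s) * w s.
Definition conj_dV s := expR (beta * Theta s) * (beta * eta s * w s + expR (- E s) * z s).

Let he (s : R) : is_derive s 1 (fun s => expR (beta * Theta s)) (expR (beta * Theta s) * (beta * eta s)).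
Proof. exact: is_derive1_expR (is_derive1Z beta (hT s)). Qed.

Lemma conj_V_derive (s : R) : is_derive s 1 conj_V (conj_dV s).
Proof.
apply: (is_derive1_eq (is_derive1M (he s) (sol.1 s))).
by rewrite /conj_dV; ring.
Qed.

Let cwz := sl_continuous sol.
Let ce : continuous (fun s => expR (beta * Theta s)) := continuous1_derive he.
Let cEn : continuous (fun s => expR (- E s)).
Proof. by apply: continuous1_derive => s; exact: is_derive1_expR (is_derive1N (hE s)). Qed.
Let cr : continuous r := continuous1_derive hr.
Let crV : continuous (fun s => (r s)^-1).
Proof. by apply: continuous1V => // s; rewrite gt_eqF. Qed.
Let cw := cwz.1.
Let cz := cwz.2.
Let cc := continuous1M.
Let ck := @continuous1cst R.

Lemma conj_dV_continuous : continuous conj_dV.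
Proof.
apply: cc => //; apply: continuous1D; last exact: cc.
by apply: cc => //; exact: cc.
Qed.

Lemma conj_V_periodic : periodic conj_V L.
Proof. by move=> s; rewrite /conj_V pT pw. Qed.

(** With [psi = r * e * w * chi], the integrand is [- eps] times the derivative of the periodic
    function [r * e * v * chi], plus [g * psi - eta * psi']; the latter integrates to zero by
    parts. *)
Lemma conj_V_weak (chi dchi : R -> R) : continuous dchi ->
  (forall s : R, is_derive s 1 chi (dchi s)) -> periodic chi L ->
  sint (fun s => (qb s * r s - eps * k%:R ^+ 2 / r s + eps * mu * r s) * (conj_V s * chi s)
    + (r s * df s * conj_dV s * chi s - eps * r s * conj_dV s * dchi s)) 0 L = 0.
Proof.
move=> cdchi hchi pchi.
have cchi : continuous chi := continuous1_derive hchi.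
pose e s := expR (beta * Theta s); pose v s := expR (- E s) * z s.
pose p s := beta * (df s + 2 * eta s) + dr s / r s.
have pe : periodic e L by move=> s; rewrite /e pT.
have pv : periodic v L by move=> s; rewrite /v pE pz.
have cp : continuous p.
  apply: continuous1D; last exact: cc.
  by apply: cc => //; apply: continuous1D => //; exact: cc.
have cv : continuous v by exact: cc.
have hv (s : R) : is_derive s 1 v (- p s * v s + (W s - mu) * w s).
  apply: (is_derive1_eq (is_derive1M (is_derive1_expR (is_derive1N (hE s))) (sol.2 s))).
  have e1 : expR (- E s) * expR (E s) = 1 by rewrite -expRD addNr expR0.
  rewrite -/(p s) /v; move: (expR (- E s)) (expR (E s)) (p s) e1 => x y t xy.
  rewrite (_ : x * (y * (W s - mu) * w s) = (x * y) * ((W s - mu) * w s)); last by ring.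
  by rewrite xy; ring.
pose A s := r s * e s * v s.
pose dA s := (dr s * e s + r s * (e s * (beta * eta s))) * v s +
  r s * e s * (- p s * v s + (W s - mu) * w s).
have hA (s : R) : is_derive s 1 A (dA s).
  exact: is_derive1M (is_derive1M (hr s) (he s)) (hv s).
pose B s := r s * e s * w s.
pose dB s := (dr s * e s + r s * (e s * (beta * eta s))) * w s + r s * e s * v s.
have hB (s : R) : is_derive s 1 B (dB s).
  exact: is_derive1M (is_derive1M (hr s) (he s)) (sol.1 s).
have cA : continuous A := continuous1_derive hA.
have cB : continuous B := continuous1_derive hB.
have cre : continuous (fun s => dr s * e s + r s * (e s * (beta * eta s))).
  by apply: continuous1D; apply: cc => //; apply: cc => //; exact: cc.
have cdA : continuous dA.
  apply: continuous1D; first exact: cc.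
  apply: cc; first exact: cc.
  apply: continuous1D; first by apply: cc => //; exact: continuous1N.
  by apply: cc => //; exact: continuous1B.
have cdB : continuous dB.
  by apply: continuous1D; apply: cc => //; exact: cc.
have per0 (f : R -> R) : periodic f L -> f L = f 0 by move=> pf; rewrite -(pf 0) add0r.
pose dAchi s := dA s * chi s + A s * dchi s.
have cAchi : continuous dAchi by apply: continuous1D; exact: cc.
have i1 : sint dAchi 0 L = 0.
  rewrite (sint_FTC _ _ cAchi (fun s => is_derive1M (hA s) (hchi s))).
  by rewrite /A !(per0 _ pr, per0 _ pe, per0 _ pv, per0 _ pchi) subrr.
pose psi s := B s * chi s; pose dpsi s := dB s * chi s + B s * dchi s.
have hpsi (s : R) : is_derive s 1 psi (dpsi s) by exact: is_derive1M (hB s) (hchi s).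
have cdpsi : continuous dpsi by apply: continuous1D; exact: cc.
have ppsi : psi L = psi 0.
  by rewrite /psi /B !(per0 _ pr, per0 _ pe, per0 _ pw, per0 _ pchi).
have cpsi : continuous psi := continuous1_derive hpsi.
have lg : lbm g by apply: lbmB => //; exact: lbm_cst.
have lgpsi : lbm (fun s => g s * psi s) by apply: lbmM => //; exact: lbm_continuous.
(* The only place where [eta' = - g] is used, through [sint_by_parts]; the boundary terms vanish as
   [g] has zero mean and [psi] takes the same value at both ends. *)
have i2 : sint (fun s => eta s * dpsi s) 0 L = sint (fun s => g s * psi s) 0 L.
  have cG : continuous (fun s => sint g 0 s).
    have -> : (fun s => sint g 0 s) = (fun s => c0 - eta s).
      by apply/funext => s; rewrite subKr.
    exact: continuous1B.
  rewrite (sint_ext (g := fun s => c0 * dpsi s - sint g 0 s * dpsi s)); last by move=> s /=; ring.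
  rewrite sintB; [|exact: lbmZ (lbm_continuous cdpsi)|exact: lbm_continuous (cc cG cdpsi)].
  rewrite sintZ; last exact: lbm_continuous.
  rewrite (sint_FTC _ _ cdpsi hpsi) ppsi subrr mulr0 sub0r.
  rewrite (sint_by_parts _ _ lg cdpsi hpsi) g0 sintxx !mul0r subrr sub0r opprK.
  by [].
rewrite (sint_ext (g := fun s => - eps * dAchi s + (g s * psi s - eta s * dpsi s))); last first.
  move=> s; rewrite /dAchi /dpsi /dA /A /psi /dB /B /conj_V /conj_dV -/(e s) -/(v s) kb WE /p.
  have rn : r s != 0 by rewrite gt_eqF.
  have -> : eps = beta^-1.
    have bn : beta != 0.
      by apply/eqP => b0; move: eb; rewrite b0 mulr0 => /eqP; rewrite eq_sym oner_eq0.
    by apply: (mulIf bn); rewrite eb mulVf.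
  have bn : beta != 0.
    by apply/eqP => b0; move: eb; rewrite b0 mulr0 => /eqP; rewrite eq_sym oner_eq0.
  move: (sint g 0 s) (e s) (v s) (w s) (chi s) (dchi s) (dr s) (df s) (qb s).
  move: (r s) rn => x xn y x1 x2 x3 x4 x5 x6 x7 x8.
  by field; rewrite xn.
rewrite sintD; [|exact: lbmZ (lbm_continuous cAchi)|].
  rewrite sintZ; last exact: lbm_continuous.
  rewrite i1 mulr0 add0r sintB//; last exact: lbm_continuous (cc ceta cdpsi).
  by rewrite i2 subrr.
by apply: lbmB => //; exact: lbm_continuous (cc ceta cdpsi).
Qed.

End Conjugation.

(** The budget, in units of [y = beta^2 kap^2 / e^2]: the barrier supplies 1/4, the lower order
    terms cost at most 1/16 and the eigenvalue 1/8. The remaining 1/16 exceeds 1/64 for the squared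
    rate plus 1/32 for the drift. *)
Lemma agmon_gap_aux (R : realType) (x y y' Y A b2 W bq c mu : R) : 0 <= Y ->
  x - (b2 * A + bq) <= W -> y / 4 <= x -> b2 * (16 * (A + 1 + c)) <= Y ->
  0 <= b2 * c -> y' <= y / 32 -> mu <= Y / 8 -> Y <= y -> bq <= b2 ->
  y / 64 + y' <= W - mu.
Proof. move=> *; lra. Qed.

Section LocalizedEigenfunction.
Variables (R : realType) (L s0 l e eta0 A B F0 kap : R).
Variables (r dr f df eta Theta : R -> R) (qm : R).
Hypothesis L0 : 0 < L.
Hypotheses (l0 : 0 < l) (lL : 4 * l < L) (e0 : 0 < e) (e1 : e < 1).
Hypothesis hr : forall s : R, is_derive s 1 r (dr s).
Hypothesis hf : forall s : R, is_derive s 1 f (df s).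
Hypothesis hT : forall s : R, is_derive s 1 Theta (eta s).
Hypotheses (cdr : continuous dr) (cdf : continuous df) (ceta : continuous eta).
Hypotheses (pr : periodic r L) (pdr : periodic dr L) (pf : periodic f L).
Hypotheses (pdf : periodic df L) (peta : periodic eta L) (pT : periodic Theta L).
Hypothesis rb : forall s, e <= r s <= 6.
Hypothesis rsmall : forall s, s0 + l <= s <= s0 + L - l -> r s <= 2 * e.
Hypothesis eta00 : 0 < eta0.
Hypothesis rlarge : forall s, `|s - s0| < eta0 -> 4 <= r s.
Hypothesis hA : forall s, `|eta s ^+ 2 + eta s * df s| <= A.
Hypothesis hB : forall s, `|df s + 2 * eta s| <= B.
Hypothesis hF : forall s, `|f s + 2 * Theta s| <= F0.
Hypothesis kap0 : 0 < kap.
Hypothesis kap1 : 36 * (A + 1) <= kap ^+ 2.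
Hypothesis kap2 : 16 * (A + 1 + (B + 1) ^+ 2) <= kap ^+ 2.
Hypothesis kap3 : 4 * (B + 1) <= kap.

(* E' = p, and the equation of w = e^(- beta Theta) V is w'' + p w' = (W - mu) w. *)
Definition sl_E beta s := beta * (f s + 2 * Theta s) + ln (r s).
Definition sl_p beta s := beta * (df s + 2 * eta s) + dr s / r s.
Definition sl_W beta s := beta ^+ 2 * (kap ^+ 2 / r s ^+ 2 - eta s ^+ 2 - eta s * df s)
  - beta * (qm + eta s * dr s / r s).

Let r0 s : 0 < r s. Proof. by apply: lt_le_trans e0 _; have /andP[] := rb s. Qed.
Let cr : continuous r := continuous1_derive hr.
Let crV : continuous (fun s => (r s)^-1).
Proof. by apply: continuous1V => // s; rewrite gt_eqF. Qed.
Let cc := @continuous1M R.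
Let ck := @continuous1cst R.

Lemma sl_E_derive beta (s : R) : is_derive s 1 (sl_E beta) (sl_p beta s).
Proof.
apply: (is_derive1_eq (is_derive1D
  (is_derive1Z beta (is_derive1D (hf s) (is_derive1Z 2 (hT s))))
  (is_derive1_compf (is_derive1_ln (r0 s)) (hr s)))).
by rewrite /sl_p [(r s)^-1 * _]mulrC.
Qed.

Lemma sl_E_periodic beta : periodic (sl_E beta) L.
Proof. by move=> s; rewrite /sl_E pf pT pr. Qed.

Lemma sl_W_continuous beta : continuous (sl_W beta).
Proof.
have cr2 : continuous (fun s => (r s ^+ 2)^-1).
  apply: continuous1V => [s|]; first by rewrite sqrf_eq0 gt_eqF.
  by under eq_fun do rewrite expr2; exact: cc.
apply: continuous1B; apply: cc => //.
  apply: continuous1B; last exact: cc.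
  by apply: continuous1B; [exact: cc|under eq_fun do rewrite expr2; exact: cc].
by apply: continuous1D => //; apply: cc => //; exact: cc.
Qed.

Lemma sl_W_periodic beta : periodic (sl_W beta) L.
Proof. by move=> s; rewrite /sl_W pr peta pdf pdr. Qed.

Lemma sl_E_exp beta s : expR (sl_E beta s) = expR (beta * (f s + 2 * Theta s)) * r s.
Proof. by rewrite /sl_E expRD lnK// posrE. Qed.

(** The barrier region starts at distance [l] from [s0], and a further distance [l] inside it yields
    the decay. [beta0] and [c] may depend on the profile, because beta tends to infinity with the
    profile fixed. *)
Lemma localized_eigenfunction : exists beta0 c, [/\ 1 <= beta0, 0 < c & forall beta,
  beta0 <= beta -> exists mu w z m,
  [/\ 0 <= mu <= kap ^+ 2 / 8 * beta ^+ 2,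
    [/\ sl_solution (sl_E beta) (sl_W beta) mu w z, periodic w L & periodic z L],
    0 < m,
    (forall s, s0 + 2 * l <= s <= s0 + L - 2 * l ->
      `|w s| <= 2 * m * expR (- (beta * kap * l / (8 * e)))) &
    m ^+ 2 / (8 * (c * beta ^+ 2 * expR (2 * (beta * F0)))) <=
      sint (fun s => w s ^+ 2) 0 L]].
Proof.
have AL : s0 + l <= s0 + L - l by move: l0 lL; lra.
have kap3' : B + 1 <= kap / 4 by move: kap3; lra.
have [||q0 q00 hq] := periodic_bounded L0 (f := fun s => qm + eta s * dr s / r s).
- by move=> s; rewrite peta pdr pr.
- by apply: continuous1D => //; apply: cc => //; exact: cc.
have [||rho0 rho00 hrho] := periodic_bounded L0 (f := fun s => dr s / r s).
- by move=> s; rewrite pdr pr.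
- exact: cc.
have A0 : 0 <= A := le_trans (normr_ge0 _) (hA 0).
have B0 : 0 <= B := le_trans (normr_ge0 _) (hB 0).
have F00 : 0 <= F0 := le_trans (normr_ge0 _) (hF 0).
have [k0 /andP[t00 t0L]] := circle_representative L0 s0 0; rewrite add0r in t0L.
(* Shooting starts at 0, so a piece of the well is needed inside the period: it is taken to the
   right of the representative [t0] of [s0], away from 0. *)
pose t0 := s0 + k0%:~R * L; pose eta1 := Num.min eta0 (L - t0).
have eta10 : 0 < eta1 by rewrite lt_min eta00 subr_gt0.
have eta1L : eta1 <= L - t0 by rewrite ge_min lexx orbT.
have eta1e : eta1 <= eta0 by rewrite ge_min lexx.
pose a := t0 + eta1 / 2; pose b := t0 + 3 / 4 * eta1.
have a0 : 0 < a by rewrite /a /t0 in eta1L *; lra.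
have bL : b <= L by rewrite /b; lra.
have ab : a <= b by rewrite /a /b; lra.
have rab s : a <= s <= b -> 4 <= r s.
  move=> /andP[sa sb]; rewrite -(periodic_int pr (- k0)); apply: rlarge.
  rewrite rmorphN mulNr ger0_norm; rewrite /a /b /t0 in sa sb *; lra.
have kap20 : 0 < kap ^+ 2 by rewrite exprn_gt0.
pose cW := kap ^+ 2 / e ^+ 2 + A + q0 + kap ^+ 2.
have e20 : 0 < e ^+ 2 by rewrite exprn_gt0.
have ke0 : 0 <= kap ^+ 2 / e ^+ 2 by rewrite divr_ge0 ?ltW.
have cW0 : 0 < cW by rewrite /cW; lra.
(* The two terms serve the two hypotheses of [sl_mass] on [Gam]. *)
pose c := 6 / e * cW * L + L^-1.
have c1 : 0 < 6 / e * cW * L by rewrite !mulr_gt0// invr_gt0.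
have Li : 0 < L^-1 by rewrite invr_gt0.
have c0 : 0 < c by rewrite /c addr_gt0.
(* [q0] and [rho0] let beta absorb the terms of lower order; the last summand makes the segment long
   enough to exclude a positive solution. *)
exists (1 + q0 + rho0 + 2 * pi / (b - a)), c.
have ba0 : 0 < b - a by rewrite /a /b; lra.
have pba : 0 <= 2 * pi / (b - a) by rewrite divr_ge0 ?mulr_ge0 ?pi_ge0// ltW.
split => //; first lra.
move=> beta hb.
have b1 : 1 <= beta by lra.
have bq : q0 <= beta by lra.
have br : rho0 <= beta by lra.
have bp : 2 * pi / (b - a) <= beta by lra.
have b0 : 0 < beta by lra.
have bb : 0 < beta ^+ 2 by rewrite exprn_gt0.
have bb1 : beta <= beta ^+ 2 by rewrite expr2 ler_peMl// ltW.
have bq2 : beta * q0 <= beta ^+ 2 by rewrite expr2 ler_wpM2l// ltW.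
have Wb s : `|sl_W beta s - beta ^+ 2 * (kap ^+ 2 / r s ^+ 2)| <= beta ^+ 2 * A + beta * q0.
  rewrite /sl_W (_ : _ - _ - _ = - (beta ^+ 2 * (eta s ^+ 2 + eta s * df s)) -
    beta * (qm + eta s * dr s / r s)); last by move: (_ / r s ^+ 2) => x; ring.
  rewrite (le_trans (ler_normB _ _))// normrN lerD//.
    by rewrite normrM (ger0_norm (ltW bb)) ler_wpM2l// ltW.
  by rewrite normrM (ger0_norm (ltW b0)) ler_wpM2l// ltW.
have pb s : `|sl_p beta s| <= beta * (B + 1).
  rewrite /sl_p (le_trans (ler_normD _ _))// (mulrDr beta B) mulr1 lerD//.
    by rewrite normrM (ger0_norm (ltW b0)) ler_wpM2l// ltW.
  exact: le_trans (hrho s) br.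
have r2le s x : 0 < x -> r s <= x -> kap ^+ 2 / x ^+ 2 <= kap ^+ 2 / r s ^+ 2.
  move=> x0 rx; rewrite ler_pM2l// lef_pV2 ?posrE ?exprn_gt0//.
  by rewrite ler_pXn2r// nnegrE ltW.
have r2ge s x : 0 < x -> x <= r s -> kap ^+ 2 / r s ^+ 2 <= kap ^+ 2 / x ^+ 2.
  move=> x0 rx; rewrite ler_pM2l// lef_pV2 ?posrE ?exprn_gt0//.
  by rewrite ler_pXn2r// nnegrE ltW.
have Wge0 s : 0 <= sl_W beta s.
  have := Wb s; rewrite ler_distl => /andP[h _]; apply: le_trans h.
  have /andP[_ r6] := rb s; have h1 := r2le s 6 ltac:(lra) r6.
  have h2 : beta ^+ 2 * (A + 1) <= beta ^+ 2 * (kap ^+ 2 / r s ^+ 2).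
    rewrite ler_pM2l//; apply: le_trans h1.
    by rewrite ler_pdivlMr ?exprn_gt0//; move: kap1; lra.
  by rewrite mulrDr mulr1 in h2; lra.
pose d := beta * (B + 1); have d0 : 0 < d by rewrite mulr_gt0//; lra.
pose mu1 := kap ^+ 2 / 8 * beta ^+ 2.
have mu10 : 0 <= mu1 by rewrite mulr_ge0 ?divr_ge0 ?ltW.
have Wab s : a <= s <= b -> sl_W beta s - mu1 <= - d ^+ 2.
  move=> sab; have h1 := r2ge s 4 ltac:(lra) (rab s sab).
  have := Wb s; rewrite ler_distl => /andP[_ h].
  have h2 : beta ^+ 2 * (kap ^+ 2 / r s ^+ 2) <= beta ^+ 2 * (kap ^+ 2 / 16).
    by rewrite ler_pM2l//; apply: le_trans h1 _; rewrite -natrX.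
  have h3 : beta ^+ 2 * (16 * (A + 1 + (B + 1) ^+ 2)) <= beta ^+ 2 * kap ^+ 2.
    by rewrite ler_pM2l.
  by rewrite /mu1 /d exprMn; move: h h2 h3 bq2; move: (beta ^+ 2) (kap ^+ 2) => X Y; lra.
have pab s : a <= s <= b -> sl_p beta s ^+ 2 <= d ^+ 2.
  move=> _; rewrite -[leLHS]real_normK ?num_real//.
  by apply: lerXn2r (pb s); rewrite nnegrE ?normr_ge0 ?(ltW d0).
have dba : 2 * pi <= d * (b - a).
  rewrite ler_pdivrMr// in bp; apply: le_trans bp _; rewrite ler_wpM2r ?(ltW ba0)//.
  by rewrite /d ler_peMr ?(ltW b0)//; lra.
have [mu [w [z [mu01 sol pw pz wn]]]] := periodic_eigenfunction L0 (sl_E_derive beta)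
  (sl_W_continuous (beta := beta)) (sl_E_periodic beta) (sl_W_periodic beta) mu10 Wge0
  d0 a0 ab bL Wab pab dba.
have /andP[mu0 muL] := mu01.
pose X := expR (beta * F0); have X0 : 0 < X by exact: expR_gt0.
have fb s : expR (beta * (f s + 2 * Theta s)) <= X /\ expR (- (beta * (f s + 2 * Theta s))) <= X.
  have := hF s; rewrite ler_norml => /andP[f1 f2].
  by split; rewrite ler_expR -?mulrN ler_wpM2l ?(ltW b0)//; lra.
have hN s : expR (- sl_E beta s) <= X / e.
  rewrite expRN sl_E_exp invfM -expRN; apply: ler_pM; rewrite ?expR_ge0 ?invr_ge0 ?(ltW (r0 s))//.
    by have [] := fb s.
  by rewrite lef_pV2 ?posrE//; have /andP[] := rb s.
have hK s : expR (sl_E beta s) * `|sl_W beta s - mu| <= X * 6 * (beta ^+ 2 * cW).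
  apply: ler_pM => //.
    rewrite sl_E_exp; apply: ler_pM; rewrite ?expR_ge0 ?(ltW (r0 s))//.
      by have [] := fb s.
    by have /andP[] := rb s.
  have /andP[re _] := rb s; have h1 := r2ge s e e0 re.
  have h2 : beta ^+ 2 * (kap ^+ 2 / r s ^+ 2) <= beta ^+ 2 * (kap ^+ 2 / e ^+ 2).
    by rewrite ler_pM2l.
  have h3 : beta * q0 <= beta ^+ 2 * q0 by rewrite ler_wpM2r.
  have h4 : mu <= beta ^+ 2 * kap ^+ 2.
    apply: le_trans muL _; rewrite /mu1 mulrC ler_pM2l//; lra.
  have h5 : 0 <= beta ^+ 2 * A by rewrite mulr_ge0// ltW.
  have h6 : 0 <= beta ^+ 2 * (kap ^+ 2 / e ^+ 2) by rewrite mulr_ge0// ltW.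
  have h7 : 0 <= beta ^+ 2 * q0 by rewrite mulr_ge0// ltW.
  have h8 : 0 <= beta ^+ 2 * kap ^+ 2 by rewrite mulr_ge0// ltW.
  have := Wb s; have := Wge0 s; rewrite ler_distl => W0 /andP[_ h].
  rewrite ler_norml /cW !mulrDr; apply/andP; split; lra.
pose Gam := c * beta ^+ 2 * expR (2 * (beta * F0)).
have XX : expR (2 * (beta * F0)) = X * X.
  by rewrite -expRD; congr expR; ring.
have X1 : 1 <= X * X.
  by rewrite -XX -[leLHS]expR0 ler_expR !mulr_ge0// ltW.
have hG : X / e * (X * 6 * (beta ^+ 2 * cW)) * L <= Gam.
  rewrite /Gam XX (_ : X / e * _ * L = (6 / e * cW * L) * beta ^+ 2 * (X * X)); last first.
    by move: (e^-1) => y; ring.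
  rewrite ler_wpM2r//; first by rewrite mulr_ge0// ltW.
  by rewrite ler_wpM2r ?(ltW bb)// lerDl ltW.
have GL : 1 <= 2 * Gam * L.
  have h1 : L^-1 <= c by rewrite lerDr ltW.
  have b21 : 1 <= beta ^+ 2 by exact: le_trans b1 bb1.
  have h2 : L^-1 <= Gam.
    rewrite /Gam XX -mulrA; apply: le_trans h1 _; rewrite ler_peMr ?(ltW c0)//.
    by rewrite -[leLHS]mulr1; apply: ler_pM.
  have : L^-1 * L <= Gam * L by rewrite ler_wpM2r// ltW.
  by rewrite mulVf ?gt_eqF//; lra.
have [m [m0 wm mass]] := sl_mass L0 sol pw hN hK hG GL wn.
exists mu, w, z, m; split => //.
(* The rate is a quarter of the least barrier [beta * kap / (2 * e)], so its square is 1/64 in the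
   units of [agmon_gap_aux]. *)
pose g := beta * kap / (8 * e).
have g0 : 0 < g by rewrite divr_gt0 ?mulr_gt0.
have ie1 : 1 <= e^-1 by rewrite invf_ge1// ltW.
have gW s : s0 + l <= s <= s0 + L - l -> g ^+ 2 + `|sl_p beta s| * g <= sl_W beta s - mu.
  move=> sAL; have rs := rsmall sAL.
  have e2 : 0 < 2 * e by rewrite mulr_gt0.
  have h1 := r2le s (2 * e) e2 rs.
  have := Wb s; rewrite ler_distl => /andP[h _].
  pose Y := beta ^+ 2 * kap ^+ 2; have Y0 : 0 < Y by rewrite mulr_gt0.
  pose i := e^-1; have i1 : 1 <= i by [].
  have ii : i <= i * i by rewrite ler_peMr// (le_trans ler01).
  have Yi : Y <= Y * (i * i) by rewrite ler_peMr ?(ltW Y0)// (le_trans i1).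
  have h2 : Y * (i * i) / 4 <= beta ^+ 2 * (kap ^+ 2 / r s ^+ 2).
    rewrite (_ : Y * (i * i) / 4 = beta ^+ 2 * (kap ^+ 2 / (2 * e) ^+ 2)).
      by rewrite ler_pM2l.
    by rewrite /Y /i; field; rewrite gt_eqF.
  have h3 : beta ^+ 2 * (16 * (A + 1 + (B + 1) ^+ 2)) <= Y by rewrite ler_pM2l.
  have h3' : 0 <= beta ^+ 2 * (B + 1) ^+ 2 by rewrite mulr_ge0 ?sqr_ge0// ltW.
  have h4 : `|sl_p beta s| * g <= Y * (i * i) / 32.
    apply: (@le_trans _ _ (beta * (kap / 4) * g)).
      apply: ler_wpM2r; first exact: ltW.
      by apply: le_trans (pb s) _; rewrite ler_pM2l.
    rewrite (_ : beta * (kap / 4) * g = Y * i / 32); last first.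
      by rewrite /g /Y /i; field; rewrite gt_eqF.
    by rewrite ler_pM2r ?invr_gt0// ler_pM2l.
  have h5 : g ^+ 2 = Y * (i * i) / 64 by rewrite /g /Y /i; field; rewrite gt_eqF.
  have h6 : mu <= Y / 8 by apply: le_trans muL _; apply: eq_ler; rewrite /mu1 /Y; ring.
  by rewrite h5; exact: agmon_gap_aux (ltW Y0) h h2 h3 h3' h4 h6 Yi bq2.
move=> s /andP[s1 s2].
have s1' : l <= s - (s0 + l).
  by rewrite lerBrDr; apply: le_trans s1; apply: eq_ler; ring.
have s2' : s - (s0 + L - l) <= - l.
  by rewrite lerBlDr; apply: le_trans s2 _; apply: eq_ler; ring.
have sAL : s0 + l <= s <= s0 + L - l.
  rewrite -subr_ge0 (le_trans (ltW l0) s1')/= -subr_le0 (le_trans s2')//.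
  by rewrite oppr_le0 ltW.
apply: le_trans (agmon_estimate (sl_E_derive beta) sol g0 AL wm gW sAL) _.
have gl : beta * kap * l / (8 * e) = g * l by rewrite /g; ring.
rewrite gl (_ : 2 * m * _ = m * expR (- (g * l)) + m * expR (- (g * l))); last by ring.
apply: lerD; rewrite ler_pM2l// ler_expR.
  by rewrite mulNr lerN2 ler_pM2l.
by rewrite -mulrN ler_pM2l.
Qed.

End LocalizedEigenfunction.

(** * Failure of observability *)

Section Observation.
Variable R : realType.
Notation mu := (@lebesgue_measure R).
Implicit Types (I : set R) (F G : R * R -> R).

Lemma circle_interval_measurable (L a b : R) : measurable (circle_interval L a b).
Proof.
have -> : circle_interval L a b = \bigcup_(k : int) `]a - k%:~R * L, b - k%:~R * L[%classic.
  apply/seteqP; split => s [k].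
    by move=> [k1 k2]; exists k => //=; rewrite in_itv/= ltrBlDr k1 ltrBrDr.
  by move=> _ /=; rewrite in_itv/= ltrBlDr ltrBrDr => /andP[k1 k2]; exists k.
by apply: countable_bigcupT_measurable => [|k]; [exact: countableP|exact: measurable_itv].
Qed.

Lemma rect_int_le a b F G : bm F -> bm G -> (forall p, F p <= G p) ->
  rect_int a b F <= rect_int a b G.
Proof.
move=> bF bG h; rewrite -lee_fin -!rect_intE//; apply: le_integral.
- exact: rect_measurable.
- exact: bm_integrable.
- exact: bm_integrable.
- by move=> p _; rewrite lee_fin.
Qed.

Lemma rect_int_cst (a b k : R) : 0 <= a -> 0 <= b -> rect_int a b (fun=> k) = k * (a * b).
Proof.
move=> a0 b0; rewrite (rect_int_fiber1 (A := fun=> k * b))//.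
- by rewrite sint_cst subr0; ring.
- exact: bm_cst.
- exact: lbm_cst.
- by move=> s; rewrite sint_cst subr0.
Qed.

Lemma int_vol_strip (L : R) (r : R -> R) I F : (forall s, 0 < r s) -> measurable I ->
  bm (fun p => F p * r p.1) ->
  int_vol (revolution_metric r) L (I `*` [set: R]) F =
  (rect_int L (2 * pi) (fun p => \1_I p.1 * (F p * r p.1)))%:E.
Proof.
move=> r0 mI bF; have bI : bm (fun p : R * R => \1_I p.1 : R).
  by apply: bm_fst; [exact: measurable_indic|exists 1 => s; rewrite indicE; case: (_ \in _);
    rewrite ?normr1 ?normr0].
rewrite -rect_intE; last exact: bmM.
rewrite /int_vol integral_mkcondr; apply: eq_integral => p _.
rewrite patchE indicE vol_revolution//.
have -> : (p \in I `*` [set: R]) = (p.1 \in I).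
  by apply/idP/idP; rewrite !inE; [case|move=> h; split].
by case: ifP => _; rewrite ?mul1r ?mul0r.
Qed.

(** The norm at time [T] is computed exactly, whereas the observation is bounded crudely by
    [r <= 6], [|V| <= Vw] on [I] and a decay factor at most 1: only exponential orders in beta will
    matter. *)
Lemma observability_bound (L lam T K0 Vw : R) (k : nat) (r dr V dV : R -> R) I :
  0 < L -> (forall s, 0 < r s <= 6) ->
  (forall s : R, is_derive s 1 r (dr s)) ->
  (forall s : R, is_derive s 1 V (dV s)) -> periodic r L -> periodic V L ->
  (0 < k)%N -> measurable I -> (forall s, I s -> `|V s| <= Vw) -> 0 <= lam -> 0 < T ->
  (int_vol (revolution_metric r) L setT (fun p => separated V lam k T p ^+ 2)%R <=
    (K0 ^+ 2)%:E * \int[mu]_(t in `[0%R, T])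
      int_vol (revolution_metric r) L (I `*` [set: R])
        (fun p => separated V lam k t p ^+ 2)%R)%E ->
  expR (- lam * T) ^+ 2 * (pi * sint (fun s => V s ^+ 2 * r s) 0 L) <=
    K0 ^+ 2 * (T * (6 * Vw ^+ 2 * (L * (2 * pi)))).
Proof.
move=> L0 r06 hr hV pr pV k0 mI hVw lam0 T0.
have r0 s : 0 < r s by have /andP[] := r06 s.
have r6 s : r s <= 6 by have /andP[] := r06 s.
rewrite (separated_normE lam k L0 r0 hr hV pr pV) (separated_mass L0 hr hV pr pV k0).
have bV0 := separated_bm 0 k L0 hV pV 0.
have br : bm (fun p : R * R => r p.1).
  apply: bm_fst; first exact: continuous_measurable_fun (continuous1_derive hr).
  by exists 6 => s; rewrite ger0_norm// ltW.
have bF t : bm (fun p => separated V lam k t p ^+ 2 * r p.1).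
  apply: bmM => //; under eq_fun do rewrite expr2.
  by apply: bmM; exact: (separated_bm lam k L0 hV pV t).
have bI : bm (fun p : R * R => \1_I p.1 : R).
  by apply: bm_fst; [exact: measurable_indic|exists 1 => s; rewrite indicE; case: (_ \in _);
    rewrite ?normr1 ?normr0].
pose c' := rect_int L (2 * pi) (fun p => \1_I p.1 * (separated V lam k 0 p ^+ 2 * r p.1)).
have pi2 : 0 <= 2 * pi :> R by rewrite mulr_ge0// pi_ge0.
have sep t p : separated V lam k t p = expR (- lam * t) * separated V lam k 0 p.
  by rewrite /separated mulr0 expR0 mul1r.
have iE t : int_vol (revolution_metric r) L (I `*` [set: R])
    (fun p => separated V lam k t p ^+ 2) = (expR (- lam * t) ^+ 2 * c')%:E.
  rewrite int_vol_strip// /c' -rect_intZ; last exact: bmM.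
  by congr (rect_int _ _ _)%:E; apply/funext => p; rewrite sep; ring.
have c'le : c' <= 6 * Vw ^+ 2 * (L * (2 * pi)).
  rewrite /c' -rect_int_cst ?(ltW L0)//; apply: rect_int_le; [exact: bmM|exact: bm_cst|].
  move=> [s t] /=; rewrite indicE; have h6 : 0 <= 6 * Vw ^+ 2 by rewrite mulr_ge0 ?sqr_ge0.
  case: (boolP (s \in I)) => [|_]; last by rewrite mul0r.
  rewrite inE mul1r => /hVw hs; rewrite mulrC; apply: ler_pM; rewrite ?sqr_ge0 ?(ltW (r0 s))//.
  rewrite /separated mulr0 expR0 mul1r exprMn -[leRHS]mulr1.
  apply: ler_pM; rewrite ?sqr_ge0//.
    rewrite -[leLHS]real_normK ?num_real//; apply: lerXn2r => //; rewrite nnegrE//.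
    exact: le_trans (normr_ge0 _) hs.
have c'0 : 0 <= c'.
  rewrite -[leLHS](mul0r (L * (2 * pi))) -rect_int_cst ?(ltW L0)//.
  apply: rect_int_le; [exact: bm_cst|exact: bmM|].
  move=> p; apply: mulr_ge0 => //; apply: mulr_ge0; first exact: sqr_ge0.
  exact: ltW (r0 _).
have cexp : continuous (fun t : R => expR (- lam * t) ^+ 2 * c').
  apply: continuous1M; last exact: continuous1cst.
  under eq_fun do rewrite expr2.
  have h (t : R) : is_derive t 1 (fun t : R => expR (- lam * t)) (expR (- lam * t) * (- lam * 1)).
    exact: is_derive1_expR (is_derive1Z (- lam) (is_derive1id t)).
  by apply: continuous1M; exact: continuous1_derive h.
have lexp := lbm_continuous cexp.
under eq_integral do rewrite iE.
rewrite integral_itv_sint ?(ltW T0)// -EFinM lee_fin => h; apply: le_trans h _.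
rewrite ler_wpM2l ?sqr_ge0//.
apply: (@le_trans _ _ (sint (fun=> c') 0 T)); last first.
  by rewrite sint_cst subr0 mulrC ler_wpM2l// ltW.
apply: le_sint; [exact: lexp|exact: lbm_cst|exact: ltW|].
move=> t /andP[t0 _]; rewrite ler_piMl// exprn_ile1 ?expR_ge0//.
by rewrite -[leRHS]expR0 ler_expR mulNr oppr_le0 mulr_ge0.
Qed.

End Observation.

(** * Assembly of the lower bound on the observation time *)

Lemma expR_gt_square (R : realType) (c : R) : exists b0, forall b, b0 <= b -> c * b ^+ 2 < expR b.
Proof.
exists (27 * (`|c| + 1)) => b hb.
have c0 := normr_ge0 c; have b0 : 0 < b by lra.
have h : (b / 3) ^+ 3 <= expR b.
  have -> : expR b = expR (b / 3) ^+ 3 by rewrite -expRM_natl; congr expR; field.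
  apply: lerXn2r; rewrite ?nnegrE ?expR_ge0 ?divr_ge0 ?(ltW b0)//.
  by apply: le_trans (expR_ge1Dx _); rewrite lerDr.
apply: lt_le_trans h; rewrite exprMn exprVn exprS.
have b20 : 0 < b ^+ 2 by rewrite exprn_gt0.
have -> : b * b ^+ 2 / 3 ^+ 3 = (b / 27) * b ^+ 2 by field.
rewrite ltr_pM2r//; have := ler_norm c; lra.
Qed.

(** [q] is set to zero where it exceeds its essential bound; that set is periodic because [q] is. *)
Lemma essentially_bounded_modification (R : realType) (L : R) (q : R -> R) :
  Linfty_circle L q -> exists qb : R -> R, [/\ measurable_fun setT qb, periodic qb L,
    exists M : R, forall s, `|qb s| <= M &
    {ae lebesgue_measure, forall s, q s = qb s}].
Proof.
move=> [pq mq [M hM]]; pose A := [set s | `|q s| <= M].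
have mA : measurable A.
  have mnq : measurable_fun setT (fun s => `|q s|) by apply: measurableT_comp mq.
  have -> : A = [set: R] `&` (fun s => `|q s|) @^-1` `]-oo, M]%classic.
    by rewrite setTI; apply/seteqP; split => s /=; rewrite in_itv.
  by apply: mnq => //; exact: measurable_itv.
exists (fun s => \1_A s * q s); split.
- by apply: measurable_funM => //; exact: measurable_indic.
- move=> s; rewrite pq; congr (_ * _); rewrite !indicE; congr ((_ : bool)%:R).
  by apply/idP/idP; rewrite !inE /A /= pq.
- exists `|M| => s; rewrite indicE; case: (boolP (s \in A)) => [|_].
    by rewrite inE mul1r => h; apply: le_trans h (ler_norm _).
  by rewrite mul0r normr0.
- have [B [mB B0 hB]] := hM; exists B; split => // s ns; apply: hB => h; apply: ns.
  by rewrite /= indicE mem_set ?mul1r.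
Qed.

(** Here [xG] bounds the decay up to [T] from below, and [xG ^+ 2] is the Agmon factor: after
    squaring, [xG ^+ 2] stands on the left and [xG ^+ 4] on the right. The surplus [xG ^+ 2] has to
    beat the weights [xt] and [xF]. *)
Lemma unobservable_aux (R : realType) (xG xt xF y e m c b K T L p : R) :
  0 < xG -> 0 < xt -> 0 < xF -> 0 < m -> 0 < c -> 0 < b -> 0 < p -> 0 <= T -> 0 <= L ->
  xt ^+ 4 * xF ^+ 2 * xG ^+ 2 <= y ->
  xG ^+ 2 * (p * (e / xt ^+ 2 * (m ^+ 2 / (8 * (c * b ^+ 2 * xF ^+ 2))))) <=
    K ^+ 2 * (T * (6 * (xt * (2 * m * xG ^+ 2)) ^+ 2 * (L * (2 * p)))) ->
  e <= 384 * K ^+ 2 * T * L * c * b ^+ 2 * y.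
Proof.
move=> G0 t0 F0 m0 c0 b0 p0 T0 L0 hy h.
pose N := xt ^+ 2 * (8 * (c * b ^+ 2 * xF ^+ 2)) / (p * m ^+ 2 * xG ^+ 2).
have N0 : 0 <= N.
  by rewrite /N !(mulr_ge0, invr_ge0, exprn_ge0)// ltW.
have := ler_wpM2r N0 h.
have -> : xG ^+ 2 * (p * (e / xt ^+ 2 * (m ^+ 2 / (8 * (c * b ^+ 2 * xF ^+ 2))))) * N = e.
  by rewrite /N; field; rewrite !gt_eqF.
have -> : K ^+ 2 * (T * (6 * (xt * (2 * m * xG ^+ 2)) ^+ 2 * (L * (2 * p)))) * N =
    384 * K ^+ 2 * T * L * c * b ^+ 2 * (xt ^+ 4 * xF ^+ 2 * xG ^+ 2).
  by rewrite /N; field; rewrite !gt_eqF.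
have hc : 0 <= 384 * K ^+ 2 * T * L * c * b ^+ 2.
  apply: mulr_ge0 (sqr_ge0 b); apply: mulr_ge0 (ltW c0); apply: mulr_ge0 L0.
  by apply: mulr_ge0 T0; exact: mulr_ge0 (ler0n R 384) (sqr_ge0 K).
by move=> h'; exact: le_trans h' (ler_wpM2l hc hy).
Qed.

Lemma unif_lower_bound (R : realType) (L a b : R) (f q : R -> R) :
  0 < L -> smooth_circle L f -> Linfty_circle L q -> a < b -> b < a + L ->
  exists2 C : R, 0 < C & forall delta : R, 0 < delta -> delta < 1 ->
  exists r : R -> R, [/\ smooth_circle L r, forall s, 0 < r s,
    exists2 s1, (forall s, r s1 <= r s) & r s1 = Num.sqrt delta &
    ((C / Num.sqrt delta)%:E <= T_unif L (revolution_metric r)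
       (fun p => f p.1)%R (fun p => q p.1)%R (circle_interval L a b `*` [set: R]))%E].
Proof.
move=> L0 sf hq ab baL.
have [pq mq _] := hq.
have [qb [mqb pqb bqb qqb]] := essentially_bounded_modification hq.
have lqb : lbm qb by split => //; have [M hM] := bqb; move=> x y; exists M.
have [qm [c0 [Th [g0 ceta peta hT pT]]]] := periodic_primitive L0 mqb bqb pqb.
set eta := (fun s => _) in ceta peta hT.
pose df := (f^`()%classic : R -> R); pose ddf := (df^`()%classic : R -> R).
have sdf : smooth_circle L df := smooth_derive1 sf.
have sddf : smooth_circle L ddf := smooth_derive1 sdf.
have hf (s : R) : is_derive s 1 f (df s) by exact: smooth_is_derive s sf.
have hdf (s : R) : is_derive s 1 df (ddf s) by exact: smooth_is_derive s sdf.
have cdf : continuous df := smooth_continuous sdf.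
have cddf : continuous ddf := smooth_continuous sddf.
have cf : continuous f := smooth_continuous sf.
have [pf pdf pddf] : [/\ periodic f L, periodic df L & periodic ddf L].
  by split; [exact: sf.1|exact: sdf.1|exact: sddf.1].
have cT : continuous Th := continuous1_derive hT.
have cc := @continuous1M R; have ck := @continuous1cst R.
have [||A A0 hA] := periodic_bounded L0 (f := fun s => eta s ^+ 2 + eta s * df s).
- by move=> s; rewrite peta pdf.
- by apply: continuous1D; [under eq_fun do rewrite expr2|]; exact: cc.
have [||B B0 hB] := periodic_bounded L0 (f := fun s => df s + 2 * eta s).
- by move=> s; rewrite peta pdf.
- by apply: continuous1D => //; exact: cc.
have [||F0 F00 hF] := periodic_bounded L0 (f := fun s => f s + 2 * Th s).
- by move=> s; rewrite pT pf.
- by apply: continuous1D => //; exact: cc.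
have [th0 th00 hth] := periodic_bounded L0 pT cT.
(* The complement of the interval, of length [4 * l], is centred at [s0]; the interval is then at
   distance [2 * l], one [l] for the well and one for the decay. *)
pose l := (a + L - b) / 4; have l0 : 0 < l by rewrite divr_gt0//; lra.
have lE : 4 * l = a + L - b by rewrite /l; field.
have lL : 4 * l < L by lra.
pose s0 := b + 2 * l.
have shift (x : R) : a < x -> x < b -> s0 + 2 * l <= x + L <= s0 + L - 2 * l.
  by move=> h1 h2; rewrite /s0; apply/andP; split; lra.
have kl0 : 0 <= 8 * (4 * th0 + 2 * F0 + 1) / l.
  by rewrite divr_ge0 ?(ltW l0)// mulr_ge0//; lra.
(* A sum of nonnegative terms, each covering one requirement; the final 1 gives [kap <= kap ^+ 2].
   The term with [l] lets the Agmon gain beat the weights, uniformly in [e < 1]. *)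
pose kap := 36 * (A + 1) + 16 * (A + 1 + (B + 1) ^+ 2) + 4 * (B + 1) +
  8 * (4 * th0 + 2 * F0 + 1) / l + 1.
have B20 : 0 <= (B + 1) ^+ 2 by exact: sqr_ge0.
have kap1 : 1 <= kap by rewrite /kap; lra.
have kap0 : 0 < kap by lra.
have kapk : kap <= kap ^+ 2 by rewrite expr2 ler_peMl// ltW.
have k1 : 36 * (A + 1) <= kap ^+ 2 by apply: le_trans kapk; rewrite /kap; lra.
have k2 : 16 * (A + 1 + (B + 1) ^+ 2) <= kap ^+ 2 by apply: le_trans kapk; rewrite /kap; lra.
have k3 : 4 * (B + 1) <= kap by rewrite /kap; lra.
have k4 : 8 * (4 * th0 + 2 * F0 + 1) <= kap * l.
  by rewrite -ler_pdivrMr// /kap; lra.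
exists (l / (2 * kap)); first by rewrite divr_gt0// mulr_gt0.
move=> delta d0 d1; pose e := Num.sqrt delta.
have e0 : 0 < e by rewrite sqrtr_gt0.
have e1 : e < 1 by rewrite -sqrtr1 ltr_sqrt.
have l2L : 2 * l < L by lra.
have [r [sr rb [s1 rs1] rsmall [eta0 eta00 rlarge]]] := profile_exists s0 l0 l2L e0 e1.
have r0 s : 0 < r s by have /andP[h _] := rb s; exact: lt_le_trans h.
exists r; split => //.
  by exists s1 => // s; rewrite rs1; have /andP[] := rb s.
pose dr := (r^`()%classic : R -> R).
have sdr : smooth_circle L dr := smooth_derive1 sr.
have hr (s : R) : is_derive s 1 r (dr s) by exact: smooth_is_derive s sr.
have cdr : continuous dr := smooth_continuous sdr.
have [pr pdr] : periodic r L /\ periodic dr L by split; [exact: sr.1|exact: sdr.1].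
have [beta0 [c [beta01 cpos loc]]] := localized_eigenfunction qm L0 l0 lL e0 e1 hr hf hT
  cdr cdf ceta pr pdr pf pdf peta pT rb rsmall eta00 rlarge hA hB hF kap0 k1 k2 k3.
apply: le_ereal_inf_tmp => _ [T [T0 [K0 [eps0 [K00 eps00 obs]]]] <-].
rewrite lee_fin leNgt; apply/negP => Tlt.
have [b1 hb1] := expR_gt_square (384 * K0 ^+ 2 * T * L * c / e).
(* Beyond [X] the eigenfunction exists, the exponential beats the square, and [eps] is below
   [eps0]. *)
pose X := Num.max (Num.max beta0 b1) (eps0^-1 + 1).
have [k hk] : exists k : nat, `|kap * X| < k%:R.
  by exists (Num.truncn `|kap * X|).+1; exact: truncnS_gt.
(* The angular frequency is an integer: beta is chosen with kap * beta = k. *)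
pose beta := k%:R / kap.
have bX : X < beta.
  by rewrite /beta ltr_pdivlMr// mulrC; exact: le_lt_trans (ler_norm _) hk.
have kb : k%:R = kap * beta by rewrite /beta mulrC divfK// gt_eqF.
move: bX; rewrite !gt_max => /andP[/andP[/ltW bb0 /ltW bb1] beps].
have beta1 : 1 <= beta by exact: le_trans bb0.
have betap : 0 < beta by exact: lt_le_trans beta1.
have k0 : (0 < k)%N by rewrite -(ltr_nat R) kb mulr_gt0.
pose eps := beta^-1.
have epsp : 0 < eps by rewrite invr_gt0.
have eb : eps * beta = 1 by rewrite mulVf// gt_eqF.
have epslt : eps < eps0.
  rewrite /eps -[eps0]invrK ltf_pV2 ?posrE ?invr_gt0//.
  by apply: lt_trans beps; rewrite ltrDl.
have [mu [w [z [m [/andP[mu0 mule] [sol pw pz] m0 wsmall mass]]]]] := loc beta bb0.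
have hE := sl_E_derive e0 hr hf hT rb beta.
have cW : continuous (sl_W kap r dr df eta qm beta).
  exact: (@sl_W_continuous R e kap r dr df eta qm e0 hr cdr cdf ceta rb beta).
have pE := sl_E_periodic pr pf pT beta.
have weak := conj_V_weak r0 hr cdr cdf lqb pr eb kb g0 ceta hT pT hE (fun s => erefl _) pE cW
  sol pw pz.
have hV := conj_V_derive beta hT sol.
have cdV := conj_dV_continuous ceta hT hE sol.
have pV := conj_V_periodic beta pT pw.
have sol_t := separated_solution L0 r0 hr hf hdf hV cdr cddf cdV pr pdr pdf pddf pV mq mqb
  bqb qqb weak.
have L2u : L2_torus (revolution_metric r) L (separated (conj_V Th w beta) (eps * mu) k 0).
  by case: sol_t => /(_ 0 (lexx _)).
have hobs := obs eps epsp epslt _ _ L2u sol_t.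
have r06 s : 0 < r s <= 6 by rewrite r0/=; have /andP[] := rb s.
pose xt := expR (beta * th0); pose xF := expR (beta * F0).
pose xG := expR (- (kap * beta * l / (16 * e))).
have xG2 : expR (- (beta * kap * l / (8 * e))) = xG ^+ 2.
  by rewrite /xG -expRM_natl; congr expR; field; rewrite gt_eqF.
have xF2 : expR (2 * (beta * F0)) = xF ^+ 2 by rewrite -expRM_natl.
have hTle s : beta * Th s <= beta * th0.
  by rewrite ler_pM2l//; exact: le_trans (ler_norm _) (hth s).
have hTge s : - (beta * th0) <= beta * Th s.
  by rewrite -mulrN ler_pM2l// lerNl; apply: le_trans (hth s); rewrite -normrN ler_norm.
have hVw s : circle_interval L a b s -> `|conj_V Th w beta s| <= xt * (2 * m * xG ^+ 2).
  (* The extra period brings the point to the right of [s0], into the window where the decay is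
     known. *)
  move=> [j [h1 h2]]; rewrite -(periodic_int pV (j + 1)) intrD mulrDl mul1r addrA.
  rewrite normrM ger0_norm ?expR_ge0//; apply: ler_pM => //.
    by rewrite ler_expR.
  by rewrite -xG2; exact: wsmall (shift _ h1 h2).
have lam0 : 0 <= eps * mu by rewrite mulr_ge0// ltW.
have obound := observability_bound L0 r06 hr hV pr pV k0 (circle_interval_measurable L a b)
  hVw lam0 T0 hobs.
have xt0 : 0 < xt by exact: expR_gt0.
have xF0 : 0 < xF by exact: expR_gt0.
have xG0 : 0 < xG by exact: expR_gt0.
have lower : e / xt ^+ 2 * (m ^+ 2 / (8 * (c * beta ^+ 2 * xF ^+ 2))) <=
    sint (fun s => conj_V Th w beta s ^+ 2 * r s) 0 L.
  have cw : continuous w := continuous1_derive sol.1.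
  have cV := continuous1_derive hV.
  have lw : lbm (fun s => w s ^+ 2).
    by apply: lbm_continuous; under eq_fun do rewrite expr2; exact: continuous1M.
  rewrite -xF2; apply: le_trans (_ : e / xt ^+ 2 * sint (fun s => w s ^+ 2) 0 L <= _).
    by apply: ler_wpM2l mass; rewrite divr_ge0 ?sqr_ge0// ltW.
  rewrite -sintZ//; apply: le_sint => //.
  - exact: lbmZ.
  - apply: lbmM; last by apply: lbm_continuous; exact: continuous1_derive hr.
    by apply: lbm_continuous; under eq_fun do rewrite expr2; exact: continuous1M.
  - exact: ltW.
  move=> t _; have /andP[er _] := rb t.
  have hx : xt^-1 <= expR (beta * Th t) by rewrite -expRN ler_expR.
  have hx2 : (xt ^+ 2)^-1 <= expR (beta * Th t) ^+ 2.
    by rewrite -exprVn; apply: lerXn2r hx; rewrite nnegrE ?invr_ge0 ?expR_ge0.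
  rewrite (_ : conj_V Th w beta t ^+ 2 * r t = r t * expR (beta * Th t) ^+ 2 * w t ^+ 2); last first.
    by rewrite /conj_V; ring.
  apply: (@ler_wpM2r _ (w t ^+ 2)); first exact: sqr_ge0.
  by apply: ler_pM => //; rewrite ?invr_ge0 ?sqr_ge0// ltW.
(* With [T < l / (2 * kap * e)], the bound [kap ^+ 2 / 8 * beta] on the decay rate gives at most
   half the Agmon exponent. *)
have lamT : xG <= expR (- (eps * mu) * T).
  rewrite ler_expR mulNr lerN2.
  have h1 : eps * mu <= kap ^+ 2 / 8 * beta.
    apply: le_trans (ler_wpM2l (ltW epsp) mule) _.
    by rewrite [leLHS](_ : _ = kap ^+ 2 / 8 * beta * (eps * beta)); [rewrite eb mulr1|ring].
  apply: le_trans (ler_pM lam0 (ltW T0) h1 (ltW Tlt)) _.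
  rewrite [leLHS](_ : _ = kap * beta * l / (16 * e))//.
  by rewrite -/e; field; rewrite !gt_eqF.
have hy : xt ^+ 4 * xF ^+ 2 * xG ^+ 2 <= expR (- beta).
  rewrite -!expRM_natl -!expRD ler_expR.
  have h1 : 8 * (4 * th0 + 2 * F0 + 1) <= kap * l / e.
    by apply: le_trans k4 _; rewrite ler_pdivlMr//; exact: ler_piMr (mulr_ge0 (ltW kap0) (ltW l0)) (ltW e1).
  have := ler_wpM2l (ltW betap) h1.
  have -> : 4 * (beta * th0) + 2 * (beta * F0) + 2 * - (kap * beta * l / (16 * e)) =
      - beta + (beta * (8 * (4 * th0 + 2 * F0 + 1)) - beta * (kap * l / e)) / 8.
    by field; rewrite gt_eqF.
  by rewrite gerDl pmulr_lle0 ?invr_gt0// subr_le0.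
have final := @unobservable_aux R xG xt xF (expR (- beta)) e m c beta K0 T L pi xG0 xt0 xF0 m0
  cpos betap (pi_gt0 R) (ltW T0) (ltW L0) hy.
have : e <= 384 * K0 ^+ 2 * T * L * c * beta ^+ 2 * expR (- beta).
  apply: final; apply: le_trans obound; apply: ler_pM.
  - exact: sqr_ge0.
  - rewrite mulr_ge0 ?pi_ge0// mulr_ge0//.
      by rewrite divr_ge0 ?sqr_ge0// ltW.
    apply: divr_ge0 (sqr_ge0 _) _; apply: mulr_ge0 (ler0n R 8) _.
    by apply: mulr_ge0 (mulr_ge0 (ltW cpos) (sqr_ge0 _)) (sqr_ge0 _).
  - by apply: lerXn2r lamT; rewrite nnegrE expR_ge0.
  - by apply: ler_wpM2l lower; exact: pi_ge0.
apply/negP; rewrite -ltNge.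
have := hb1 beta bb1; rewrite mulrAC ltr_pdivrMr// => h.
rewrite expRN; have E0 := expR_gt0 beta.
by rewrite (ltr_pdivrMr _ _ E0) [ltRHS]mulrC.
Qed.

Theorem corollary1p10 (R : realType) (L : R) (f q : R -> R) (I : set R)
  (hL : 0 < L)
  (hf : smooth_circle L f)
  (hq : Linfty_circle L q)
  (hI : open_interval_circle L I)
  (hI0 : I !=set0)
  (hIcl : closure I <> setT) :
  exists C : R, 0 < C /\
  forall delta : R, 0 < delta -> delta < 1 ->
  exists r : R -> R,
    let g := revolution_metric r in
    let F := fun p : R * R => f p.1 in
    let Q := fun p : R * R => q p.1 in
    let omega := I `*` [set: R] in
    [/\ smooth_circle L r /\ (forall s, 0 < r s),
        [/\ forall u : R * R -> R, smooth_torus L u ->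
              forall p, inner g p (grad g F p) (grad g u p)
                        = f^`()%classic p.1 * pderiv 0 u p,
            GCC (grad g F) omega <-> (forall s, ~ I s -> f^`()%classic s != 0) &
            GCC (grad g F) omega ->
              T_GCC (grad g F) omega =
                `| \int[lebesgue_measure]_(s in circle_dom L `&` ~` I)
                     ((f^`()%classic s)^-1)%:E |%E /\
              (T_GCC (grad g F) omega < +oo)%E],
        ((C / Num.sqrt delta)%:E <= T_unif L g F Q omega)%E &
        exists s0, [/\ forall s, r s0 <= r s,
                       Num.sqrt delta * (1 - C * delta) <= r s0
                     & r s0 <= Num.sqrt delta]].
Proof.
have [a [b [IE ab baL _]]] := open_interval_circle_normal hL hI hI0 hIcl.
have [C C0 hC] := unif_lower_bound hL hf hq ab baL.
exists C; split=> // delta d0 d1.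
have [r [sr r0 [s1 s1min s1E] hT]] := hC delta d0 d1; exists r => g F Q omega.
split; [by []| | |].
- split.
  + by move=> u _ p; exact: inner_grad_revolution.
  + exact: GCC_nonvanishing hL hf r0 hI hI0 hIcl.
  + exact: T_GCC_integral hL hf r0 hI hI0 hIcl.
- rewrite /omega IE; exact: hT.
(* The minimum of the profile is exactly the square root of delta, so any positive [C] fits and the
   constant of the time bound can be kept. *)
- have d1C : 1 - C * delta <= 1 by rewrite gerBl mulr_ge0// ltW.
  exists s1; split; first by [].
  + by rewrite s1E; exact: ler_piMr (sqrtr_ge0 _) d1C.
  + by rewrite s1E.
Qed.
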